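(* Let $A$ be a finite dimensional $k$-algebra over a field $k$ with finite strong global dimension $\operatorname{s.gl.dim}A=\nu\ge 1$, let $m\ge 2$, and let $\mathcal{F}_m:\mathbf{C}^b(\operatorname{proj}A)\to\mathbf{C}_{\equiv m}(\operatorname{proj}A)$ be the compression functor. Then each almost split sequence in $\mathbf{C}_{\equiv m}(\operatorname{proj}A)$ is the image under $\mathcal{F}_m$ of the shift of an almost split sequence in $\mathbf{C}_{[1,\nu+1]}(\operatorname{proj}A)$.
   Context: $\operatorname{proj}A$ is the category of finitely generated projective $A$-modules. $\mathbf{C}^b(\operatorname{proj}A)$ is the category of bounded cochain complexes and $\mathbf{K}^b(\operatorname{proj}A)$ its homotopy category; $\mathbf{C}_{[1,n]}(\operatorname{proj}A)$, for $n\ge2$, is the full subcategory of $\mathbf{C}^b(\operatorname{proj}A)$ of complexes with $X^i=0$ for $i\notin[1,n]$. The strong global dimension is $\operatorname{s.gl.dim}A=\sup\{\ell(X): X\in\mathbf{K}^b(\operatorname{proj}A)\text{ indecomposable}\}$, where $\ell(X)$ is the least $b-a$ such that $X$ is isomorphic in $\mathbf{K}^b(\operatorname{proj}A)$ to a complex concentrated in degrees $[a,b]$. The shift $X[t]$ has $X[t]^i=X^{i+t}$ and differential $(-1)^td_X^{i+t}$. $\mathbf{C}_{\equiv m}(\operatorname{proj}A)$ is the category of $m$-periodic complexes: complexes $X=(X^i,d_X^i)_{i\in\mathbb{Z}}$ with $X^i=X^j$, $d_X^i=d_X^j$ whenever $i\equiv j\pmod m$; morphisms are chain maps $(f^i)$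 with $f^i=f^j$ whenever $i\equiv j\pmod m$. The compression functor is given by $\mathcal{F}_m(X)^i=\bigoplus_{t\in\mathbb{Z}}X^{i+tm}$ with diagonal differential with components $d_X^{i+tm}$, and $\mathcal{F}_m(f)^i$ is diagonal with components $f^{i+tm}$. All these categories carry the exact structure whose conflations $X\to Y\to Z$ are split exact in each degree. An almost split sequence is a conflation $X\xrightarrow{f}Y\xrightarrow{g}Z$ with $f$ minimal left almost split and $g$ minimal right almost split in the category considered. Sequences are considered up to isomorphism. *)

(* Defs.v *)
From HB Require Import structures.
From mathcomp Require Import all_boot all_order all_algebra falgebra.
From mathcomp Require Import boolp classical_sets cardinality zify.

Set Implicit Arguments.
Unset Strict Implicit.
Unset Printing Implicit Defensive.

Import Order.TTheory GRing.Theory Num.Theory.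
Local Open Scope classical_set_scope.
Local Open Scope ring_scope.

Section Split.
Variables m n : nat.

Lemma split_lshift (j : 'I_m) : split (lshift n j) = inl j.
Proof. exact: (unsplitK (inl j)). Qed.

Lemma split_rshift (j : 'I_n) : split (rshift m j) = inr j.
Proof. exact: (unsplitK (inr j)). Qed.

End Split.

Section Modules.
Variable A : nzRingType.

Definition finitely_generated (M : lmodType A) : Prop :=
  exists (n : nat) (e : 'I_n -> M),
    forall x : M, exists c : 'I_n -> A, x = \sum_(i < n) c i *: e i.

Definition projective (M : lmodType A) : Prop :=
  forall (N L : lmodType A) (p : {linear N -> L}) (f : {linear M -> L}),
    (forall y, exists x, p x = y) ->
    exists h : {linear M -> N}, forall x, p (h x) = f x.

Definition zero_module (M : lmodType A) : Prop := forall x : M, x = 0.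

Record projmod := ProjMod {
  pm_sort :> lmodType A;
  pm_fg : finitely_generated pm_sort;
  pm_proj : projective pm_sort }.

Definition mk_linear (M N : lmodType A) (f : M -> N) (lf : linear f) :
    {linear M -> N} :=
  HB.pack f (GRing.isLinear.Build A M N *:%R f lf).

Lemma prod_fg (M N : lmodType A) :
  finitely_generated M -> finitely_generated N ->
  finitely_generated (M * N)%type.
Proof.
move=> [m [e He]] [n [f Hf]]; exists (m + n)%N.
exists (fun i => match split i with inl j => (e j, 0) | inr j => (0, f j) end).
move=> [x y]; have [c ->] := He x; have [d ->] := Hf y.
exists (fun i => match split i with inl j => c j | inr j => d j end).
rewrite big_split_ord /=.
under [X in _ = X + _]eq_bigr => i _ do rewrite split_lshift.
under [X in _ = _ + X]eq_bigr => i _ do rewrite split_rshift.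
rewrite [RHS]surjective_pairing /=; congr (_, _).
  rewrite !(raddf_sum (@fst M N)) [X in _ + X]big1 ?addr0 //.
  by move=> i _ /=; rewrite scaler0.
rewrite !(raddf_sum (@snd M N)) [X in X + _]big1 ?add0r //.
by move=> i _ /=; rewrite scaler0.
Qed.

Lemma prod_proj (M N : lmodType A) :
  projective M -> projective N -> projective (M * N)%type.
Proof.
move=> PM PN K L p f sp.
have lf1 : linear (fun x : M => f (x, 0)).
  by move=> a x y; rewrite -linearP; congr (f _); congr pair; rewrite /= scaler0 addr0.
have lf2 : linear (fun x : N => f (0, x)).
  by move=> a x y; rewrite -linearP; congr (f _); congr pair; rewrite /= scaler0 addr0.
have [h1 Hh1] := PM _ _ p (mk_linear lf1) sp.
have [h2 Hh2] := PN _ _ p (mk_linear lf2) sp.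
have lh : linear (fun x : (M * N)%type => h1 x.1 + h2 x.2).
  by move=> a x y /=; rewrite !linearP scalerDr addrACA.
exists (mk_linear lh) => -[x y] /=; rewrite linearD Hh1 Hh2 /= -linearD.
by congr (f _); congr pair; rewrite /= ?addr0 ?add0r.
Qed.

Definition prod_projmod (M N : projmod) : projmod :=
  ProjMod (prod_fg (pm_fg M) (pm_fg N)) (prod_proj (@pm_proj M) (@pm_proj N)).

End Modules.

(* The direct sum over an arbitrary index set, as finitely supported dependent
   functions. *)

Section DirectSum.
Variables (A : nzRingType) (I : Type) (M : I -> lmodType A).

Record dsum := DSum {
  dsum_fun :> forall i, M i;
  dsum_finite : finite_set [set i | dsum_fun i != 0] }.

HB.instance Definition _ := gen_eqMixin dsum.
HB.instance Definition _ := gen_choiceMixin dsum.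

Lemma dsumP (x y : dsum) : (forall i, x i = y i) -> x = y.
Proof.
case: x y => [x Hx] [y Hy] /= xy.
have {}xy : x = y by apply: functional_extensionality_dep.
by subst y; congr DSum; apply: Prop_irrelevance.
Qed.

Lemma dsum0_subproof : finite_set [set i | (fun i => 0 : M i) i != 0].
Proof. by apply: (@sub_finite_set _ _ set0) => // i /=; rewrite eqxx. Qed.
Definition dsum0 := DSum dsum0_subproof.

Lemma dsumN_subproof (x : dsum) : finite_set [set i | - x i != 0].
Proof.
by apply: sub_finite_set (dsum_finite x) => i /=; rewrite oppr_eq0.
Qed.
Definition dsumN x := DSum (dsumN_subproof x).

Lemma dsumD_subproof (x y : dsum) : finite_set [set i | x i + y i != 0].
Proof.
have := conj (dsum_finite x) (dsum_finite y); rewrite -finite_setU.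
apply: sub_finite_set => i /= xy; case: (eqVneq (x i) 0) => [x0|]; last by left.
by right; apply: contra xy => /eqP->; rewrite x0 addr0.
Qed.
Definition dsumD x y := DSum (dsumD_subproof x y).

Lemma dsumZ_subproof (a : A) (x : dsum) : finite_set [set i | a *: x i != 0].
Proof.
apply: sub_finite_set (dsum_finite x) => i /=.
by apply: contra => /eqP->; rewrite scaler0.
Qed.
Definition dsumZ a x := DSum (dsumZ_subproof a x).

Lemma dsumDA : associative dsumD.
Proof. by move=> x y z; apply: dsumP => i; apply: addrA. Qed.
Lemma dsumDC : commutative dsumD.
Proof. by move=> x y; apply: dsumP => i; apply: addrC. Qed.
Lemma dsum0D : left_id dsum0 dsumD.
Proof. by move=> x; apply: dsumP => i; apply: add0r. Qed.
Lemma dsumND : left_inverse dsum0 dsumN dsumD.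
Proof. by move=> x; apply: dsumP => i; apply: addNr. Qed.

HB.instance Definition _ :=
  GRing.isZmodule.Build dsum dsumDA dsumDC dsum0D dsumND.

Lemma dsumZA (a b : A) (x : dsum) : dsumZ a (dsumZ b x) = dsumZ (a * b) x.
Proof. by apply: dsumP => i; apply: scalerA. Qed.
Lemma dsum1Z : left_id 1 dsumZ.
Proof. by move=> x; apply: dsumP => i; apply: scale1r. Qed.
Lemma dsumZDr : right_distributive dsumZ +%R.
Proof. by move=> a x y; apply: dsumP => i; apply: scalerDr. Qed.
Lemma dsumZDl (x : dsum) : {morph dsumZ^~ x : a b / a + b}.
Proof. by move=> a b; apply: dsumP => i; apply: scalerDl. Qed.

HB.instance Definition _ :=
  GRing.Zmodule_isLmodule.Build A dsum dsumZA dsum1Z dsumZDr dsumZDl.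

End DirectSum.

Section DirectSumProj.
Variables (A : nzRingType) (I : eqType) (M : I -> lmodType A).

Lemma dinj_subproof i (x : M i) :
  finite_set [set j | dfwith (fun j => 0 : M j) x j != 0].
Proof.
apply: (@sub_finite_set _ _ [set i]) => // j /=.
by case: dfwithP => //= k _; rewrite eqxx.
Qed.
Definition dinj i (x : M i) : dsum M := DSum (dinj_subproof x).

Lemma dinj_linear i : linear (@dinj i).
Proof.
move=> a x y; apply: dsumP => j /=.
have [<-|ij] := eqVneq i j; first by rewrite /= !dfwith_in.
by rewrite !dfwith_out //= scaler0 addr0.
Qed.

Lemma dsum_sumE (J : Type) (r : seq J) (F : J -> dsum M) i :
  (\sum_(j <- r) F j) i = \sum_(j <- r) F j i.
Proof. by elim: r => [|j r IH]; rewrite ?big_nil // !big_cons /= IH. Qed.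

Variable s : seq I.
Hypotheses (us : uniq s) (sM : forall i, i \notin s -> zero_module (M i)).

Lemma dsum_dinjE (x : dsum M) : x = \sum_(i <- s) dinj (x i).
Proof.
apply: dsumP => i; rewrite dsum_sumE.
have [si|/sM Mi0] := boolP (i \in s); last by rewrite (Mi0 (x i)); apply/esym/Mi0.
rewrite (bigD1_seq i) //= dfwith_in big1 ?addr0 // => j ji.
by rewrite dfwith_out.
Qed.

Lemma dsum_fg :
  (forall i, finitely_generated (M i)) -> finitely_generated (dsum M).
Proof.
move=> fgM.
suff H (r : seq I) : exists n (e : 'I_n -> dsum M), forall x : dsum M,
    exists c : 'I_n -> A, \sum_(i <- r) dinj (x i) = \sum_(i < n) c i *: e i.
  have [n [e He]] := H s; exists n, e => x.
  by have [c Hc] := He x; exists c; rewrite -Hc -dsum_dinjE.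
elim: r => [|i r [n [e He]]].
  exists 0%N, (fun=> 0) => x; exists (fun=> 0).
  by rewrite big_nil big_ord0.
have [m [f Hf]] := fgM i; exists (m + n)%N.
exists (fun k => match split k with inl j => dinj (f j) | inr j => e j end).
move=> x; have [c Hc] := Hf (x i); have [d Hd] := He x.
exists (fun k => match split k with inl j => c j | inr j => d j end).
rewrite big_cons Hd big_split_ord /=; congr (_ + _).
  pose D : {linear M i -> dsum M} := mk_linear (@dinj_linear i).
  transitivity (D (\sum_(k < m) c k *: f k)); first by rewrite -Hc.
  by rewrite linear_sum; apply: eq_bigr => k _; rewrite split_lshift linearZ.
by apply: eq_bigr => k _; rewrite split_rshift.
Qed.

Lemma dsum_proj : (forall i, projective (M i)) -> projective (dsum M).
Proof.
move=> pM K L p f sp.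
have lf i : linear (fun x : M i => f (dinj x)).
  by move=> a x y; rewrite dinj_linear linearP.
have lift i : {h : {linear M i -> K} | forall x, p (h x) = f (dinj x)}.
  exact: cid (pM i _ _ p (mk_linear (lf i)) sp).
pose h i : {linear M i -> K} := sval (lift i).
have Hh i (x : M i) : p (h i x) = f (dinj x) by exact: (svalP (lift i) x).
have lh : linear (fun x : dsum M => \sum_(i <- s) h i (x i)).
  move=> a x y; rewrite scaler_sumr -big_split /=.
  by apply: eq_bigr => i _; rewrite linearP.
exists (mk_linear lh) => x /=; rewrite linear_sum [in RHS](dsum_dinjE x).
by rewrite linear_sum; apply: eq_bigr => i _.
Qed.

End DirectSumProj.

Section Complexes.
Variables (A : nzRingType) (I : nzRingType).

(* [I] is [int] for ordinary cochain complexes; for m >= 2 the m-periodic ones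
   are those graded by ['Z_m], since X^i and d_X^i depend on i mod m only.  The differential is a family indexed by
   all pairs of degrees that vanishes off the pairs (i, i + 1); this avoids
   transport along equalities between degrees. *)
Record complex := Complex {
  cob :> I -> projmod A;
  cdiff : forall i j, {linear cob i -> cob j};
  cdiff_shape : forall i j, j <> i + 1 -> forall x, cdiff i j x = 0;
  cdiffK : forall i j l x, cdiff j l (cdiff i j x) = 0 }.

Record cmap (X Y : complex) := CMap {
  cmap_fun :> forall i, {linear X i -> Y i};
  cmap_comm : forall i j x,
    cmap_fun j (cdiff X i j x) = cdiff Y i j (cmap_fun i x) }.

Definition cmap_eq (X Y : complex) (f g : cmap X Y) : Prop :=
  forall i x, f i x = g i x.

Definition cmap_id (X : complex) : cmap X X :=
  @CMap X X (fun i => idfun) (fun i j x => erefl).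

Lemma ccomp_subproof (X Y Z : complex) (g : cmap Y Z) (f : cmap X Y) i j x :
  (g j \o f j) (cdiff X i j x) = cdiff Z i j ((g i \o f i) x).
Proof. by rewrite /= !cmap_comm. Qed.

Definition ccomp (X Y Z : complex) (g : cmap Y Z) (f : cmap X Y) : cmap X Z :=
  @CMap X Z (fun i => g i \o f i) (ccomp_subproof g f).

Section DirectSumComplex.
Variables X Y : complex.

Lemma csum_linear i j :
  linear (fun x : (X i * Y i)%type => (cdiff X i j x.1, cdiff Y i j x.2)).
Proof. by move=> a x y /=; rewrite !linearP. Qed.

Let csum_ob i : projmod A := prod_projmod (X i) (Y i).
Let csum_diff i j : {linear csum_ob i -> csum_ob j} :=
  mk_linear (@csum_linear i j).

Lemma csum_shape i j : j <> i + 1 -> forall x, csum_diff i j x = 0.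
Proof. by move=> ij x /=; rewrite !cdiff_shape. Qed.

Lemma csum_diffK i j l x : csum_diff j l (csum_diff i j x) = 0.
Proof. by rewrite /= !cdiffK. Qed.

Definition csum : complex := Complex csum_shape csum_diffK.

End DirectSumComplex.

Definition section (X Y : complex) (f : cmap X Y) : Prop :=
  exists r : cmap Y X, cmap_eq (ccomp r f) (cmap_id X).

Definition retraction (X Y : complex) (f : cmap X Y) : Prop :=
  exists s : cmap Y X, cmap_eq (ccomp f s) (cmap_id Y).

Definition isomorphism (X Y : complex) (f : cmap X Y) : Prop :=
  exists g : cmap Y X, cmap_eq (ccomp g f) (cmap_id X) /\ cmap_eq (ccomp f g) (cmap_id Y).

Definition conflation (X Y Z : complex) (f : cmap X Y) (g : cmap Y Z) : Prop :=
  forall i, [/\ injective (f i),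
    forall y, g i y = 0 <-> exists x, f i x = y &
    exists s : {linear Z i -> Y i}, forall z, g i (s z) = z].

(* The notions below are relative to the full subcategory of complexes on the
   objects satisfying [C]. *)
Section Subcategory.
Variable C : complex -> Prop.

Definition left_almost_split (X Y : complex) (f : cmap X Y) : Prop :=
  ~ section f /\
  forall W, C W -> forall h : cmap X W, ~ section h ->
    exists h' : cmap Y W, cmap_eq (ccomp h' f) h.

Definition right_almost_split (Y Z : complex) (g : cmap Y Z) : Prop :=
  ~ retraction g /\
  forall W, C W -> forall h : cmap W Z, ~ retraction h ->
    exists h' : cmap W Y, cmap_eq (ccomp g h') h.

Definition left_minimal (X Y : complex) (f : cmap X Y) : Prop :=
  forall e : cmap Y Y, cmap_eq (ccomp e f) f -> isomorphism e.

Definition right_minimal (Y Z : complex) (g : cmap Y Z) : Prop :=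
  forall e : cmap Y Y, cmap_eq (ccomp g e) g -> isomorphism e.

Definition almost_split (X Y Z : complex) (f : cmap X Y) (g : cmap Y Z) : Prop :=
  [/\ [/\ C X, C Y & C Z], conflation f g,
      left_almost_split f /\ left_minimal f &
      right_almost_split g /\ right_minimal g].

End Subcategory.

Definition seq_iso (X Y Z X' Y' Z' : complex)
    (f : cmap X Y) (g : cmap Y Z) (f' : cmap X' Y') (g' : cmap Y' Z') : Prop :=
  exists (a : cmap X X') (b : cmap Y Y') (c : cmap Z Z'),
    [/\ isomorphism a, isomorphism b, isomorphism c,
        cmap_eq (ccomp b f) (ccomp f' a) & cmap_eq (ccomp c g) (ccomp g' b)].

End Complexes.

Arguments cmap_id {A I} X.

Section Bounded.
Variable A : nzRingType.

Definition concentrated (a b : int) (X : complex A int) : Prop :=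
  forall i, ~~ (a <= i <= b) -> zero_module (X i).

Record bcomplex := BComplex {
  bc :> complex A int;
  bc_bounded : exists a b, concentrated a b bc }.

Lemma csum_bounded (X Y : bcomplex) :
  exists a b, concentrated a b (csum X Y).
Proof.
have [a [b Xab]] := bc_bounded X; have [a' [b' Yab]] := bc_bounded Y.
exists (Num.min a a'), (Num.max b b') => i out -[x y].
congr pair; [apply: Xab|apply: Yab]; apply: contra out => /andP[ai ib];
  by rewrite ge_min le_max ai ib ?orbT.
Qed.

Definition bsum (X Y : bcomplex) : bcomplex := BComplex (csum_bounded X Y).

(* The homotopy is given on all pairs of degrees; only its values on the pairs (i, i - 1)
   matter. *)
Definition homotopic (X Y : complex A int) (f g : cmap X Y) : Prop :=
  exists s : forall i j, {linear X i -> Y j}, forall i x,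
    f i x - g i x = cdiff Y (i - 1) i (s i (i - 1) x)
                    + s (i + 1) i (cdiff X i (i + 1) x).

Definition K_iso (X Y : bcomplex) : Prop :=
  exists (f : cmap X Y) (g : cmap Y X),
    homotopic (ccomp g f) (cmap_id X) /\ homotopic (ccomp f g) (cmap_id Y).

Definition K_zero (X : bcomplex) : Prop :=
  exists O : bcomplex, (forall i, zero_module (O i)) /\ K_iso X O.

Definition K_indecomposable (X : bcomplex) : Prop :=
  ~ K_zero X /\
  forall Y Z : bcomplex, K_iso X (bsum Y Z) -> K_zero Y \/ K_zero Z.

Definition is_length (X : bcomplex) (l : nat) : Prop :=
  let widths := [set n : nat | exists (a : int) (Y : bcomplex),
                   concentrated a (a + n%:Z) Y /\ K_iso X Y] in
  widths l /\ lbound widths l.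

Definition is_sgldim (nu : nat) : Prop :=
  supremums [set l : nat | exists X, K_indecomposable X /\ is_length X l] nu.

Section Shift.
Variables (t : int) (X : bcomplex).

Lemma shift_linear i j :
  linear (fun x : X (i + t) => cdiff X (i + t) (j + t) x *~ (-1) ^ t).
Proof. by move=> a x y; rewrite linearP mulrzDl scalerMzr. Qed.

Let shift_ob i : projmod A := X (i + t).
Let shift_diff i j : {linear shift_ob i -> shift_ob j} :=
  mk_linear (@shift_linear i j).

Lemma shift_shape i j : j <> i + 1 -> forall x, shift_diff i j x = 0.
Proof.
move=> ij x /=; rewrite cdiff_shape ?mul0rz // => /eqP.
by rewrite addrAC (inj_eq (addIr t)) => /eqP.
Qed.

Lemma shift_diffK i j l x : shift_diff j l (shift_diff i j x) = 0.
Proof. by rewrite /= raddfMz /= cdiffK !mul0rz. Qed.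

Lemma shift_bounded :
  exists a b, concentrated a b (Complex shift_shape shift_diffK).
Proof.
have [a [b Xab]] := bc_bounded X; exists (a - t), (b - t) => i out.
have {}out : ~~ (a <= i + t <= b) by move: out; lia.
exact: Xab out.
Qed.

Definition shift : bcomplex := BComplex shift_bounded.

End Shift.

Lemma shift_map_comm (t : int) (X Y : bcomplex) (f : cmap X Y) i j x :
  f (j + t) (cdiff (shift t X) i j x) = cdiff (shift t Y) i j (f (i + t) x).
Proof. by rewrite /= raddfMz /= cmap_comm. Qed.

Definition shift_map (t : int) (X Y : bcomplex) (f : cmap X Y) :
    cmap (shift t X) (shift t Y) :=
  @CMap _ _ (shift t X) (shift t Y) (fun i => f (i + t))
    (@shift_map_comm t X Y f).

End Bounded.

Arguments K_zero {A} X.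
Arguments is_sgldim : clear implicits.

Section Compression.
Variables (A : nzRingType) (m : nat) (m_gt1 : (1 < m)%N).

(* The degree i + tm, with i in Z/m represented in {0, ..., m - 1}. *)
Definition deg (i : 'Z_m) (t : int) : int := (i : nat)%:Z + t * m%:Z.

Definition window (n : nat) : seq int :=
  [seq k%:Z - n%:Z | k <- iota 0 (n.*2).+1].

Lemma window_uniq n : uniq (window n).
Proof. by rewrite map_inj_uniq ?iota_uniq // => k l /addIr []. Qed.

Lemma mem_window n (t : int) : (`|t| <= n%:Z) -> t \in window n.
Proof.
move=> tn; apply/mapP; exists (absz (t + n%:Z)); last by lia.
by rewrite mem_iota; lia.
Qed.

Lemma bounded_window (X : bcomplex A) (i : 'Z_m) :
  exists n, forall t, t \notin window n -> zero_module (X (deg i t)).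
Proof.
have [a [b Xab]] := bc_bounded X.
exists (i + absz a + absz b)%N => t /negP out; apply: Xab; apply/negP => ab.
by apply: out; apply: mem_window; move: ab; rewrite /deg; nia.
Qed.

Section Object.
Variable X : bcomplex A.

Definition comp_sort (i : 'Z_m) : lmodType A :=
  dsum (fun t => X (deg i t) : lmodType A).

Lemma comp_sort_fg i : finitely_generated (comp_sort i).
Proof.
have [n Xn] := bounded_window X i.
by apply: (dsum_fg (window_uniq n)) => // t; apply: pm_fg.
Qed.

Lemma comp_sort_proj i : projective (comp_sort i).
Proof.
have [n Xn] := bounded_window X i.
by apply: (dsum_proj (window_uniq n)) => // t; apply: pm_proj.
Qed.

Definition comp_ob (i : 'Z_m) : projmod A :=
  ProjMod (comp_sort_fg i) (@comp_sort_proj i).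

Lemma comp_finite i (x : forall t, X (deg i t)) :
  finite_set [set t | x t != 0].
Proof.
have [n Xn] := bounded_window X i.
apply: (@sub_finite_set _ _ [set` window n]) => [t /=|].
  by apply: contraR => /Xn/(_ (x t))->.
exact: finite_seq.
Qed.

(* The index t of the summand X^(i + tm) that d_X sends to X^(j + sm), for
   j = i + 1 in Z/m; t differs from s when j = 0. *)
Definition pred_index (j : 'Z_m) (s : int) : int := ((deg j s - 1) %/ m%:Z)%Z.

Lemma pred_indexE (i j : 'Z_m) (t s : int) :
  deg j s = deg i t + 1 -> pred_index j s = t.
Proof.
rewrite /pred_index => ->; rewrite addrK /deg addrC divzMDl; last by lia.
by rewrite divz_nat divn_small ?addr0 // -[leqRHS](Zp_cast m_gt1).
Qed.

Definition comp_diff_fun (i j : 'Z_m) (x : comp_sort i) : comp_sort j :=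
  @DSum _ _ (fun s => X (deg j s) : lmodType A)
    (fun s => let t := pred_index j s in cdiff X (deg i t) (deg j s) (x t))
    (comp_finite _).

Lemma comp_diff_linear i j : linear (@comp_diff_fun i j).
Proof. by move=> a x y; apply: dsumP => s /=; rewrite linearP. Qed.

Definition comp_diff i j : {linear comp_ob i -> comp_ob j} :=
  mk_linear (@comp_diff_linear i j).

Lemma deg_succ (i j : 'Z_m) (t s : int) : deg j s = deg i t + 1 -> j = i + 1.
Proof.
have Em := Zp_cast m_gt1; rewrite /deg => eq_deg; apply: val_inj => /=.
move: (ltn_ord i) (ltn_ord j) eq_deg.
move: (nat_of_ord i) (nat_of_ord j) => {}i {}j; rewrite !Em => lt_i lt_j eq_deg.
rewrite (modn_small m_gt1).
have := congr1 (modz^~ m%:Z) eq_deg.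
rewrite addrAC ![_ + _ * m%:Z]addrC !modzMDl -PoszD !modz_nat => -[].
by rewrite (modn_small lt_j).
Qed.

Lemma comp_diff_shape i j : j <> i + 1 -> forall x, comp_diff i j x = 0.
Proof.
move=> ij x; apply: dsumP => s /=; apply: cdiff_shape.
by move=> /deg_succ.
Qed.

Lemma comp_diffK i j l x : comp_diff j l (comp_diff i j x) = 0.
Proof. by apply: dsumP => s /=; rewrite cdiffK. Qed.

Definition compress : complex A 'Z_m := Complex comp_diff_shape comp_diffK.

End Object.

Section Map.
Variables (X Y : bcomplex A) (f : cmap X Y).

Definition comp_map_fun (i : 'Z_m) (x : comp_sort X i) : comp_sort Y i :=
  @DSum _ _ (fun t => Y (deg i t) : lmodType A)
    (fun t => f (deg i t) (x t)) (comp_finite _).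

Lemma comp_map_linear i : linear (@comp_map_fun i).
Proof. by move=> a x y; apply: dsumP => t /=; rewrite linearP. Qed.

Definition comp_map i : {linear compress X i -> compress Y i} :=
  mk_linear (@comp_map_linear i).

Lemma comp_map_comm i j x :
  comp_map j (cdiff (compress X) i j x) = cdiff (compress Y) i j (comp_map i x).
Proof. by apply: dsumP => s /=; rewrite cmap_comm. Qed.

Definition compress_map : cmap (compress X) (compress Y) := CMap comp_map_comm.

End Map.
End Compression.

(* Main.v *)
From HB Require Import structures.
Require Import Defs.
From mathcomp Require Import all_boot all_order all_algebra falgebra.
From mathcomp Require Import boolp zify.

Set Implicit Arguments.
Unset Strict Implicit.
Unset Printing Implicit Defensive.

Import Order.TTheory GRing.Theory Num.Theory.
Local Open Scope ring_scope.

(** Write F for the compression functor.  A periodic complex is a bounded one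
rolled up, as long as its unrolling decomposes into pieces shorter than the
window through which it is looked at; finite strong global dimension provides
exactly this.

Width.  An indecomposable bounded complex is either contractible, and then
lives in two consecutive degrees, or indecomposable in the homotopy category,
and then it is a direct summand of a complex with at most nu + 1 nonzero terms
([indec_width]).  Both cases rest on Fitting's lemma: endomorphism rings are
finite dimensional, so a complex without nontrivial idempotents has a local
endomorphism ring ([indec_local]).

Density.  Unroll an indecomposable periodic complex M and truncate it to a
window wider than 2 nu.  By the width bound an indecomposable summand N of the
truncation that is nonzero in the middle does not reach the ends of the
window, so it is a summand of the unrolled complex.  By adjunction this gives
maps F N -> M -> F N whose composite has degree-zero part the identity
([local_summand]).  The ring End (F N) is graded by integers with degree-zero
part End N, and the products of parts of opposite nonzero degrees lie in the
radical, since N is bounded.  Moreover a nonzero idempotent has invertible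
degree-zero part, because its image again contains some F N1 up to such maps
([radical_idempotent]).  Hence an endomorphism of F N with invertible
degree-zero part is invertible ([iso_of_degree_zero]), and M is isomorphic to
F N ([density]).

Homogenization.  Let X -> Y -> Z be almost split; by density one may take X =
F N' and Z = F N.  Let theta be its extension class.  It is a sum of
homogeneous components, and one of them is not zero; after a translation of N'
this component is F of an extension N' -> E -> N of bounded complexes.  Since
Y -> Z is right almost split, F E -> F N factors through Y, which induces an
endomorphism a of F N'. If a were not invertible, none of its homogeneous
parts would be, and each of them would kill theta because X -> Y is left
almost split; then they would kill the chosen component too, and Y -> Z would
split.  So a is invertible and the given sequence is isomorphic to F of the
bounded one ([homogeneous_representative]).  As F has a one-sided inverse on
morphisms, the bounded sequence is almost split in the category of all bounded
complexes ([almost_split_reflect]).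

Span.  It remains to place N', E and N in a common interval of nu + 1 degrees.
A nonzero term of N' lies at most nu degrees above a nonzero term of N:
otherwise dividing E by a lift of the part of N above the low degree yields a
complex that touches two degrees too far apart, and separating these degrees
by an idempotent would split the sequence ([span_up]).  A nonzero term of N
lies at most nu degrees above one of N': otherwise one separates degrees first
in E and then in the cone of the irreducible map from N' to the separated
summand of E, and concludes that N' is contractible, hence again that the
sequence splits ([span_down]).  Shifting the common interval to [1, nu + 1]
finishes the proof. *)

(** * The additive category of complexes *)

(** With functional extensionality and proof irrelevance, extensional equality
of chain maps becomes Leibniz equality.  Maps between two complexes then form
an abelian group and endomorphisms a ring, so the general lemmas on big sums
and on powers apply to them. *)
Lemma linear_ext (R : pzRingType) (U V : lmodType R) (f g : {linear U -> V}) :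
  (forall x, f x = g x) -> f = g.
Proof.
case: f g => [f [[Hf] [Sf]]] [g [[Hg] [Sg]]] /= fg.
have {}fg : f = g by apply: funext.
subst g; congr (GRing.Linear.Pack (GRing.Linear.Class _ _));
  congr (_ _); exact: Prop_irrelevance.
Qed.

Notation "g \oc f" := (ccomp g f) (at level 40, left associativity).

Section ChainMaps.
Variables A I : nzRingType.

Lemma cmapP (X Y : complex A I) (f g : cmap X Y) : cmap_eq f g -> f = g.
Proof.
case: f g => [f Hf] [g Hg] /= fg.
have {}fg : f = g.
  by apply: functional_extensionality_dep => i; apply: linear_ext => x; apply: fg.
by subst g; congr CMap; apply: Prop_irrelevance.
Qed.

Section Additive.
Variables X Y : complex A I.

HB.instance Definition _ := gen_eqMixin (cmap X Y).
HB.instance Definition _ := gen_choiceMixin (cmap X Y).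

Lemma czero_comm i j x :
  (\0 : {linear X j -> Y j}) (cdiff X i j x) = cdiff Y i j ((\0 : {linear X i -> Y i}) x).
Proof. by rewrite /= linear0. Qed.
Definition czero : cmap X Y := CMap czero_comm.

Lemma copp_comm (f : cmap X Y) i j x :
  (\- (f j) : {linear X j -> Y j}) (cdiff X i j x)
  = cdiff Y i j ((\- (f i) : {linear X i -> Y i}) x).
Proof. by rewrite /= cmap_comm linearN. Qed.
Definition copp (f : cmap X Y) : cmap X Y := CMap (copp_comm f).

Lemma cadd_comm (f g : cmap X Y) i j x :
  (f j \+ g j : {linear X j -> Y j}) (cdiff X i j x)
  = cdiff Y i j ((f i \+ g i : {linear X i -> Y i}) x).
Proof. by rewrite /= !cmap_comm linearD. Qed.
Definition cadd (f g : cmap X Y) : cmap X Y := CMap (cadd_comm f g).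

Lemma caddA : associative cadd.
Proof. by move=> f g h; apply: cmapP => i x /=; rewrite addrA. Qed.
Lemma caddC : commutative cadd.
Proof. by move=> f g; apply: cmapP => i x /=; rewrite addrC. Qed.
Lemma cadd0 : left_id czero cadd.
Proof. by move=> f; apply: cmapP => i x /=; rewrite add0r. Qed.
Lemma caddN : left_inverse czero copp cadd.
Proof. by move=> f; apply: cmapP => i x /=; rewrite addNr. Qed.

HB.instance Definition _ := GRing.isZmodule.Build (cmap X Y) caddA caddC cadd0 caddN.

Lemma c0E i x : (0 : cmap X Y) i x = 0. Proof. by []. Qed.
Lemma cNE (f : cmap X Y) i x : (- f) i x = - f i x. Proof. by []. Qed.
Lemma cDE (f g : cmap X Y) i x : (f + g) i x = f i x + g i x. Proof. by []. Qed.
Lemma csumE (J : Type) (r : seq J) (F : J -> cmap X Y) i x :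
  (\sum_(j <- r) F j) i x = \sum_(j <- r) F j i x.
Proof. by elim: r => [|j r IH]; rewrite ?big_nil // !big_cons cDE IH. Qed.

End Additive.

Definition cE := (c0E, cNE, cDE, csumE).

Section Ring.
Variable X : complex A I.

Lemma cmulA : associative (@ccomp A I X X X).
Proof. by move=> f g h; apply: cmapP. Qed.
Lemma cmul1 : left_id (cmap_id X) (@ccomp A I X X X).
Proof. by move=> f; apply: cmapP. Qed.
Lemma cmulr1 : right_id (cmap_id X) (@ccomp A I X X X).
Proof. by move=> f; apply: cmapP. Qed.
Lemma cmulDl : left_distributive (@ccomp A I X X X) +%R.
Proof. by move=> f g h; apply: cmapP. Qed.
Lemma cmulDr : right_distributive (@ccomp A I X X X) +%R.
Proof. by move=> f g h; apply: cmapP => i x /=; rewrite linearD. Qed.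

HB.instance Definition _ :=
  GRing.Zmodule_isPzRing.Build (cmap X X) cmulA cmul1 cmulr1 cmulDl cmulDr.

Lemma c1E i x : (1 : cmap X X) i x = x. Proof. by []. Qed.
Lemma cME (f g : cmap X X) i x : (f * g) i x = f i (g i x). Proof. by []. Qed.
Lemma cmulE (f g : cmap X X) : f * g = f \oc g. Proof. by []. Qed.
Lemma cXE (f : cmap X X) n i x : (f ^+ n) i x = iter n (f i) x.
Proof. by elim: n => [|n IH] //; rewrite exprS cME IH. Qed.

End Ring.

Lemma ccompA (X Y Z W : complex A I) (h : cmap Z W) (g : cmap Y Z) (f : cmap X Y) :
  h \oc (g \oc f) = h \oc g \oc f.
Proof. exact: cmapP. Qed.

Lemma ccomp1l (X Y : complex A I) (f : cmap X Y) : (1 : cmap Y Y) \oc f = f.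
Proof. exact: cmapP. Qed.

Lemma ccomp1r (X Y : complex A I) (f : cmap X Y) : f \oc (1 : cmap X X) = f.
Proof. exact: cmapP. Qed.

Lemma ccompDr (X Y Z : complex A I) (g : cmap Y Z) (f f' : cmap X Y) :
  g \oc (f + f') = g \oc f + g \oc f'.
Proof. by apply: cmapP => i x; rewrite /= linearD. Qed.

Lemma ccompDl (X Y Z : complex A I) (g g' : cmap Y Z) (f : cmap X Y) :
  (g + g') \oc f = g \oc f + g' \oc f.
Proof. exact: cmapP. Qed.

Lemma ccompNr (X Y Z : complex A I) (g : cmap Y Z) (f : cmap X Y) :
  g \oc (- f) = - (g \oc f).
Proof. by apply: cmapP => i x; rewrite /= linearN. Qed.

Lemma ccompNl (X Y Z : complex A I) (g : cmap Y Z) (f : cmap X Y) :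
  (- g) \oc f = - (g \oc f).
Proof. exact: cmapP. Qed.

Lemma ccomp0r (X Y Z : complex A I) (g : cmap Y Z) : g \oc (0 : cmap X Y) = 0.
Proof. by apply: cmapP => i x; rewrite /= linear0. Qed.

Lemma ccomp0l (X Y Z : complex A I) (f : cmap X Y) : (0 : cmap Y Z) \oc f = 0.
Proof. exact: cmapP. Qed.

Lemma retractionE (X Y : complex A I) (f : cmap X Y) :
  retraction f <-> exists s, f \oc s = 1.
Proof. by split=> [[s /cmapP fs]|[s fs]]; exists s => //; rewrite fs. Qed.

Lemma sectionE (X Y : complex A I) (f : cmap X Y) :
  section f <-> exists r, r \oc f = 1.
Proof. by split=> [[s /cmapP fs]|[s fs]]; exists s => //; rewrite fs. Qed.

Lemma isoE (X Y : complex A I) (f : cmap X Y) :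
  isomorphism f <-> exists g, g \oc f = 1 /\ f \oc g = 1.
Proof.
split=> [[g [/cmapP fs /cmapP gs]]|[s [fs gs]]]; exists s || exists g => //.
by rewrite fs gs.
Qed.

End ChainMaps.

(** * Transport between equal degrees, and images of idempotents *)

Section Transport.
Variables A I : nzRingType.

(** The identity when the degrees agree and zero otherwise.  As a family over
all pairs of degrees it replaces transport along an equality of degrees. *)
Definition cst (X : complex A I) i j : {linear X i -> X j} :=
  match @eqP I i j with
  | ReflectT e => match e in _ = j' return {linear X i -> X j'} with erefl => idfun end
  | ReflectF _ => (\0 : {linear X i -> X j})
  end.

Lemma cst_id (X : complex A I) i x : cst X i i x = x.
Proof. by rewrite /cst; case: eqP => // e; rewrite (eq_axiomK e). Qed.

Lemma cst_out (X : complex A I) i j x : i <> j -> cst X i j x = 0.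
Proof. by rewrite /cst; case: eqP. Qed.

Lemma cst_diff_r (X : complex A I) i j l x : j = l -> cst X j l (cdiff X i j x) = cdiff X i l x.
Proof. by move=> <-; rewrite cst_id. Qed.

Lemma cst_diff_l (X : complex A I) i j l x : i = j -> cdiff X j l (cst X i j x) = cdiff X i l x.
Proof. by move=> <-; rewrite cst_id. Qed.

Lemma cst_map (X Y : complex A I) (f : cmap X Y) i j x : f j (cst X i j x) = cst Y i j (f i x).
Proof.
by have [<-|ij] := eqVneq i j; rewrite ?cst_id // !cst_out ?linear0 //; apply/eqP.
Qed.

End Transport.

Section Image.
Variables (A : nzRingType) (M : lmodType A) (e : {linear M -> M}).

Definition fixes : pred M := fun x => e x == x.

Lemma fixes_submod : submod_closed fixes.
Proof.
split=> [|a x y]; first by rewrite unfold_in linear0.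
by rewrite !unfold_in linearP => /eqP-> /eqP->.
Qed.

HB.instance Definition _ := GRing.isSubmodClosed.Build A M fixes fixes_submod.

Record fixpts := FixPt { fixpt_val :> M; _ : fixpt_val \in fixes }.
HB.instance Definition _ := [isSub for fixpt_val].
HB.instance Definition _ := [Choice of fixpts by <:].
HB.instance Definition _ := [SubChoice_isSubLmodule of fixpts by <:].

Definition fixpt_inc : {linear fixpts -> M} := val.

Hypothesis ee : forall x, e (e x) = e x.

Lemma fixpt_prj_subproof x : e x \in fixes.
Proof. by rewrite unfold_in ee. Qed.

Definition fixpt_prj_fun x : fixpts := FixPt (fixpt_prj_subproof x).

Lemma fixpt_prj_linear : linear fixpt_prj_fun.
Proof. by move=> a x y; apply: val_inj; rewrite /= linearP. Qed.

Definition fixpt_prj : {linear M -> fixpts} := mk_linear fixpt_prj_linear.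

Lemma fixpt_incK x : fixpt_prj (fixpt_inc x) = x.
Proof. by apply: val_inj; case: x => x /= /eqP. Qed.

End Image.

Section Retract.
Variables (A : nzRingType) (M N : lmodType A) (i : {linear N -> M}) (p : {linear M -> N}).
Hypothesis ip : forall x, p (i x) = x.

Lemma retract_fg : finitely_generated M -> finitely_generated N.
Proof.
move=> [n [g gP]]; exists n, (p \o g) => x; have [c cE] := gP (i x); exists c.
by rewrite -[LHS]ip cE linear_sum; apply: eq_bigr => j _; rewrite linearZ.
Qed.

Lemma retract_proj : projective M -> projective N.
Proof.
move=> PM K L q f sq; have [h hE] := PM _ _ q (f \o p : {linear M -> L}) sq.
by exists (h \o i : {linear N -> K}) => x; rewrite /= hE /= ip.
Qed.

End Retract.

Section ImageComplex.
Variables A I : nzRingType.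
Variables (X : complex A I) (e : forall i, {linear X i -> X i}).
Hypothesis ee : forall i x, e i (e i x) = e i x.
Hypothesis ded : forall i j l x, cdiff X j l (e j (cdiff X i j x)) = 0.

Definition im_ob i : projmod A :=
  ProjMod (retract_fg (fixpt_incK (@ee i)) (pm_fg (X i)))
          (retract_proj (fixpt_incK (@ee i)) (@pm_proj A (X i))).

Definition im_inc i : {linear im_ob i -> X i} := fixpt_inc (e i).
Definition im_prj i : {linear X i -> im_ob i} := fixpt_prj (@ee i).

Lemma im_incK i x : im_prj i (im_inc i x) = x.
Proof. exact: fixpt_incK. Qed.

Lemma im_prjK i x : im_inc i (im_prj i x) = e i x.
Proof. by []. Qed.

Definition im_diff i j : {linear im_ob i -> im_ob j} := im_prj j \o (cdiff X i j \o im_inc i).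

Lemma im_diffE i j x : im_diff i j x = im_prj j (cdiff X i j (im_inc i x)).
Proof. by []. Qed.

Lemma im_shape i j : j <> i + 1 -> forall x, im_diff i j x = 0.
Proof. by move=> ij x; rewrite im_diffE cdiff_shape // linear0. Qed.

Lemma im_diffK i j l x : im_diff j l (im_diff i j x) = 0.
Proof. by rewrite !im_diffE im_prjK ded linear0. Qed.

(** The images of degreewise idempotents [e] that are not required to commute
with the differential: d e d = 0 is enough for the compressed differential to
square to zero.  A chain idempotent gives a direct summand; other choices give
brutal truncations and some quotient complexes. *)
Definition im_complex : complex A I := Complex im_shape im_diffK.

End ImageComplex.

Section SplitIdempotent.
Variables (A I : nzRingType) (X : complex A I) (e : cmap X X).
Hypothesis ee : e * e = e.

Let eei i x : e i (e i x) = e i x. Proof. by rewrite -cME ee. Qed.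
Let ded i j l x : cdiff X j l (e j (cdiff X i j x)) = 0.
Proof. by rewrite cmap_comm cdiffK. Qed.

Definition split_ob : complex A I := im_complex eei ded.

Lemma split_inc_comm i j x :
  im_inc eei j (cdiff split_ob i j x) = cdiff X i j (im_inc eei i x).
Proof.
rewrite -[LHS]/(e j (cdiff X i j (im_inc eei i x))) cmap_comm.
by rewrite -[e i _]/(im_inc eei i (im_prj eei i (im_inc eei i x))) im_incK.
Qed.
Definition split_inc : cmap split_ob X :=
  @CMap A I split_ob X (fun i => im_inc eei i) split_inc_comm.

Lemma split_prj_comm i j x :
  im_prj eei j (cdiff X i j x) = cdiff split_ob i j (im_prj eei i x).
Proof. by apply: val_inj; rewrite /= !cmap_comm !eei. Qed.
Definition split_prj : cmap X split_ob :=
  @CMap A I X split_ob (fun i => im_prj eei i) split_prj_comm.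

End SplitIdempotent.

Lemma split_idem (A I : nzRingType) (X : complex A I) (e : cmap X X) : e * e = e ->
  exists (Y : complex A I) (i : cmap Y X) (p : cmap X Y), p \oc i = 1 /\ i \oc p = e.
Proof.
move=> ee; exists (split_ob ee), (split_inc ee), (split_prj ee).
by split; apply: cmapP => j x //; apply: fixpt_incK.
Qed.

(** * Fitting's lemma over a finite-dimensional algebra *)

Section RingFacts.
Variables (R : pzRingType) (u c : R) (n : nat).
Hypotheses (uc : u * c = c * u) (reg : u ^+ n = u ^+ n.+1 * c).

(** Together with [regular_idem]: in a ring, u ^+ n = u ^+ n.+1 * c with c
commuting with u produces an idempotent that is zero only for nilpotent u and
one only for invertible u. *)
Lemma regular_absorb j : u ^+ n * (u * c) ^+ j = u ^+ n.
Proof.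
by elim: j => [|j IH]; rewrite ?mulr1 // exprSr mulrA IH mulrA -exprSr -reg.
Qed.

Lemma regular_idem : (u * c) ^+ n * (u * c) ^+ n = (u * c) ^+ n.
Proof.
have cn : (u * c) ^+ n = c ^+ n * u ^+ n.
  by rewrite exprMn_comm //; apply: commrX; apply: commr_sym; apply: commrX.
by rewrite {1}cn -mulrA regular_absorb -cn.
Qed.

End RingFacts.

Section Finite.
Variables (k : fieldType) (A : falgType k).

Definition spanned (M : lmodType A) (n : nat) : Prop :=
  exists e : 'I_n -> M, forall x, exists c : 'I_n -> k, x = \sum_i (c i)%:A *: e i.

Lemma spanned_fin (M : lmodType A) (T : finType) (e : T -> M) :
  (forall x, exists c : T -> k, x = \sum_i (c i)%:A *: e i) -> spanned M #|T|.
Proof.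
move=> eP; exists (e \o enum_val) => x; have [c ->] := eP x.
exists (c \o enum_val); rewrite (reindex (@enum_val T T)) //=.
by exists (@enum_rank T) => i _; [apply: enum_valK|apply: enum_rankK].
Qed.

Lemma fg_spanned (M : lmodType A) : finitely_generated M -> exists n, spanned M n.
Proof.
move=> [n [e eP]]; pose b := vbasis {:A}.
eexists.
apply: (@spanned_fin M ('I_n * 'I_(\dim {:A}))%type (fun ij => b`_ij.2 *: e ij.1)) => x.
have [c ->] := eP x; exists (fun ij => coord b ij.2 (c ij.1)).
rewrite -(pair_big xpredT xpredT (fun i j => (coord b j (c i))%:A *: (b`_j *: e i))) /=.
apply: eq_bigr => i _; rewrite {1}(coord_vbasis (memvf (c i))) scaler_suml.
by apply: eq_bigr => j _; rewrite scalerA mulr_algl.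
Qed.

(** The Cayley-Hamilton theorem for a matrix over the ground field that
describes [u] on a finite spanning set.  The multiples of [p] appear because
polynomials found in different degrees of a complex have to be multiplied. *)
Lemma annihilating_poly (M : lmodType A) (u : {linear M -> M}) :
  finitely_generated M ->
  exists2 p : {poly k}, p != 0 & forall q x,
    \sum_(j < size (q * p)) ((q * p)`_j)%:A *: iter j u x = 0.
Proof.
move=> /fg_spanned[[|n] [e eP]].
  have M0 x : x = 0 :> M by have [c ->] := eP x; rewrite big_ord0.
  exists 1; first exact: oner_neq0.
  by move=> q x; rewrite [x]M0 big1 // => j _; rewrite [iter _ _ _]M0 scaler0.
have [T TE] : exists T : 'M[k]_n.+1, forall i, u (e i) = \sum_j (T i j)%:A *: e j.
  have [c cE] := choice (fun i => eP (u (e i))).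
  by exists (\matrix_(i, j) c i j) => i; rewrite cE; apply: eq_bigr => j _; rewrite mxE.
have uT j i : iter j u (e i) = \sum_l ((T ^+ j) i l)%:A *: e l.
  elim: j i => [|j IH] i.
    rewrite expr0 (bigD1 i) //= mxE eqxx !scale1r big1 ?addr0 // => l li.
    by rewrite mxE eq_sym (negPf li) !scale0r.
  rewrite iterSr TE.
  have iterL (x : 'I_n.+1 -> k) (F : 'I_n.+1 -> M) :
      iter j u (\sum_l (x l)%:A *: F l) = \sum_l (x l)%:A *: iter j u (F l).
    elim: (j) => [|j' IHj] //=; rewrite IHj linear_sum; apply: eq_bigr => l _.
    by rewrite linearZ.
  rewrite iterL; under eq_bigr => l _ do rewrite IH scaler_sumr.
  rewrite exchange_big /=; apply: eq_bigr => l _.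
  rewrite exprS mxE !scaler_suml; apply: eq_bigr => l' _.
  by rewrite scalerA mulr_algl scalerA.
exists (char_poly T); first by rewrite monic_neq0 ?char_poly_monic.
move=> q x; set P := q * _.
have PT : horner_mx T P = 0 by rewrite rmorphM /= Cayley_Hamilton mulr0.
have PE : horner_mx T P = \sum_(j < size P) P`_j *: T ^+ j.
  rewrite -{1}(coefK P) poly_def linear_sum /=; apply: eq_bigr => j _.
  by rewrite linearZ /= rmorphXn /= horner_mx_X.
have [c ->] := eP x.
have iterL j : iter j u (\sum_l (c l)%:A *: e l) = \sum_l (c l)%:A *: iter j u (e l).
  elim: j => [|j IHj] //=; rewrite IHj linear_sum; apply: eq_bigr => l _.
  by rewrite linearZ.
under eq_bigr => j _ do rewrite iterL scaler_sumr.
rewrite exchange_big /= big1 // => i _.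
transitivity ((c i)%:A *: \sum_l (horner_mx T P i l)%:A *: e l).
  rewrite PE scaler_sumr; under [RHS]eq_bigr => l _.
    rewrite summxE !scaler_suml scaler_sumr; over.
  rewrite exchange_big /=; apply: eq_bigr => j _.
  rewrite uT !scaler_sumr; apply: eq_bigr => l _.
  rewrite mxE !scalerA; congr (_ *: _).
  by rewrite -!scalerAl !mul1r -scalerAl mul1r !scalerA mulrA [c i * _]mulrC.
by rewrite PT big1 ?scaler0 // => l _; rewrite mxE !scale0r.
Qed.

Section Graded.
Variable I : nzRingType.

(** Covers bounded int-graded complexes and all periodic complexes at once. *)
Definition fin_supp (X : complex A I) : Prop :=
  exists s : seq I, forall i, i \notin s -> zero_module (X i).

Section Fitting.
Variable X : complex A I.

Lemma kscale_linear (c : k) i : linear (fun x : X i => c%:A *: x : X i).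
Proof.
by move=> a x y; rewrite scalerDr !scalerA mulr_algl mulr_algr.
Qed.

Lemma kscale_comm (c : k) i j x :
  mk_linear (@kscale_linear c j) (cdiff X i j x) = cdiff X i j (mk_linear (@kscale_linear c i) x).
Proof. by rewrite /= linearZ. Qed.
Definition kscale (c : k) : cmap X X := CMap (@kscale_comm c).

Lemma kscaleE c i x : kscale c i x = c%:A *: x. Proof. by []. Qed.

Lemma kscaleC c (u : cmap X X) : kscale c * u = u * kscale c.
Proof. by apply: cmapP => i x; rewrite !cME !kscaleE linearZ. Qed.

Lemma kscaleM c d : kscale (c * d) = kscale c * kscale d.
Proof. by apply: cmapP => i x; rewrite !cME !kscaleE scalerA mulr_algl scalerA. Qed.

Lemma kscale1 : kscale 1 = 1.
Proof. by apply: cmapP => i x; rewrite kscaleE !scale1r. Qed.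

Lemma kscale0 : kscale 0 = 0.
Proof. by apply: cmapP => i x; rewrite kscaleE !scale0r. Qed.

(** A nonzero polynomial annihilates [u]; dividing it by its lowest nonzero
term expresses u ^+ n as u ^+ n.+1 times a polynomial in [u].  Then (u * c) ^+
n is the idempotent of the Fitting decomposition. *)
Lemma fitting (fX : fin_supp X) (u : cmap X X) :
  exists (n : nat) (c : cmap X X), u * c = c * u /\ u ^+ n = u ^+ n.+1 * c.
Proof.
have [P P0 Pu] : exists2 P : {poly k}, P != 0 &
    \sum_(0 <= j < size P) kscale P`_j * u ^+ j = 0.
  have [s sX] := fX.
  have [p p0 pu] : exists2 p : I -> {poly k}, (forall i, p i != 0) & forall i q x,
      \sum_(j < size (q * p i)) ((q * p i)`_j)%:A *: iter j (u i) x = 0.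
    have [p pP] := choice (fun i => let: ex_intro2 p a b := annihilating_poly (u i) (pm_fg (X i)) in
      ex_intro (fun p : {poly k} => p != 0 /\ forall q x,
        \sum_(j < size (q * p)) ((q * p)`_j)%:A *: iter j (u i) x = 0) p (conj a b)).
    by exists p => i; case: (pP i).
  exists (\prod_(i <- s) p i); first by rewrite prodf_seq_neq0; apply/allP => i _; apply: p0.
  apply: cmapP => i x; rewrite big_mkord !cE.
  have [si|/sX X0] := boolP (i \in s); last by rewrite big1 // => j _; apply: X0.
  rewrite (big_rem i) //= mulrC -[RHS](pu i (\prod_(j <- rem i s) p j) x).
  by apply: eq_bigr => j _; rewrite cXE.
have [n Pn nP] : exists2 n, P`_n != 0 & forall j, (j < n)%N -> P`_j = 0.
  have exn : exists n, P`_n != 0 by exists (size P).-1; rewrite -lead_coefE lead_coef_eq0.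
  exists (ex_minn exn); case: ex_minnP => // n Pn nmin j jn.
  by apply/eqP; apply: contraLR jn => /nmin; rewrite -leqNgt.
pose c := - \sum_(0 <= j < size P - n.+1) kscale ((P`_n)^-1 * P`_(j + n.+1)) * u ^+ j.
exists n, c; split.
  rewrite /c mulrN mulNr mulr_sumr mulr_suml; congr (- _); apply: eq_bigr => j _.
  by rewrite mulrA -kscaleC -!mulrA -exprS -exprSr.
have nS : (n < size P)%N.
  by rewrite ltnNge; apply: contra Pn => /(nth_default 0)/eqP.
move: Pu; rewrite (@big_cat_nat _ _ _ n) //= 1?ltnW // big_nat_cond big1 ?add0r; last first.
  by move=> j /andP[/andP[_ jn] _]; rewrite nP // kscale0 mul0r.
rewrite big_ltn // -{1}[n.+1]add0n big_addn => Pu.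
have {}Pu : u ^+ n + kscale (P`_n)^-1 *
    (\sum_(0 <= j < size P - n.+1) kscale P`_(j + n.+1) * u ^+ (j + n.+1)) = 0.
  apply: (etrans _ (etrans (congr1 (fun v => kscale (P`_n)^-1 * v) Pu) (mulr0 _))).
  by rewrite mulrDr mulrA -kscaleM mulVf // kscale1 mul1r.
move/eqP: Pu; rewrite addr_eq0 => /eqP->; rewrite /c mulrN mulr_sumr; congr (- _).
rewrite mulr_sumr; apply: eq_bigr => j _.
by rewrite mulrA -kscaleM [RHS]mulrA -kscaleC -mulrA -exprD addnC.
Qed.

End Fitting.
End Graded.
End Finite.

(** * Indecomposable complexes and direct summands *)

Section Retracts.
Variables A I : nzRingType.

Lemma iso_comp (X Y Z : complex A I) (g : cmap Y Z) (f : cmap X Y) :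
  isomorphism g -> isomorphism f -> isomorphism (g \oc f).
Proof.
move=> /isoE[g' [g'g gg']] /isoE[f' [f'f ff']]; apply/isoE; exists (f' \oc g'); split.
  by rewrite ccompA -(ccompA f') g'g ccomp1r.
by rewrite ccompA -(ccompA g) ff' ccomp1r.
Qed.

Definition indec (X : complex A I) : Prop :=
  (1 : cmap X X) <> 0 /\ forall e : cmap X X, e * e = e -> e = 0 \/ e = 1.

Lemma nonzero_degree (X : complex A I) :
  (1 : cmap X X) <> 0 -> exists i, ~ zero_module (X i).
Proof.
move=> X0; apply: contrapT => /forallNP X1; apply: X0; apply: cmapP => i x.
by apply: (contrapT (X1 i)).
Qed.

Lemma degree_nonzero (X : complex A I) i : ~ zero_module (X i) -> (1 : cmap X X) <> 0.
Proof. by move=> Xi X0; apply: Xi => x; rewrite -[LHS]/((1 : cmap X X) i x) X0. Qed.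

Lemma zero_retract (X Y : complex A I) (i : cmap Y X) (p : cmap X Y) j :
  p \oc i = 1 -> zero_module (X j) -> zero_module (Y j).
Proof.
move=> pi X0 y; rewrite -[y]/((1 : cmap Y Y) j y) -pi /=.
by rewrite (X0 (i j y)) linear0.
Qed.

Lemma idemN (X : complex A I) (e : cmap X X) : e * e = e -> (1 - e) * (1 - e) = 1 - e.
Proof. by move=> ee; rewrite mulrBl mul1r mulrBr mulr1 ee subrr subr0. Qed.

End Retracts.

Section KrullSchmidt.
Variables (k : fieldType) (A : falgType k) (I : nzRingType).

Lemma fin_supp_retract (X Y : complex A I) (i : cmap Y X) (p : cmap X Y) :
  p \oc i = 1 -> fin_supp X -> fin_supp Y.
Proof. by move=> pi [s sX]; exists s => j /sX; apply: zero_retract pi. Qed.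

(** Endomorphism rings are finite dimensional, hence Dedekind-finite. *)
Lemma one_sided_inverse (X : complex A I) (u v : cmap X X) :
  fin_supp X -> u * v = 1 -> v * u = 1.
Proof.
move=> fX uv; have [n [c [uc reg]]] := fitting fX u.
have unv m : u ^+ m * v ^+ m = 1.
  by elim: m => [|m IH]; rewrite ?mulr1 // exprSr exprS mulrA -(mulrA _ u) uv mulr1.
have cu : c * u = 1.
  have cun : c * u * u ^+ n = u ^+ n.
    by rewrite -mulrA -exprS [RHS]reg; apply: commrX; apply: commr_sym.
  by rewrite -[RHS](unv n) -[in RHS]cun -mulrA unv mulr1.
by rewrite -[v]mul1r -{1}cu -(mulrA c) uv mulr1.
Qed.

Lemma endo_retraction_iso (X : complex A I) (u : cmap X X) :
  fin_supp X -> retraction u -> isomorphism u.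
Proof.
move=> fX /retractionE[v uv]; apply/isoE; exists v; split=> //.
exact: one_sided_inverse uv.
Qed.

Lemma endo_section_iso (X : complex A I) (u : cmap X X) :
  fin_supp X -> section u -> isomorphism u.
Proof.
move=> fX /sectionE[v vu]; apply/isoE; exists v; split=> //.
exact: one_sided_inverse vu.
Qed.

Lemma iso_mul (X : complex A I) (u v : cmap X X) :
  fin_supp X -> isomorphism (u \oc v) -> isomorphism u /\ isomorphism v.
Proof.
move=> fX /isoE[w [wuv uvw]]; split.
  by apply: endo_retraction_iso => //; apply/retractionE; exists (v \oc w); rewrite ccompA.
by apply: endo_section_iso => //; apply/sectionE; exists (w \oc u); rewrite -ccompA.
Qed.

Section Local.
Variable X : complex A I.
Hypotheses (fX : fin_supp X) (iX : indec X).

Lemma indec_nilpotent_or_iso (u : cmap X X) : (exists n, u ^+ n = 0) \/ isomorphism u.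
Proof.
have [n [c [uc reg]]] := fitting fX u.
case: (iX.2 _ (regular_idem uc reg)) => w.
  by left; exists n; rewrite -(regular_absorb reg n) w mulr0.
right; apply: endo_retraction_iso => //; apply/retractionE.
case: n reg w => [|n] reg w; first by exists c; rewrite -cmulE -[u]expr1 -reg.
by exists (c * (u * c) ^+ n); rewrite -cmulE mulrA -exprS.
Qed.

Lemma nilpotent_iso1B (u : cmap X X) n : u ^+ n = 0 -> isomorphism (1 - u).
Proof.
move=> un; apply: endo_retraction_iso => //; apply/retractionE.
exists (\sum_(i < n) u ^+ i); rewrite -cmulE -[LHS]opprK -mulNr opprB -subrX1 un.
by rewrite sub0r opprK.
Qed.

Lemma indec_local (u : cmap X X) : isomorphism u \/ isomorphism (1 - u).
Proof.
by have [[n un]|] := indec_nilpotent_or_iso u; [right; apply: nilpotent_iso1B un|left].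
Qed.

Lemma indec_iso_add (u v : cmap X X) : isomorphism (u + v) -> isomorphism u \/ isomorphism v.
Proof.
move=> /isoE[w [wuv _]]; have [wu|wv] := indec_local (w * u).
  by left; have [] := iso_mul fX wu.
right; suff /(iso_mul fX)[] : isomorphism (w \oc v) by [].
by rewrite -cmulE; congr isomorphism: wv; rewrite -wuv -cmulE mulrDr addrC addKr.
Qed.

Lemma iso0F : ~ isomorphism (0 : cmap X X).
Proof. by move=> /isoE[w [w0 _]]; apply: iX.1; rewrite -w0 ccomp0r. Qed.

Lemma iso1 : isomorphism (1 : cmap X X).
Proof. by apply/isoE; exists 1; rewrite ccomp1l. Qed.

(** The form in which locality of the endomorphism ring is used below. *)
Lemma indec_iso_sum (J : eqType) (r : seq J) (u : J -> cmap X X) :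
  isomorphism (\sum_(j <- r) u j) -> exists2 j, j \in r & isomorphism (u j).
Proof.
elim: r => [|j r IH]; first by rewrite big_nil => /iso0F.
rewrite big_cons => /indec_iso_add[uj|/IH[l lr ul]].
  by exists j => //; rewrite mem_head.
by exists l => //; rewrite in_cons lr orbT.
Qed.

End Local.

Definition size_le (X : complex A I) (n : nat) : Prop :=
  exists (s : seq I) (d : I -> nat), [/\ forall i, i \notin s -> zero_module (X i),
    forall i, spanned (X i) (d i) & (\sum_(i <- s) d i <= n)%N].

Lemma spanned_retract (M N : lmodType A) (i : {linear N -> M}) (p : {linear M -> N}) n :
  (forall y, p (i y) = y) -> spanned M n -> spanned N n.
Proof.
move=> pi [e eP]; exists (p \o e) => y; have [c cE] := eP (i y); exists c.
by rewrite -[LHS]pi cE linear_sum; apply: eq_bigr => j _; rewrite linearZ.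
Qed.

(** A nonzero element killed by [p] makes one of the spanning elements
redundant in the quotient, so the size of a spanning family is a measure that
drops when one passes to a proper direct summand. *)
Lemma spanned_proper (M N : lmodType A) (p : {linear M -> N}) n x :
  (forall y, exists z, p z = y) -> p x = 0 -> x <> 0 ->
  spanned M n -> exists2 m, (m < n)%N & spanned N m.
Proof.
move=> sp px x0 [e eP]; have [c cE] := eP x.
have [j cj] : exists j, c j != 0.
  apply: contrapT => /forallNP c0; apply: x0; rewrite cE big1 // => j _.
  by have /negP := c0 j; rewrite negbK => /eqP->; rewrite !scale0r.
case: n => [|n] in e eP c cE j cj *; first by case: j {cj}.
have kA (a b : k) : a%:A * b%:A = (a * b)%:A :> A by rewrite mulr_algl scalerA.
exists n => //; exists (fun l => p (e (lift j l))) => y.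
have [z <-] := sp y; have [d ->] := eP z.
exists (fun l => d (lift j l) - d j * (c j)^-1 * c (lift j l)).
move: px; rewrite cE !linear_sum !(bigD1_ord j) //= !linearZ /= => pj.
have {}pj : p (e j) = - \sum_(i < n) ((c j)^-1 * c (lift j i))%:A *: p (e (lift j i)).
  apply/eqP; rewrite -addr_eq0; apply/eqP.
  transitivity ((c j)^-1%:A *: ((c j)%:A *: p (e j) + \sum_(i < n) p ((c (lift j i))%:A *: e (lift j i)))).
    rewrite scalerDr scalerA kA mulVf // !scale1r; congr (_ + _).
    rewrite scaler_sumr; apply: eq_bigr => i _.
    by rewrite linearZ /= scalerA kA.
  by rewrite pj scaler0.
rewrite pj scalerN scaler_sumr -sumrN -big_split /=; apply: eq_bigr => i _.
by rewrite [p (_ *: _)]linearZ /= scalerA kA mulrA addrC scalerBl scalerBl.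
Qed.

Lemma fin_supp_size (X : complex A I) : fin_supp X -> exists n, size_le X n.
Proof.
move=> [s sX]; have [d dP] := choice (fun i => fg_spanned (pm_fg (X i))).
by exists (\sum_(i <- s) d i)%N, s, d.
Qed.

Lemma size_le_retract (X Y : complex A I) (i : cmap Y X) (p : cmap X Y) n :
  p \oc i = 1 -> i \oc p <> 1 -> size_le X n -> exists2 m, (m < n)%N & size_le Y m.
Proof.
move=> pi ip [s [d [sX dX dn]]].
have piE l y : p l (i l y) = y by rewrite -[RHS]/((1 : cmap Y Y) l y) -pi.
have [l [x xip]] : exists l x, i l (p l x) <> x.
  apply: contrapT => H; apply: ip; apply: cmapP => l x; apply: contrapT => E.
  by apply: H; exists l, x.
have [m md Ym] : exists2 m, (m < d l)%N & spanned (Y l) m.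
  apply: (@spanned_proper _ _ (p l) _ (x - i l (p l x))) (dX l).
  - by move=> y; exists (i l y).
  - by rewrite linearB /= piE subrr.
  - by move/eqP; rewrite subr_eq0 => /eqP/esym.
pose d' j := if j == l then m else d j.
exists (\sum_(j <- s) d' j)%N; last first.
  exists s, d'; split=> // [j /sX|j]; first exact: zero_retract pi.
  rewrite /d'; case: eqP => [->//|_]; exact: spanned_retract (piE j) (dX j).
apply: leq_trans dn; have ls : l \in s.
  by apply: contraT => /sX X0; case: xip; rewrite (X0 x) (X0 (i l _)).
rewrite (big_rem l ls) [X in (_ < X)%N](big_rem l ls) /= /d' eqxx.
rewrite -addSn leq_add // leq_sum // => j _; case: eqP => // ->; exact: ltnW.
Qed.

(** Induction over proper direct summands; it replaces the decomposition into
a finite direct sum of indecomposables. *)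
Lemma retract_ind (P : complex A I -> Prop) :
  (forall X, fin_supp X ->
    (forall Y (i : cmap Y X) (p : cmap X Y), p \oc i = 1 -> i \oc p <> 1 -> P Y) -> P X) ->
  forall X, fin_supp X -> P X.
Proof.
move=> IH X fX; have [n] := fin_supp_size fX.
elim/ltn_ind: n X fX => n IHn X fX Xn; apply: IH => // Y i p pi ip.
have [m mn Ym] := size_le_retract pi ip Xn.
exact: IHn mn Y (fin_supp_retract pi fX) Ym.
Qed.

Lemma decomposes (X : complex A I) : (1 : cmap X X) <> 0 -> ~ indec X ->
  exists (Y Y' : complex A I) (i : cmap Y X) (p : cmap X Y) (i' : cmap Y' X) (p' : cmap X Y'),
    [/\ p \oc i = 1, p' \oc i' = 1, i \oc p <> 1, i' \oc p' <> 1 & i \oc p + i' \oc p' = 1].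
Proof.
move=> X0 niX.
have [e [ee e0 e1]] : exists e : cmap X X, [/\ e * e = e, e <> 0 & e <> 1].
  apply: contrapT => H; apply: niX; split=> // e ee; apply: contrapT => /not_orP[e0 e1].
  by apply: H; exists e.
have [Y [i [p [pi ip]]]] := split_idem ee.
have [Y' [i' [p' [pi' ip']]]] := split_idem (idemN ee).
exists Y, Y', i, p, i', p'; split=> //; first by rewrite ip.
  by rewrite ip' => E; apply: e0; rewrite -(subKr 1 e) E subrr.
by rewrite ip ip' addrC subrK.
Qed.

Lemma indec_retract (j : I) (X : complex A I) : fin_supp X -> ~ zero_module (X j) ->
  exists (N : complex A I) (i : cmap N X) (p : cmap X N),
    [/\ p \oc i = 1, indec N & ~ zero_module (N j)].
Proof.
move=> fX; move: X fX; apply: retract_ind => X fX IH Xj.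
have [iX|niX] := pselect (indec X); first by exists X, 1, 1; split=> //; rewrite ccomp1l.
have [Y [Y' [i [p [i' [p' [pi pi' ip ip' ipip]]]]]]] := decomposes (degree_nonzero Xj) niX.
have [Yj|Yj] := pselect (zero_module (Y j)); last first.
  have [N [i1 [p1 [pi1 iN Nj]]]] := IH _ _ _ pi ip Yj.
  by exists N, (i \oc i1), (p1 \oc p); split=> //; rewrite ccompA -(ccompA p1) pi ccomp1r.
have [|N [i1 [p1 [pi1 iN Nj]]]] := IH _ _ _ pi' ip'.
  move=> Yj'; apply: Xj => x; rewrite -[x]/((1 : cmap X X) j x) -ipip cDE /=.
  by rewrite (Yj (p j x)) (Yj' (p' j x)) !linear0 addr0.
by exists N, (i' \oc i1), (p1 \oc p'); split=> //; rewrite ccompA -(ccompA p1) pi' ccomp1r.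
Qed.

(** The projection onto the sum of those indecomposable summands that are
nonzero in degree [a]; these vanish in degree [b]. *)
Lemma separating_idempotent (a b : I) :
  (forall N : complex A I, fin_supp N -> indec N -> zero_module (N a) \/ zero_module (N b)) ->
  forall X : complex A I, fin_supp X -> exists e : cmap X X,
    [/\ e * e = e, forall x, e a x = x & forall x, e b x = 0].
Proof.
move=> sep; apply: retract_ind => X fX IH.
have [X0|X0] := pselect ((1 : cmap X X) = 0).
  by exists 1; split=> [|//|x]; rewrite ?mulr1 // X0.
have [iX|niX] := pselect (indec X).
  have [Xa|Xb] := sep X fX iX.
    by exists 0; split=> [|x|//]; rewrite ?mul0r // [RHS]Xa.
  by exists 1; split=> [|//|x]; rewrite ?mul1r // [RHS]Xb.
have [Y [Y' [i [p [i' [p' [pi pi' ip ip' ipip]]]]]]] := decomposes X0 niX.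
have [e [ee ea eb]] := IH _ _ _ pi ip; have [e' [ee' ea' eb']] := IH _ _ _ pi' ip'.
have E l x : i l (p l x) + i' l (p' l x) = x by rewrite -[RHS]/((1 : cmap X X) l x) -ipip.
have piE l x : p l (i l x) = x by rewrite -[RHS]/((1 : cmap Y Y) l x) -pi.
have piE' l x : p' l (i' l x) = x by rewrite -[RHS]/((1 : cmap Y' Y') l x) -pi'.
have eeE l x : e l (e l x) = e l x by rewrite -cME ee.
have eeE' l x : e' l (e' l x) = e' l x by rewrite -cME ee'.
have pi0 l x : p l (i' l x) = 0.
  have := congr1 (p l) (E l (i' l x)); rewrite linearD /= piE piE'.
  by rewrite -[RHS]addr0 => /addrI.
have pi0' l x : p' l (i l x) = 0.
  have := congr1 (p' l) (E l (i l x)); rewrite linearD /= piE' piE.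
  by rewrite -[RHS]addr0 => /addrI.
exists (i \oc e \oc p + i' \oc e' \oc p'); split.
- apply: cmapP => l x; rewrite cME !cDE /=.
  by rewrite !linearD /= piE piE' pi0 pi0' eeE eeE' !linear0 addr0 add0r.
- by move=> x; rewrite cDE /= ea ea' E.
- by move=> x; rewrite cDE /= eb eb' !linear0 addr0.
Qed.

End KrullSchmidt.

(** * Null-homotopic maps and contractible complexes *)

Section ElementaryIdempotent.
Variables (A : nzRingType) (X : complex A int) (a : int) (s : {linear X (a + 1) -> X a}).
Hypothesis dsd : forall x, cdiff X a (a + 1) (s (cdiff X a (a + 1) x)) = cdiff X a (a + 1) x.

Definition elem_fun i : {linear X i -> X i} :=
  (cst X a i \o (s \o cdiff X i (a + 1))) \+ (cdiff X a i \o (s \o cst X i (a + 1))).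

Lemma elem_funE i x : elem_fun i x =
  cst X a i (s (cdiff X i (a + 1) x)) + cdiff X a i (s (cst X i (a + 1) x)).
Proof. by []. Qed.

Lemma elem_comm i j x : elem_fun j (cdiff X i j x) = cdiff X i j (elem_fun i x).
Proof.
rewrite !elem_funE linearD /= !cdiffK !linear0 add0r addr0.
have [ia|ia] := eqVneq i a; have [ja|ja] := eqVneq j (a + 1).
- by subst i j; rewrite !cst_id.
- subst i; rewrite [RHS]cdiff_shape; last exact/eqP.
  by rewrite [LHS]cdiff_shape //; apply/eqP.
- subst j; rewrite cst_id [cdiff X i _ x]cdiff_shape ?linear0 //.
  by move=> /eqP; rewrite (inj_eq (addIr 1)) eq_sym (negPf ia).
- rewrite cst_out ?linear0; last exact/eqP.
  by rewrite cst_out ?linear0 //; apply/eqP; rewrite eq_sym.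
Qed.

(** The chain endomorphism s d + d s for a map [s] from degree a + 1 to degree
a. When d s d = d it is the projection onto the contractible summand that [d]
and [s] cut out, so an indecomposable complex either is such a summand or has
none. *)
Definition elem : cmap X X := CMap elem_comm.

Lemma elem_lo x : elem a x = s (cdiff X a (a + 1) x).
Proof. by rewrite /= cst_id cst_out ?linear0 ?addr0 //; lia. Qed.

Lemma elem_hi x : elem (a + 1) x = cdiff X a (a + 1) (s x).
Proof. by rewrite /= cst_id cst_out ?add0r //; lia. Qed.

Lemma elem_out i x : i <> a -> i <> a + 1 -> elem i x = 0.
Proof. by move=> ia ia1; rewrite /= !cst_out ?linear0 ?addr0 //; apply/nesym. Qed.

Lemma elem_idem : elem * elem = elem.
Proof.
apply: cmapP => i x; rewrite cME.
have [ia|ia] := eqVneq i a; first by subst i; rewrite !elem_lo dsd.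
have [ia1|ia1] := eqVneq i (a + 1); first by subst i; rewrite !elem_hi dsd.
by rewrite !elem_out //; apply/eqP.
Qed.

Lemma elem_indec : indec X ->
  ((forall x, s (cdiff X a (a + 1) x) = 0) /\ (forall y, cdiff X a (a + 1) (s y) = 0)) \/
  [/\ forall x, s (cdiff X a (a + 1) x) = x, forall y, cdiff X a (a + 1) (s y) = y &
      forall i, i <> a -> i <> a + 1 -> zero_module (X i)].
Proof.
move=> iX; have [e0|e1] := iX.2 _ elem_idem; [left|right]; split.
- by move=> x; rewrite -elem_lo e0.
- by move=> x; rewrite -elem_hi e0.
- by move=> x; rewrite -elem_lo e1.
- by move=> x; rewrite -elem_hi e1.
- by move=> i ia ia1 x; rewrite -(elem_out x ia ia1) e1.
Qed.

End ElementaryIdempotent.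

Section Homotopy.
Variable A : nzRingType.

Definition null_homotopic (X Y : complex A int) (f : cmap X Y) : Prop := homotopic f 0.

Lemma homotopic_null (X Y : complex A int) (f g : cmap X Y) : homotopic f g <-> null_homotopic (f - g).
Proof. by split=> -[s sE]; exists s => i x; have := sE i x; rewrite subr0. Qed.

Lemma nullE (X Y : complex A int) (f : cmap X Y) : null_homotopic f ->
  exists s : forall i j, {linear X i -> Y j}, forall i j l x, j = i + 1 -> l = j + 1 ->
    f j x = cdiff Y i j (s j i x) + s l j (cdiff X j l x).
Proof.
move=> [s sE]; exists s => i j l x ij ->; have {ij} -> : i = j - 1 by rewrite ij addrK.
by rewrite -sE subr0.
Qed.

Lemma nullD (X Y : complex A int) (f g : cmap X Y) : null_homotopic f -> null_homotopic g -> null_homotopic (f + g).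
Proof.
move=> [s sE] [t tE]; exists (fun i j => s i j \+ t i j) => i x.
move: (sE i x) (tE i x); rewrite !subr0 => fE gE.
by rewrite cDE fE gE /= linearD addrACA.
Qed.

Lemma null_compl (X Y Z : complex A int) (g : cmap Y Z) (f : cmap X Y) :
  null_homotopic f -> null_homotopic (g \oc f).
Proof.
move=> [s sE]; exists (fun i j => g j \o s i j) => i x.
by move: (sE i x); rewrite !subr0 /= => ->; rewrite linearD /= cmap_comm.
Qed.

Lemma null_compr (X Y Z : complex A int) (g : cmap Y Z) (f : cmap X Y) :
  null_homotopic g -> null_homotopic (g \oc f).
Proof.
move=> [s sE]; exists (fun i j => s i j \o f i) => i x.
by move: (sE i (f i x)); rewrite !subr0 /= => ->; rewrite cmap_comm.
Qed.

Lemma null0 (X Y : complex A int) : null_homotopic (0 : cmap X Y).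
Proof. by exists (fun i j => \0) => i x; rewrite /= subr0 linear0 addr0. Qed.

Lemma nullN (X Y : complex A int) (f : cmap X Y) : null_homotopic f -> null_homotopic (- f).
Proof.
move=> fn; have -> : - f = (- 1 : cmap Y Y) \oc f by rewrite ccompNl ccomp1l.
exact: null_compl.
Qed.

(** The components of a contracting homotopy give elementary idempotents; if
all of them vanished then so would the identity. *)
Lemma contractible_indec (X : complex A int) : indec X -> null_homotopic (1 : cmap X X) ->
  exists a, forall i, i <> a -> i <> a + 1 -> zero_module (X i).
Proof.
move=> iX /nullE[s sE]; have dsd a x :
    cdiff X a (a + 1) (s (a + 1) a (cdiff X a (a + 1) x)) = cdiff X a (a + 1) x.
  have := sE a (a + 1) (a + 1 + 1) (cdiff X a (a + 1) x) erefl erefl.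
  by rewrite c1E cdiffK linear0 addr0 => <-.
have [i Xi] := nonzero_degree iX.1; apply: contrapT => /forallNP out.
have vanish a : (forall x, s (a + 1) a (cdiff X a (a + 1) x) = 0) /\
    (forall y, cdiff X a (a + 1) (s (a + 1) a y) = 0).
  by have [//|[_ _ /out]] := elem_indec (dsd a) iX.
apply: Xi => x; have -> : x = (1 : cmap X X) i x by [].
rewrite (sE (i - 1) i (i + 1)) ?subrK // (vanish i).1 addr0.
have := (vanish (i - 1)).2; rewrite subrK; exact.
Qed.

End Homotopy.

Section BoundedComplexes.
Variable A : nzRingType.

Definition bounded (X : complex A int) : Prop := exists a b, concentrated a b X.

Lemma bounded_retract (X Y : complex A int) (i : cmap Y X) (p : cmap X Y) :
  p \oc i = 1 -> bounded X -> bounded Y.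
Proof. by move=> pi [a [b Xab]]; exists a, b => j /Xab; apply: zero_retract pi. Qed.

Lemma zero_bcomplex : exists O : bcomplex A, forall i, zero_module (O i).
Proof.
have zfg (M : lmodType A) : zero_module M -> finitely_generated M.
  by move=> M0; exists 0%N, (fun=> 0) => x; exists (fun=> 0); rewrite big_ord0.
pose M : lmodType A := 'rV[A]_0.
have M0 : zero_module M by move=> x; apply: thinmx0.
have PM : projective M.
  by move=> N L p f _; exists \0 => x /=; rewrite [x]M0 !linear0.
pose P := ProjMod (zfg M M0) PM.
have s0 (i j : int) : j <> i + 1 -> forall x, (\0 : {linear P -> P}) x = 0 by [].
have k0 (i j l : int) x : (\0 : {linear P -> P}) ((\0 : {linear P -> P}) x) = 0 by [].
pose O := @Complex A int (fun=> P) (fun i j => \0) s0 k0.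
have bO : exists a b, concentrated a b O by exists 0, 0 => i _; apply: M0.
by exists (BComplex bO).
Qed.

Lemma K_zeroP (X : bcomplex A) : K_zero X <-> null_homotopic (1 : cmap X X).
Proof.
split=> [[O [O0 [f [g [/homotopic_null gf _]]]]]|n1].
  have f0 : f = 0 by apply: cmapP => i x; rewrite [LHS](O0 i).
  move: gf; rewrite f0 ccomp0r sub0r => /nullN; by rewrite opprK.
have [O O0] := zero_bcomplex; exists O; split=> //; exists 0, 0; split; apply/homotopic_null.
  by rewrite ccomp0l sub0r; apply: nullN.
have nO (h : cmap O O) : null_homotopic h.
  suff -> : h = 0 by apply: null0.
  by apply: cmapP => i x; rewrite [LHS](O0 i).
exact: nO.
Qed.

Section BinarySum.
Variables Y Z : complex A int.

Definition csum_p1 : cmap (csum Y Z) Y :=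
  @CMap _ _ (csum Y Z) Y (fun i => (fst : {linear (Y i * Z i)%type -> Y i})) (fun i j x => erefl).
Definition csum_p2 : cmap (csum Y Z) Z :=
  @CMap _ _ (csum Y Z) Z (fun i => (snd : {linear (Y i * Z i)%type -> Z i})) (fun i j x => erefl).

Lemma pairl_linear (M N : lmodType A) : linear (fun x : M => (x, 0 : N)).
Proof. by move=> a x y; congr pair; rewrite /= scaler0 addr0. Qed.
Lemma pairr_linear (M N : lmodType A) : linear (fun x : N => (0 : M, x)).
Proof. by move=> a x y; congr pair; rewrite /= scaler0 addr0. Qed.
Definition pairl (M N : lmodType A) : {linear M -> (M * N)%type} := mk_linear (@pairl_linear M N).
Definition pairr (M N : lmodType A) : {linear N -> (M * N)%type} := mk_linear (@pairr_linear M N).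

Lemma csum_i1_comm i j (x : Y i) :
  pairl (Y j) (Z j) (cdiff Y i j x) = cdiff (csum Y Z) i j (pairl (Y i) (Z i) x).
Proof. by rewrite /= linear0. Qed.
Lemma csum_i2_comm i j (x : Z i) :
  pairr (Y j) (Z j) (cdiff Z i j x) = cdiff (csum Y Z) i j (pairr (Y i) (Z i) x).
Proof. by rewrite /= linear0. Qed.
Definition csum_i1 : cmap Y (csum Y Z) := @CMap _ _ Y (csum Y Z) _ csum_i1_comm.
Definition csum_i2 : cmap Z (csum Y Z) := @CMap _ _ Z (csum Y Z) _ csum_i2_comm.

Lemma csum_id : csum_i1 \oc csum_p1 + csum_i2 \oc csum_p2 = 1.
Proof. by apply: cmapP => i [x y]; rewrite cDE; congr pair; rewrite /= ?addr0 ?add0r. Qed.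

Lemma csum_pi11 : csum_p1 \oc csum_i1 = 1. Proof. exact: cmapP. Qed.
Lemma csum_pi22 : csum_p2 \oc csum_i2 = 1. Proof. exact: cmapP. Qed.
Lemma csum_pi12 : csum_p1 \oc csum_i2 = 0. Proof. exact: cmapP. Qed.
Lemma csum_pi21 : csum_p2 \oc csum_i1 = 0. Proof. exact: cmapP. Qed.

End BinarySum.
End BoundedComplexes.

(** * The width of an indecomposable bounded complex *)

Section Width.
Variables (k : fieldType) (A : falgType k).

Lemma bounded_fin_supp (X : complex A int) : bounded X -> fin_supp X.
Proof.
move=> [a [b Xab]]; exists [seq a + n%:Z | n <- iota 0 (absz (b - a)).+1] => i /negP out.
apply: Xab; apply/negP => ab; apply: out; apply/mapP.
by exists (absz (i - a)); rewrite ?mem_iota; lia.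
Qed.

Lemma null_iso1D (X : complex A int) (n : cmap X X) : bounded X -> indec X ->
  ~ null_homotopic (1 : cmap X X) -> null_homotopic n -> isomorphism (1 + n).
Proof.
move=> bX iX X0 nn; have [//|] := indec_local (bounded_fin_supp bX) iX (1 + n).
rewrite opprD addNKr => /isoE[v [vn _]]; case: X0; rewrite -vn.
by apply: null_compl; apply: nullN.
Qed.

(** If X is homotopy equivalent to Y + Z and the endomorphism of X through Y
is invertible, then the component X -> Z is null-homotopic, because it becomes
so after composition with that endomorphism. *)
Lemma complement_null (X W Y Z : complex A int) (f : cmap X W) (g : cmap W X)
    (i1 : cmap Y W) (p1 : cmap W Y) (i2 : cmap Z W) (p2 : cmap W Z) :
  p2 \oc i1 = 0 -> p2 \oc i2 = 1 -> null_homotopic (f \oc g - 1) ->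
  isomorphism (g \oc i1 \oc p1 \oc f) -> null_homotopic (1 : cmap Z Z).
Proof.
move=> pi21 pi22 fg /isoE[v [_ ev]].
have fgE : f \oc g = (f \oc g - 1) + 1 by rewrite subrK.
have p2f : null_homotopic (p2 \oc f).
  rewrite -[p2 \oc f]ccomp1r -ev ccompA; apply: null_compr.
  rewrite !ccompA -[p2 \oc f \oc g]ccompA fgE ccompDr ccomp1r !ccompDl pi21 !ccomp0l addr0.
  by do 3 apply: null_compr; apply: null_compl.
rewrite -pi22 -[p2]ccomp1r.
have -> : (1 : cmap W W) = f \oc g - (f \oc g - 1) by rewrite opprB addrC subrK.
rewrite ccompDr ccompDl ccompNr ccompNl; apply: nullD; last apply: nullN.
  by rewrite ccompA; do 2 apply: null_compr.
by apply: null_compr; apply: null_compl.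
Qed.

(** Null-homotopic endomorphisms of an indecomposable non-contractible complex
form a proper ideal of a local ring, so homotopy decompositions can be tested
on honest chain maps. *)
Lemma indec_K_indecomposable (X : bcomplex A) :
  indec X -> ~ null_homotopic (1 : cmap X X) -> K_indecomposable X.
Proof.
move=> iX X0; split=> [/K_zeroP//|Y Z [f [g [/homotopic_null gf /homotopic_null fg]]]].
have gfI : isomorphism (g \oc f).
  rewrite -[g \oc f](subrK 1) addrC; apply: null_iso1D => //; exact: bc_bounded.
have : isomorphism (g \oc csum_i1 Y Z \oc csum_p1 Y Z \oc f
                    + g \oc csum_i2 Y Z \oc csum_p2 Y Z \oc f).
  by rewrite -ccompDl -!ccompA -ccompDr csum_id ccomp1r.
move=> /(indec_iso_add (bounded_fin_supp (bc_bounded X)) iX)[] H; [right|left];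
  apply/K_zeroP; apply: complement_null fg H.
- exact: csum_pi21.
- exact: csum_pi22.
- exact: csum_pi12.
- exact: csum_pi11.
Qed.

Lemma has_length (X : bcomplex A) : exists l, is_length X l.
Proof.
pose P n := exists (a : int) (Y : bcomplex A), concentrated a (a + n%:Z) Y /\ K_iso X Y.
have exP : exists n, `[< P n >].
  have [a [b Xab]] := bc_bounded X; exists (absz (b - a)); apply/asboolP.
  exists a, X; split=> [i out|]; first by apply: Xab; lia.
  by exists 1, 1; split; apply/homotopic_null; rewrite ccomp1l subrr; apply: null0.
exists (ex_minn exP); case: ex_minnP => l /asboolP Pl lmin; split=> // n Pn.
by apply: lmin; apply/asboolP.
Qed.

Variable nu : nat.
Hypotheses (nu_ge1 : (1 <= nu)%N) (A_sgldim : is_sgldim A nu).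

(** A non-contractible indecomposable is homotopy equivalent to a complex with
l + 1 terms where l <= nu; the composite endomorphism is invertible modulo
null-homotopic maps, hence invertible, and the complex is a summand. *)
Lemma indec_width (X : complex A int) i j : bounded X -> indec X ->
  ~ zero_module (X i) -> ~ zero_module (X j) -> i - j <= nu%:Z.
Proof.
move=> bX iX Xi Xj; have [X0|X0] := pselect (null_homotopic (1 : cmap X X)).
  have [a aX] := contractible_indec iX X0.
  have near l : ~ zero_module (X l) -> l = a \/ l = a + 1.
    by move=> Xl; apply: contrapT => /not_orP[la la1]; apply: Xl; apply: aX.
  by have := near _ Xi; have := near _ Xj; lia.
pose X' := BComplex bX; have [l Xl] := has_length X'.
have lnu : (l <= nu)%N.
  by apply: (A_sgldim.1); exists X'; split=> //; apply: indec_K_indecomposable.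
have [[a [Y [Yal [f [g [/homotopic_null gf _]]]]]] _] := Xl.
have /isoE[v [vgf _]] : isomorphism (g \oc f).
  by rewrite -[g \oc f](subrK 1) addrC; apply: null_iso1D.
have inside t : ~ zero_module (X t) -> a <= t <= a + l%:Z.
  move=> Xt; apply: contraT => /Yal Yt; case: Xt.
  by apply: (zero_retract (i := f) (p := v \oc g)) Yt; rewrite -ccompA.
by have := inside _ Xi; have := inside _ Xj; lia.
Qed.

Lemma separate_degrees (X : complex A int) (a b : int) :
  bounded X -> nu%:Z < `|b - a| -> exists e : cmap X X,
    [/\ e * e = e, forall x, e a x = x & forall x, e b x = 0].
Proof.
move=> bX ab.
(* The induction behind separating_idempotent runs over complexes of finite
   support, which for int-graded ones means bounded. *)
have [||e eP] := @separating_idempotent k A int a b _ X; last by exists e.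
  move=> N [s sN] iN; apply: contrapT => /not_orP[Na Nb].
  have bN : bounded N.
    exists (- \sum_(i <- s) `|i|), (\sum_(i <- s) `|i|) => i out; apply: sN.
    apply: contra out => si; rewrite (big_rem i si) /=.
    have : 0 <= \sum_(j <- rem i s) `|j| by apply: sumr_ge0 => j _; apply: normr_ge0.
    by move: (\sum_(j <- _) _) (ler_norm i) (ler_norm (- i)); rewrite normrN => S; lia.
  by have := indec_width bN iN Na Nb; have := indec_width bN iN Nb Na; lia.
exact: bounded_fin_supp.
Qed.

End Width.

(** * The span of an almost split sequence of bounded complexes *)

Section AlmostSplitEnds.
Variables (A I : nzRingType) (C : complex A I -> Prop).

Lemma right_almost_split_indec (Y Z : complex A I) (g : cmap Y Z) :
  C Z -> right_almost_split C g -> indec Z.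
Proof.
move=> CZ [ng lift]; split=> [Z0|e ee].
  by apply: ng; apply/retractionE; exists 0; rewrite ccomp0r Z0.
have fact (u : cmap Z Z) : ~ retraction u -> exists h, g \oc h = u.
  by move=> /(lift _ CZ)[h /cmapP]; exists h.
have idem_retr (u : cmap Z Z) : u * u = u -> retraction u -> u = 1.
  by move=> uu /retractionE[v uv]; rewrite -[u]mulr1 -uv mulrA uu.
have [/(idem_retr _ ee)|/fact[h he]] := pselect (retraction e); first by right.
left; have [/(idem_retr _ (idemN ee))|/fact[h' he']] := pselect (retraction (1 - e)).
  by move=> e1; rewrite -(subKr 1 e) e1 subrr.
by case: ng; apply/retractionE; exists (h + h'); rewrite ccompDr he he' addrC subrK.
Qed.

Lemma left_almost_split_indec (X Y : complex A I) (f : cmap X Y) :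
  C X -> left_almost_split C f -> indec X.
Proof.
move=> CX [nf ext]; split=> [X0|e ee].
  by apply: nf; apply/sectionE; exists 0; rewrite ccomp0l X0.
have fact (u : cmap X X) : ~ section u -> exists h, h \oc f = u.
  by move=> /(ext _ CX)[h /cmapP]; exists h.
have idem_sect (u : cmap X X) : u * u = u -> section u -> u = 1.
  by move=> uu /sectionE[v vu]; rewrite -[u]mul1r -vu -cmulE -mulrA uu.
have [/(idem_sect _ ee)|/fact[h he]] := pselect (section e); first by right.
left; have [/(idem_sect _ (idemN ee))|/fact[h' he']] := pselect (section (1 - e)).
  by move=> e1; rewrite -(subKr 1 e) e1 subrr.
by case: nf; apply/sectionE; exists (h + h'); rewrite ccompDl he he' addrC subrK.
Qed.

(** The degreewise splittings of g can be complemented by compatible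
retractions of f. *)
Lemma conflation_splitting (X Y Z : complex A I) (f : cmap X Y) (g : cmap Y Z) :
  conflation f g ->
  exists (s : forall i, {linear Z i -> Y i}) (r : forall i, {linear Y i -> X i}),
    [/\ forall i z, g i (s i z) = z, forall i x, r i (f i x) = x,
        forall i x, g i (f i x) = 0, forall i z, r i (s i z) = 0 &
        forall i y, f i (r i y) + s i (g i y) = y].
Proof.
move=> cfl.
have exs i : exists s : {linear Z i -> Y i}, forall z, g i (s z) = z.
  by have [_ _] := cfl i.
pose s i := sval (cid (exs i)).
have gs i z : g i (s i z) = z by rewrite /s; case: cid.
have inj i : injective (f i) by have [] := cfl i.
have gf i x : g i (f i x) = 0.
  by have [_ ex _] := cfl i; apply/ex; exists x.
have exr i : exists r : {linear Y i -> X i}, forall y, f i (r y) = y - s i (g i y).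
  have ex y : exists x, f i x = y - s i (g i y).
    by have [_ ex _] := cfl i; apply/ex; rewrite linearB /= gs subrr.
  have [r rE] := choice ex.
  have lr : linear r.
    move=> a x y; apply: (inj i); rewrite linearP !rE [g i _]linearP [s i _]linearP /=.
    by rewrite scalerBr opprD addrACA.
  by exists (mk_linear lr).
pose r i := sval (cid (exr i)).
have rE i y : f i (r i y) = y - s i (g i y) by rewrite /r; case: cid.
exists s, r; split=> //.
- by move=> i x; apply: (inj i); rewrite rE gf linear0 subr0.
- by move=> i z; apply: (inj i); rewrite rE gs subrr linear0.
- by move=> i y; rewrite rE subrK.
Qed.

End AlmostSplitEnds.

Section Twist.
Variables (A I : nzRingType) (X Z : complex A I) (phi : forall i j, {linear Z i -> X j}).
Hypothesis phi_shape : forall i j, j <> i + 1 -> forall z, phi i j z = 0.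
Hypothesis phi_cocycle : forall i j l z,
  cdiff X j l (phi i j z) + phi j l (cdiff Z i j z) = 0.

Lemma twist_linear i j :
  linear (fun x : (X i * Z i)%type => (cdiff X i j x.1 + phi i j x.2, cdiff Z i j x.2)).
Proof. by move=> a x y; congr pair; rewrite /= !linearP //= scalerDr addrACA. Qed.

Let twist_ob i : projmod A := prod_projmod (X i) (Z i).
Let twist_diff i j : {linear twist_ob i -> twist_ob j} := mk_linear (@twist_linear i j).

Lemma twist_shape i j : j <> i + 1 -> forall x, twist_diff i j x = 0.
Proof. by move=> ij x /=; rewrite !cdiff_shape // phi_shape // addr0. Qed.

Lemma twist_diffK i j l x : twist_diff j l (twist_diff i j x) = 0.
Proof. by rewrite /= linearD /= !cdiffK add0r phi_cocycle. Qed.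

(** The extension of Z by X with class [phi]: the sum of the two complexes,
with [phi] added to the differential. *)
Definition twist : complex A I := Complex twist_shape twist_diffK.

Lemma twist_in_comm i j (x : X i) :
  pairl (X j) (Z j) (cdiff X i j x) = cdiff twist i j (pairl (X i) (Z i) x).
Proof. by rewrite /= !linear0 addr0. Qed.
Definition twist_in : cmap X twist := @CMap _ _ X twist _ twist_in_comm.

Definition twist_out : cmap twist Z :=
  @CMap _ _ twist Z (fun i => (snd : {linear (X i * Z i)%type -> Z i})) (fun i j x => erefl).

Lemma twist_conflation : conflation twist_in twist_out.
Proof.
move=> i; split=> [x y []//|[x z]|]; first split=> /= [->|[y [_ <-]]//]; first by exists x.
by exists (pairr (X i) (Z i)).
Qed.

End Twist.

Section Cone.
Variable A : nzRingType.

Lemma cst_succ (X : complex A int) i j l x :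
  cst X (j + 1) l (cdiff X (i + 1) (j + 1) x) = cdiff X j l (cst X (i + 1) j x).
Proof.
have [ij|ij] := eqVneq j (i + 1); have [jl|jl] := eqVneq l (j + 1).
- by subst j; subst l; rewrite !cst_id.
- by rewrite cst_out ?[RHS]cdiff_shape //; apply/eqP; rewrite // eq_sym.
- rewrite [X in cst _ _ _ X]cdiff_shape ?linear0; last by move=> /addIr/eqP; rewrite (negPf ij).
  by rewrite cst_out ?linear0 //; apply/eqP; rewrite eq_sym.
- by rewrite cst_out ?[RHS]cdiff_shape //; apply/eqP; rewrite // eq_sym.
Qed.

Variables (X : bcomplex A) (Y : complex A int) (h : cmap X Y).

Lemma shift1E i j (n : shift 1 X i) : cdiff (shift 1 X) i j n = - cdiff X (i + 1) (j + 1) n.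
Proof. by rewrite /= expr1z mulrN1z. Qed.

Definition cone_phi i j : {linear shift 1 X i -> Y j} := h j \o cst X (i + 1) j.

Lemma cone_shape i j : j <> i + 1 -> forall n, cone_phi i j n = 0.
Proof. by move=> ij n; rewrite /= cst_out ?linear0 //; apply/nesym. Qed.

Lemma cone_cocycle i j l n :
  cdiff Y j l (cone_phi i j n) + cone_phi j l (cdiff (shift 1 X) i j n) = 0.
Proof. by rewrite shift1E !linearN /= -cmap_comm cst_succ subrr. Qed.

Definition cone : complex A int := twist cone_shape cone_cocycle.

End Cone.

Lemma twist_bounded (A : nzRingType) (U V : complex A int) phi s c :
  bounded U -> bounded V -> bounded (@twist A int U V phi s c).
Proof.
move=> [a [b Uab]] [a' [b' Vab]]; exists (Num.min a a'), (Num.max b b') => i out -[x y].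
by congr pair; [apply: Uab|apply: Vab]; move: out; lia.
Qed.

Section Truncation.
Variables (A I : nzRingType) (X : complex A I) (P : pred I).

Let te i : {linear X i -> X i} :=
  if P i then (idfun : {linear X i -> X i}) else (\0 : {linear X i -> X i}).
Let te_idem i x : te i (te i x) = te i x. Proof. by rewrite /te; case: ifP. Qed.
Let te_diff i j l x : cdiff X j l (te j (cdiff X i j x)) = 0.
Proof. by rewrite /te; case: ifP => _; rewrite /= ?cdiffK ?linear0. Qed.

(** The brutal truncation. *)
Definition trunc : complex A I := im_complex te_idem te_diff.
Definition tinc i : {linear trunc i -> X i} := im_inc te_idem i.
Definition tprj i : {linear X i -> trunc i} := im_prj te_idem i.

Lemma tincK i x : tprj i (tinc i x) = x. Proof. exact: im_incK. Qed.
Lemma tprjK i x : P i -> tinc i (tprj i x) = x.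
Proof. by rewrite [LHS]/(te i x) /te => ->. Qed.
Lemma tdiffE i j x : cdiff trunc i j x = tprj j (cdiff X i j (tinc i x)).
Proof. by []. Qed.
Lemma trunc_out i : ~~ P i -> zero_module (trunc i).
Proof.
move=> Pi x; have te0 z : te i z = 0 by rewrite /te (negPf Pi).
have tinc0 y : tinc i y = 0 by rewrite -[y]tincK; apply: te0.
by rewrite -[x]tincK tinc0 linear0.
Qed.

End Truncation.

Section Span.
Variables (k : fieldType) (A : falgType k) (nu : nat).
Hypotheses (nu_ge1 : (1 <= nu)%N) (A_sgldim : is_sgldim A nu).
Variables (X Y Z : complex A int) (f : cmap X Y) (g : cmap Y Z).
Hypotheses (bX : bounded X) (bY : bounded Y) (bZ : bounded Z).
Hypothesis cfl : conflation f g.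

(** Suppose b - a > nu, so that X vanishes up to degree a.  The inclusion of
the part of Z above degree a is not a retraction, so it lifts through g.
Dividing Y by the image of the lift leaves a complex V that agrees with Y up
to degree a and with X above it.  An idempotent of V that is the identity in
degree a and zero in degree b restricts to X as a non-identity idempotent,
hence as zero; so V has zero differential out of degree a, and this says that
the lift extends to a section of g. *)
Lemma span_up (a b : int) : right_almost_split (@bounded A) g -> indec X ->
  ~ zero_module (Z a) -> ~ zero_module (X b) -> b - a <= nu%:Z.
Proof.
move=> [ng lift] iX Za Xb; rewrite leNgt; apply/negP => ab.
have Xlow j : j <= a -> zero_module (X j).
  move=> ja; apply: contrapT => Xj.
  by have := indec_width nu_ge1 A_sgldim bX iX Xb Xj; lia.
have [s [r [gs rf gf rs frsg]]] := conflation_splitting cfl.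
pose T := trunc Z (fun i => a < i).
pose inc i : {linear T i -> Z i} := tinc Z (fun i => a < i) i.
pose prj i : {linear Z i -> T i} := tprj Z (fun i => a < i) i.
have incK i x : prj i (inc i x) = x by exact: tincK.
have prjK i z : a < i -> inc i (prj i z) = z by exact: tprjK.
have T0 i : i <= a -> zero_module (T i).
  by move=> ia; apply: trunc_out; rewrite -leNgt.
have dT i j x : cdiff T i j x = prj j (cdiff Z i j (inc i x)) by [].
have inc_comm i j x : inc j (cdiff T i j x) = cdiff Z i j (inc i x).
  have [ij|/eqP ij] := eqVneq j (i + 1); last by rewrite !cdiff_shape ?linear0.
  have [ia|ai] := leP i a; last by rewrite dT prjK //; lia.
  by rewrite (T0 i ia x) !linear0.
have bT : bounded T.
  move: bZ => [lo [hi Zab]]; exists lo, hi => i /Zab Zi x.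
  by rewrite -[x]incK (Zi (inc i x)) linear0.
pose incT : cmap T Z := @CMap _ _ T Z inc inc_comm.
have [lam lamE] : exists lam : cmap T Y, g \oc lam = incT.
  have [|h /cmapP] := lift T bT incT; last by exists h.
  move=> /retractionE[v iv]; apply: Za => z.
  rewrite -[z]/((1 : cmap Z Z) a z) -iv /= -/(inc a _).
  by rewrite (T0 a (lexx a) (v a z)) ?linear0.
have glam i x : g i (lam i x) = inc i x by rewrite -[RHS]/(incT i x) -lamE.
(* A degreewise section of g that is compatible with the differentials above
   degree a, thanks to lam. *)
pose w i : {linear Z i -> Y i} :=
  if a < i then (lam i \o prj i : {linear Z i -> Y i}) else s i.
have wE i z : a < i -> w i z = lam i (prj i z) by rewrite /w => ->.
have gw i z : g i (w i z) = z.
  have [ia|ai] := leP i a; first by rewrite /w ltNge ia gs.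
  by rewrite wE // glam prjK.
have dw i j z : a < i -> cdiff Y i j (w i z) = w j (cdiff Z i j z).
  move=> ai; have [ij|/eqP ij] := eqVneq j (i + 1); last by rewrite !cdiff_shape ?linear0.
  have aj : a < j by lia.
  by rewrite !wE // -cmap_comm dT prjK.
pose e i : {linear Y i -> Y i} :=
  if a < i then (idfun \- (w i \o g i) : {linear Y i -> Y i}) else idfun.
have e_hi i y : a < i -> e i y = y - w i (g i y) by rewrite /e => ->.
have e_lo i y : i <= a -> e i y = y by rewrite /e leNgt => /negPf ->.
have ee i y : e i (e i y) = e i y.
  have [ia|ai] := leP i a; first by rewrite !e_lo.
  by rewrite !e_hi // linearB /= gw subrr linear0 subr0.
have ded i j l y : cdiff Y j l (e j (cdiff Y i j y)) = 0.
  have [ja|aj] := leP j a; first by rewrite e_lo // cdiffK.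
  by rewrite e_hi // linearB /= cdiffK cmap_comm dw // cdiffK linear0 subr0.
pose V := im_complex ee ded.
pose vinc i : {linear V i -> Y i} := im_inc ee i.
pose vprj i : {linear Y i -> V i} := im_prj ee i.
have vincK i v : vprj i (vinc i v) = v by exact: im_incK.
have vprjK i y : vinc i (vprj i y) = e i y by [].
have dV i j v : cdiff V i j v = vprj j (cdiff Y i j (vinc i v)) by [].
have vinc_inj i : injective (vinc i) by apply: can_inj (vincK i).
have vprj_w i z : a < i -> vprj i (w i z) = 0.
  by move=> ai; apply: vinc_inj; rewrite vprjK e_hi // gw subrr linear0.
have vprj_comm i j y : vprj j (cdiff Y i j y) = cdiff V i j (vprj i y).
  have [ij|/eqP ij] := eqVneq j (i + 1); last by rewrite !cdiff_shape ?linear0.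
  rewrite dV vprjK; have [ia|ai] := leP i a; first by rewrite e_lo.
  rewrite e_hi // [cdiff Y i j (_ - _)]linearB [in RHS]dw // [in RHS]linearB.
  by rewrite vprj_w ?subr0 //; lia.
have gvinc i v : a < i -> g i (vinc i v) = 0.
  by move=> ai; rewrite -[v]vincK vprjK e_hi // linearB /= gw subrr.
have bV : bounded V.
  move: bY => [lo [hi Yab]]; exists lo, hi => i /Yab Yi v.
  by rewrite -[v]vincK (Yi (vinc i v)) linear0.
have [|eps [epsM eps_a eps_b]] := separate_degrees nu_ge1 A_sgldim bV (a := a) (b := b).
  lia.
have epsK i v : eps i (eps i v) = eps i v by rewrite -cME epsM.
pose kap i : {linear X i -> V i} := vprj i \o f i.
(* [kap] is a chain map and [rho] its inverse above degree a, but [rho] does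
not commute with the differential out of degree a: this is where the
extension class of V sits. *)
pose rho i : {linear V i -> X i} := r i \o vinc i.
have rhokap i x : rho i (kap i x) = x.
  rewrite -[LHS]/(r i (vinc i (vprj i (f i x)))) vprjK; have [ia|ai] := leP i a; first by rewrite e_lo.
  by rewrite e_hi // gf linear0 subr0 rf.
have kaprho i v : a < i -> kap i (rho i v) = v.
  move=> ai; rewrite -[LHS]/(vprj i (f i (r i (vinc i v)))); have := frsg i (vinc i v); rewrite gvinc // linear0 addr0 => ->.
  exact: vincK.
have kap_comm i j x : kap j (cdiff X i j x) = cdiff V i j (kap i x).
  by rewrite -[RHS]/(cdiff V i j (vprj i (f i x))) -vprj_comm -cmap_comm.
pose e'_fun i : {linear X i -> X i} := rho i \o (eps i \o kap i).
have e'_comm i j x : e'_fun j (cdiff X i j x) = cdiff X i j (e'_fun i x).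
  have [ia|ai] := leP i a; first by rewrite (Xlow i ia x) !linear0.
  have [ij|/eqP ij] := eqVneq j (i + 1); last by rewrite !cdiff_shape ?linear0.
  rewrite /e'_fun; rewrite -[LHS]/(rho j (eps j (kap j (cdiff X i j x)))) kap_comm cmap_comm.
  rewrite -[in LHS](kaprho i (eps i _) ai) -kap_comm rhokap.
  by [].
pose e' : cmap X X := CMap e'_comm.
have e'E i x : e' i x = rho i (eps i (kap i x)) by [].
have e'e' : e' * e' = e'.
  apply: cmapP => i x; rewrite cME.
  have [ia|ai] := leP i a; first by rewrite (Xlow i ia x) !linear0.
  by rewrite !e'E kaprho // epsK.
have e'0 : e' = 0.
  case: (iX.2 _ e'e') => // e'1; case: Xb => x.
  by rewrite -[x]/((1 : cmap X X) b x) -e'1 e'E eps_b linear0.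
have eps0 i v : a < i -> eps i v = 0.
  move=> ai; rewrite -[v](kaprho i) // -[LHS](kaprho i) // -e'E e'0.
  by rewrite c0E linear0.
have dVa j v : cdiff V a j v = 0.
  have [aj|/eqP aj] := eqVneq j (a + 1); last by rewrite cdiff_shape.
  by rewrite -[v]eps_a -cmap_comm eps0 //; lia.
have dwa j z : cdiff Y a j (w a z) = w j (cdiff Z a j z).
  have [aj|/eqP aj] := eqVneq j (a + 1); last by rewrite !cdiff_shape ?linear0.
  have := dVa j (vprj a (w a z)); rewrite -vprj_comm => /(congr1 (vinc j)).
  rewrite vprjK e_hi; last by lia.
  by rewrite linear0 cmap_comm gw => /eqP; rewrite subr_eq0 => /eqP.
have w_comm i j z : w j (cdiff Z i j z) = cdiff Y i j (w i z).
  case: (ltgtP i a) => [ia|ai|ia]; last 1 first.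
  - by subst i; rewrite dwa.
  - have [ij|/eqP ij] := eqVneq j (i + 1); last by rewrite !cdiff_shape ?linear0.
    apply/eqP; rewrite -subr_eq0; apply/eqP; rewrite -[LHS](frsg j) [g j (_ - _)]linearB.
    rewrite gw cmap_comm gw subrr linear0 addr0 (Xlow j _ (r j _)) ?linear0 //; lia.
  - by rewrite dw.
case: ng; apply/retractionE; exists (CMap w_comm).
by apply: cmapP => i z; apply: gw.
Qed.

(** Let Y2 be a summand of Y that vanishes in degree a + 1 and contains Y in
degree b. Left minimality makes the component f2 : X -> Y2 irreducible.  In
the cone C of f2, take a summand C1 that contains C in degree a and vanishes
in degree b.  The pullback U of C -> X[1] along C1 -> C factors f2 as X -> U
-> Y2.  As U vanishes in degree b and Y2 does not, X -> U is a section.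
Evaluated in degree a this means that the differential of X out of degree a +
1 is split mono.  So X is contractible and f is a section. *)
Lemma span_down (a b : int) : left_almost_split (@bounded A) f -> left_minimal f ->
  indec X -> ~ zero_module (X (a + 1)) -> zero_module (X a) -> ~ zero_module (Z b) ->
  b - (a + 1) <= nu%:Z.
Proof.
move=> [nf ext] lmin iX Xa1 Xa Zb; rewrite leNgt; apply/negP => ab.
have Xb : zero_module (X b).
  apply: contrapT => Xb.
  by have := indec_width nu_ge1 A_sgldim bX iX Xb Xa1; lia.
have [s [r [gs rf gf rs frsg]]] := conflation_splitting cfl.
have [|eps [epsM eps_b eps_a]] := separate_degrees nu_ge1 A_sgldim bY (a := b) (b := a + 1).
  lia.
have [Y2 [i2 [p2 [pi2 ip2]]]] := split_idem epsM.
have pi2E i y : p2 i (i2 i y) = y by rewrite -[RHS]/((1 : cmap Y2 Y2) i y) -pi2.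
have ip2E i y : i2 i (p2 i y) = eps i y by rewrite -ip2.
have Y2a : zero_module (Y2 (a + 1)).
  by move=> y; rewrite -[y]pi2E -[i2 _ y]/(i2 (a + 1) y) -[y in i2 _ y]pi2E ip2E eps_a linear0.
pose f2 := p2 \oc f.
have Y2b : ~ zero_module (Y2 b).
  by move=> Y2b; apply: Zb => z; rewrite -[z]gs -[s b z]eps_b -ip2E (Y2b (p2 b _)) !linear0.
(* Irreducibility of f2: it does not factor through a complex that vanishes
in degree b unless the first factor is a section. *)
have sect U (kap : cmap X U) (rho : cmap U Y2) : bounded U -> zero_module (U b) ->
    rho \oc kap = f2 -> section kap.
  move=> bU Ub rk; apply: contrapT => /(ext U bU)[kap' /cmapP kf].
  pose phi := 1 - i2 \oc p2 + i2 \oc (rho \oc kap').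
  have /isoE[psi [_ phipsi]] : isomorphism phi.
    apply: lmin => i x; rewrite -[RHS]/((f : cmap X Y) i x); congr (cmap_fun _ i x).
    by rewrite /phi !ccompDl ccompNl ccomp1l -!ccompA kf rk /f2 subrK.
  have p2phi : p2 \oc phi = rho \oc kap'.
    by rewrite /phi !ccompDr ccompNr ccomp1r !ccompA pi2 !ccomp1l subrr add0r.
  apply: Y2b => y; rewrite -[y]pi2E -[p2 b _]/((p2 \oc 1) b (i2 b y)) -phipsi ccompA p2phi /=.
  by rewrite (Ub (kap' b _)) linear0.
pose X' := BComplex bX; pose C := cone (X := X') f2.
have bC : bounded C by apply: twist_bounded; [apply: bounded_retract pi2 bY|apply: bc_bounded].
have [|del [delM del_a del_b]] := separate_degrees nu_ge1 A_sgldim bC (a := a) (b := b).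
  lia.
have [C1 [i1 [p1 [pi1 ip1]]]] := split_idem delM.
have pi1E i c : p1 i (i1 i c) = c by rewrite -[RHS]/((1 : cmap C1 C1) i c) -pi1.
have ip1E i c : i1 i (p1 i c) = del i c by rewrite -ip1.
have C1b : zero_module (C1 b).
  by move=> c; rewrite -[c]pi1E -[c in i1 _ c]pi1E ip1E del_b linear0.
pose phi i j : {linear C1 i -> X j} := cst X (i + 1) j \o (snd \o i1 i).
have phiE i j c : phi i j c = cst X (i + 1) j (i1 i c).2 by [].
have phi_shape i j : j <> i + 1 -> forall c, phi i j c = 0.
  by move=> ij c; rewrite phiE cst_out //; apply/nesym.
have phi_cocycle i j l c : cdiff X j l (phi i j c) + phi j l (cdiff C1 i j c) = 0.
  rewrite !phiE cmap_comm.
  rewrite -[(cdiff C i j (i1 i c)).2]/(cdiff (shift 1 X') i j (i1 i c).2) shift1E.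
  by rewrite linearN -cst_succ subrr.
pose U := twist phi_shape phi_cocycle.
have bU : bounded U by apply: twist_bounded => //; apply: bounded_retract pi1 bC.
have Ub : zero_module (U b) by move=> [x c]; congr pair; [apply: Xb|apply: C1b].
pose rho_fun i : {linear U i -> Y2 i} := (f2 i \o fst) \- (fst \o (i1 i \o snd)).
have rho_funE i u : rho_fun i u = f2 i u.1 - (i1 i u.2).1 by [].
have rho_comm i j u : rho_fun j (cdiff U i j u) = cdiff Y2 i j (rho_fun i u).
  case: u => x c; rewrite !rho_funE.
  rewrite -[(cdiff U i j (x, c)).1]/(cdiff X i j x + phi i j c).
  rewrite -[(cdiff U i j (x, c)).2]/(cdiff C1 i j c) cmap_comm phiE.
  set n := (i1 i c).2; set y := (i1 i c).1.
  rewrite -[(cdiff C i j (i1 i c)).1]/(cdiff Y2 i j y + f2 j (cst X (i + 1) j n)).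
  by rewrite linearD [cdiff Y2 i j (_ - _)]linearB cmap_comm opprD addrACA subrr addr0.
pose rho : cmap U Y2 := CMap rho_comm.
have [r1 r1E] : exists r1 : cmap U X, r1 \oc twist_in phi_shape phi_cocycle = 1.
  apply/sectionE; apply: (sect U _ rho) => //.
  by apply: cmapP => i x; rewrite [LHS]rho_funE /= linear0 subr0.
have r1in i x : r1 i (x, 0) = x by rewrite -[RHS]/((1 : cmap X X) i x) -r1E.
(* The retraction r1, applied to the boundary of (0, c) with c in degree a
   corresponding to n, exhibits n as a linear function of the differential of n. *)
pose s1 : {linear X (a + 1 + 1) -> X (a + 1)} :=
  r1 (a + 1) \o (pairr _ _ \o (p1 (a + 1) \o pairr (Y2 (a + 1)) (shift 1 X' (a + 1)))).
have s1E m : s1 m = r1 (a + 1) (0, p1 (a + 1) (0, m)) by [].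
have s1d n : s1 (cdiff X (a + 1) (a + 1 + 1) n) = n.
  pose c := p1 a (0, n : shift 1 X' a).
  have ic : i1 a c = (0, n) by rewrite ip1E del_a.
  have dc : cdiff C1 a (a + 1) c = - p1 (a + 1) (0, cdiff X (a + 1) (a + 1 + 1) n).
    rewrite -cmap_comm -linearN; congr (p1 (a + 1) _); congr pair.
    by rewrite [LHS]Y2a [RHS]Y2a.
  have := cmap_comm r1 (a + 1) ((0, c) : U a); rewrite (Xa (r1 a _)) linear0.
  have -> : cdiff U a (a + 1) (0, c) = (n, 0) - (0, - cdiff C1 a (a + 1) c).
    congr pair; last by rewrite /= opprK add0r.
    by rewrite /= linear0 add0r oppr0 addr0 -/(i1 a c) ic cst_id.
  rewrite linearB /= r1in => /eqP; rewrite subr_eq0 => /eqP nE.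
  by rewrite [RHS]nE dc opprK.
have ds1d x : cdiff X (a + 1) (a + 1 + 1) (s1 (cdiff X (a + 1) (a + 1 + 1) x))
    = cdiff X (a + 1) (a + 1 + 1) x by rewrite s1d.
have [[s1d0 _]|[_ ds1 Xout]] := elem_indec ds1d iX.
  by apply: Xa1 => x; rewrite -[LHS]s1d s1d0.
(* A retraction of f, built from the contraction s1 of X and the degreewise
retraction r in the upper of the two degrees of X. *)
pose q i : {linear Y i -> X i} :=
  (cst X (a + 1) i \o (s1 \o (r (a + 1 + 1) \o cdiff Y i (a + 1 + 1))))
  \+ (cst X (a + 1 + 1) i \o (r (a + 1 + 1) \o cst Y i (a + 1 + 1))).
have qE i y : q i y = cst X (a + 1) i (s1 (r (a + 1 + 1) (cdiff Y i (a + 1 + 1) y)))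
    + cst X (a + 1 + 1) i (r (a + 1 + 1) (cst Y i (a + 1 + 1) y)) by [].
have q_comm i j y : q j (cdiff Y i j y) = cdiff X i j (q i y).
  have [ij|/eqP ij] := eqVneq j (i + 1); last by rewrite !cdiff_shape ?linear0.
  subst j; rewrite !qE cdiffK !linear0 add0r linearD.
  have [ia|ia] := eqVneq i (a + 1).
    subst i; rewrite !cst_id [cst Y _ _ y]cst_out ?linear0 ?addr0 ?ds1 //; lia.
  rewrite [cst Y _ _ (cdiff _ _ _ _)]cst_out ?linear0; last by move=> /addIr/eqP; apply/negP.
  rewrite cst_out ?linear0 ?add0r; last by apply/eqP; rewrite eq_sym.
  have [ia2|/eqP ia2] := eqVneq i (a + 1 + 1); last by rewrite cst_out ?linear0 //; apply/nesym.
  by rewrite [RHS](Xout (i + 1)) //; lia.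
case: nf; apply/sectionE; exists (CMap q_comm); apply: cmapP => i x.
rewrite [LHS]qE -cmap_comm rf.
have [ia|/eqP ia] := eqVneq i (a + 1).
  subst i; rewrite cst_id s1d [cst Y _ _ _]cst_out ?linear0 ?addr0 //; lia.
have [ia2|/eqP ia2] := eqVneq i (a + 1 + 1); last by rewrite [RHS](Xout i) ?[LHS](Xout i).
by subst i; rewrite !cst_id cst_out ?add0r ?rf //; lia.
Qed.

Lemma least_degree (P : int -> Prop) (lo a : int) : P a -> (forall i, P i -> lo <= i) ->
  exists c, P c /\ forall i, P i -> c <= i.
Proof.
move=> Pa Plo; have exP : exists n, `[< P (lo + n%:Z) >].
  exists (absz (a - lo)); apply/asboolP; have -> // : lo + (absz (a - lo))%:Z = a.
  by have := Plo _ Pa; lia.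
exists (lo + (ex_minn exP)%:Z); case: ex_minnP => n /asboolP Pn nmin; split=> // i Pi.
have := nmin (absz (i - lo)); have := Plo _ Pi => loi.
have -> : lo + (absz (i - lo))%:Z = i by lia.
by move=> /(_ (asboolT Pi)); lia.
Qed.

Lemma almost_split_span : almost_split (@bounded A) f g ->
  exists c, [/\ concentrated c (c + nu%:Z) X, concentrated c (c + nu%:Z) Y &
                concentrated c (c + nu%:Z) Z].
Proof.
move=> [_ _ [fl fm] [gr _]].
have iX := left_almost_split_indec bX fl; have iZ := right_almost_split_indec bZ gr.
have [s [r [gs rf gf rs frsg]]] := conflation_splitting cfl.
have YX i : ~ zero_module (X i) -> ~ zero_module (Y i).
  by move=> Xi Y0; apply: Xi => x; rewrite -[x]rf (Y0 (f i x)) linear0.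
have YZ i : ~ zero_module (Z i) -> ~ zero_module (Y i).
  by move=> Zi Y0; apply: Zi => z; rewrite -[z]gs (Y0 (s i z)) linear0.
have XZY i : ~ zero_module (Y i) -> ~ zero_module (X i) \/ ~ zero_module (Z i).
  move=> Yi; apply: contrapT => /not_orP[/contrapT X0 /contrapT Z0]; apply: Yi => y.
  by rewrite -[y]frsg (X0 (r i y)) (Z0 (g i y)) !linear0 addr0.
have down a b : ~ zero_module (X a) -> ~ zero_module (Z b) -> b - a <= nu%:Z.
  move=> Xa Zb; have [lo [hi Xlo]] := bX.
  have [|c [Xc cmin]] := @least_degree (fun i => ~ zero_module (X i)) lo a Xa.
    by move=> i Xi; have [//|loi] := leP lo i; case: Xi; apply: Xlo; rewrite leNgt loi.
  have Xc1 : zero_module (X (c - 1)).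
    by apply: contrapT => /cmin; lia.
  have := span_down (a := c - 1) fl fm iX; rewrite subrK => /(_ b Xc Xc1 Zb).
  by have := cmin a Xa; lia.
have [i0 Yi0] : exists i, ~ zero_module (Y i).
  by have [i Zi] := nonzero_degree iZ.1; exists i; apply: YZ.
have [lo [hi Ylo]] := bY.
have [|c [Yc cmin]] := @least_degree (fun i => ~ zero_module (Y i)) lo i0 Yi0.
  by move=> i Yi; have [//|loi] := leP lo i; case: Yi; apply: Ylo; rewrite leNgt loi.
have conc i : ~ zero_module (Y i) -> c <= i <= c + nu%:Z.
  move=> Yi; rewrite cmin //=.
  suff : i - c <= nu%:Z by lia.
  case: (XZY _ Yc) => [Xc|Zc]; case: (XZY _ Yi) => [Xi|Zi].
  - exact: indec_width bX iX Xi Xc.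
  - exact: down.
  - exact: span_up.
  - exact: indec_width bZ iZ Zi Zc.
exists c; split=> i /negP out; apply: contrapT => Wi; apply: out; apply: conc => //.
  exact: YX.
exact: YZ.
Qed.

End Span.

(** * The grading on maps between compressed complexes *)

Section CompressionGrading.
Variables (A : nzRingType) (m : nat) (m_gt1 : (1 < m)%N).

Local Notation "'F' X" := (compress m_gt1 X) (at level 10, X at level 9).
Local Notation Fm f := (compress_map m_gt1 f).

Lemma deg_div (i : 'Z_m) t : (deg i t %/ m%:Z)%Z = t.
Proof.
rewrite /deg addrC divzMDl; last by lia.
by rewrite divz_nat divn_small ?addr0 // -[leqRHS](Zp_cast m_gt1).
Qed.

Lemma deg_inj (i : 'Z_m) t s : deg i t = deg i s -> t = s.
Proof. by move=> ts; rewrite -[t](deg_div i) ts deg_div. Qed.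

(** Every integer is [deg (cl j) (qt j)], so that statements about a bounded
complex in degree j can be proved in the form in which degrees occur in its
compression. *)
Definition cl (j : int) : 'Z_m := inZp (absz (j %% m%:Z)%Z).
Definition qt (j : int) : int := (j %/ m%:Z)%Z.

Lemma deg_cl j : deg (cl j) (qt j) = j.
Proof.
rewrite /deg /cl /qt /= (Zp_cast m_gt1) modn_small; last by lia.
by rewrite [RHS](divz_eq j m%:Z) addrC gez0_abs //; lia.
Qed.

Lemma qt_deg (i : 'Z_m) t : qt (deg i t) = t. Proof. exact: deg_div. Qed.

Lemma cl_deg (i : 'Z_m) t : cl (deg i t) = i.
Proof.
apply: val_inj; have : deg (cl (deg i t)) (qt (deg i t)) = deg i t by apply: deg_cl.
by rewrite qt_deg /deg => /addIr[].
Qed.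

Section Components.
Variable X : bcomplex A.

Definition demb (i : 'Z_m) t : {linear X (deg i t) -> F X i} :=
  mk_linear (@dinj_linear A _ (fun t => X (deg i t) : lmodType A) t).

Lemma dprj_linear (i : 'Z_m) t : linear (fun y : F X i => (y : dsum _) t : X (deg i t)).
Proof. by []. Qed.
Definition dprj (i : 'Z_m) t : {linear F X i -> X (deg i t)} := mk_linear (@dprj_linear i t).

Lemma dprjK i t x : dprj i t (demb i t x) = x.
Proof. exact: dfwith_in. Qed.

Lemma dprj_out i t s x : t <> s -> dprj i s (demb i t x) = 0.
Proof. by move=> /eqP ts; apply: dfwith_out. Qed.

(** Extensionality in the target and, in [compress_ext], in the source: maps
between compressed complexes are compared on matrix entries. *)
Lemma compressP i (y z : F X i) : (forall t, dprj i t y = dprj i t z) -> y = z.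
Proof. exact: dsumP. Qed.

Lemma compress_decomp i : exists w : seq int, forall y : F X i, y = \sum_(t <- w) demb i t (dprj i t y).
Proof.
have [n Xn] := bounded_window m_gt1 X i; exists (window n) => y.
exact: (dsum_dinjE (window_uniq n) Xn y).
Qed.

Lemma compress_ext i (M : lmodType A) (p q : {linear F X i -> M}) :
  (forall t x, p (demb i t x) = q (demb i t x)) -> p = q.
Proof.
move=> pq; apply: linear_ext => y; have [w wE] := compress_decomp i; rewrite (wE y).
by rewrite !linear_sum; apply: eq_bigr => t _.
Qed.

Lemma diff_dprjE i j s y : dprj j s (cdiff (F X) i j y) =
  cdiff X (deg i (pred_index j s)) (deg j s) (dprj i (pred_index j s) y).
Proof. by []. Qed.

Lemma diff_dprj i j t s y : deg j s = deg i t + 1 ->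
  dprj j s (cdiff (F X) i j y) = cdiff X (deg i t) (deg j s) (dprj i t y).
Proof. by move=> ts; rewrite /= (pred_indexE m_gt1 ts). Qed.

Lemma diff_demb i j t s x : deg j s = deg i t + 1 ->
  cdiff (F X) i j (demb i t x) = demb j s (cdiff X (deg i t) (deg j s) x).
Proof.
move=> ts; apply: compressP => s'; have [<-|/eqP ss'] := eqVneq s s'.
  by rewrite (diff_dprj _ ts) !dprjK.
rewrite dprj_out // diff_dprjE; have [tt'|/eqP tt'] := eqVneq (pred_index j s') t.
  rewrite tt' cdiff_shape // -ts => /deg_inj; exact/nesym.
by rewrite dprj_out ?linear0 //; apply/nesym.
Qed.

End Components.

Lemma diff_homog (X : bcomplex A) i j t s x : deg i t + 1 <> deg j s ->
  dprj X j s (cdiff (F X) i j (demb X i t x)) = 0.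
Proof.
move=> ts; rewrite diff_dprjE; have [tt'|/eqP tt'] := eqVneq (pred_index j s) t.
  by rewrite tt' cdiff_shape // => /esym.
by rewrite dprj_out ?linear0 //; apply/nesym.
Qed.

Lemma Fm_demb (X Y : bcomplex A) (f : cmap X Y) i t x :
  Fm f i (demb X i t x) = demb Y i t (f (deg i t) x).
Proof.
apply: compressP => s; rewrite -[LHS]/(f (deg i s) (dprj X i s (demb X i t x))).
have [<-|/eqP ts] := eqVneq t s; first by rewrite !dprjK.
by rewrite !dprj_out // linear0.
Qed.

Section Homogeneous.
Variables X Y : bcomplex A.

(** The degree of a matrix entry is the difference of the two bounded degrees,
an arbitrary integer and not only a multiple of m.  So the differential is
homogeneous of degree one, and the same notion serves for chain maps,
extension classes and homotopies. *)
Definition homog i j (r : int) (p : {linear F X i -> F Y j}) : Prop :=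
  forall t s x, deg i t + r <> deg j s -> dprj Y j s (p (demb X i t x)) = 0.

Section Part.
Variables (i j : 'Z_m) (r : int) (p : {linear F X i -> F Y j}).

Definition hpart_fun (y : F X i) : F Y j :=
  @DSum A int (fun s => Y (deg j s) : lmodType A)
    (fun s => let t := qt (deg j s - r) in
       if deg i t + r == deg j s then dprj Y j s (p (demb X i t (dprj X i t y))) else 0)
    (comp_finite m_gt1 _).

Lemma hpart_linear : linear hpart_fun.
Proof.
move=> a y z; apply: dsumP => s /=; case: ifP => _; last by rewrite scaler0 addr0.
by rewrite -[LHS]/(dprj Y j s (p (demb X i _ (dprj X i _ (a *: y + z))))) !linearP.
Qed.

(** The homogeneous part of degree r.  A column of the matrix has at most one
entry of degree r in a given row, which makes the formula free of sums. *)
Definition hpart : {linear F X i -> F Y j} := mk_linear hpart_linear.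

Lemma hpartE t s x : dprj Y j s (hpart (demb X i t x)) =
  if deg i t + r == deg j s then dprj Y j s (p (demb X i t x)) else 0.
Proof.
rewrite -[LHS]/(if deg i (qt (deg j s - r)) + r == deg j s then
  dprj Y j s (p (demb X i _ (dprj X i (qt (deg j s - r)) (demb X i t x)))) else 0).
have [ts|ts] := eqVneq (deg i t + r) (deg j s).
  have -> : qt (deg j s - r) = t by rewrite -ts addrK qt_deg.
  by rewrite ts eqxx dprjK.
case: ifP => // ts'; rewrite dprj_out ?linear0 // => tq.
by case/eqP: ts; rewrite tq; apply/eqP.
Qed.

Lemma hpart_homog : homog r hpart.
Proof. by move=> t s x /eqP/negPf ts; rewrite hpartE ts. Qed.

Lemma hpart_id : homog r p -> hpart = p.
Proof.
move=> hp; apply: compress_ext => t x; apply: compressP => s; rewrite hpartE.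
by case: eqP => // /hp->.
Qed.

End Part.

Lemma homog_local i j r (p : {linear F X i -> F Y j}) s y z : homog r p ->
  (forall t, deg i t + r = deg j s -> dprj X i t y = dprj X i t z) ->
  dprj Y j s (p y) = dprj Y j s (p z).
Proof.
move=> hp yz; have [w wE] := compress_decomp X i.
rewrite (wE y) (wE z) !linear_sum; apply: eq_bigr => t _.
by have [/yz->//|ts] := eqVneq (deg i t + r) (deg j s); rewrite !hp //; apply/eqP.
Qed.

Lemma hpart_supp i j r (p : {linear F X i -> F Y j}) D s y :
  (forall t, deg i t <> D -> dprj X i t y = 0) ->
  dprj Y j s (hpart r p y) = if D + r == deg j s then dprj Y j s (p y) else 0.
Proof.
move=> yD; have [w wE] := compress_decomp X i.
rewrite (wE y) !linear_sum; case: ifP => Ds; last rewrite big1 //; last move=> t _.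
  apply: eq_bigr => t _; have [tD|/eqP/yD->] := eqVneq (deg i t) D; last by rewrite !linear0.
  have E : (deg i t + r == deg j s) = (D + r == deg j s) by rewrite tD.
  by rewrite hpartE E Ds.
have [tD|/eqP/yD->] := eqVneq (deg i t) D; last by rewrite !linear0.
have E : (deg i t + r == deg j s) = (D + r == deg j s) by rewrite tD.
by rewrite hpartE E Ds.
Qed.

Lemma degrees_close : exists n : nat, forall (i j : 'Z_m) t s,
  ~ zero_module (X (deg i t)) -> ~ zero_module (Y (deg j s)) -> `|deg j s - deg i t| <= n%:Z.
Proof.
have [a [b Xab]] := bc_bounded X; have [a' [b' Yab]] := bc_bounded Y.
exists (absz a + absz b + absz a' + absz b')%N => i j t s Xt Ys.
have it : a <= deg i t <= b by apply: contraT => /Xab.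
have js : a' <= deg j s <= b' by apply: contraT => /Yab.
by move: it js; move: (deg i t) (deg j s) => u v; lia.
Qed.

(** Only finitely many degrees occur, uniformly in the map, since both
complexes are bounded. *)
Lemma hpart_sum : exists n : nat, forall i j (p : {linear F X i -> F Y j}) y,
  p y = \sum_(r <- window n) hpart r p y.
Proof.
have [n nP] := degrees_close; exists n => i j p y.
suff key t x : p (demb X i t x) = \sum_(r <- window n) hpart r p (demb X i t x).
  have [w wE] := compress_decomp X i; rewrite (wE y) linear_sum.
  under [RHS]eq_bigr => r _ do rewrite linear_sum.
  by rewrite exchange_big /=; apply: eq_bigr => t _; apply: key.
apply: compressP => s; rewrite linear_sum.
under [RHS]eq_bigr => r _ do rewrite hpartE.
have [Xt|Xt] := pselect (zero_module (X (deg i t))).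
  by rewrite (Xt x) !linear0 big1 // => r _; case: ifP.
have [Ys|Ys] := pselect (zero_module (Y (deg j s))).
  by rewrite [LHS]Ys [RHS]Ys.
have rw : deg j s - deg i t \in window n by apply: (mem_window m_gt1); apply: nP.
rewrite (bigD1_seq _ rw (window_uniq n)) /= [deg i t + _]addrC subrK eqxx.
rewrite big1 ?addr0 // => r rts; case: eqP => // ts; case/eqP: rts.
by rewrite -ts addrC addKr.
Qed.

Lemma hpartD i j r (p q : {linear F X i -> F Y j}) y :
  hpart r (p \+ q : {linear F X i -> F Y j}) y = hpart r p y + hpart r q y.
Proof.
rewrite -[RHS]/((hpart r p \+ hpart r q : {linear F X i -> F Y j}) y).
move: y; suff -> : hpart r (p \+ q : {linear F X i -> F Y j})
    = (hpart r p \+ hpart r q : {linear F X i -> F Y j}) by [].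
apply: compress_ext => t x; apply: compressP => s; rewrite hpartE /=.
rewrite -[RHS]/(dprj Y j s (hpart r p (demb X i t x)) + dprj Y j s (hpart r q (demb X i t x))).
by rewrite !hpartE; case: ifP; rewrite ?addr0.
Qed.

End Homogeneous.

(** Taking homogeneous parts is linear over homogeneous maps, here on the left
and in [hpart_compr] on the right.  Applied to the differential it shows that
the homogeneous parts of a chain map are chain maps. *)
Lemma hpart_compl (X Y Z : bcomplex A) i j l q r (p : {linear F Y j -> F Z l})
    (p' : {linear F X i -> F Y j}) y : homog r p ->
  hpart (q + r) (p \o p' : {linear F X i -> F Z l}) y = p (hpart q p' y).
Proof.
move=> hp; rewrite -[RHS]/((p \o hpart q p' : {linear F X i -> F Z l}) y); move: y.
suff -> : hpart (q + r) (p \o p' : {linear F X i -> F Z l}) = (p \o hpart q p') by [].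
apply: compress_ext => t x; apply: compressP => s; rewrite hpartE /=.
case: eqP => ts.
  apply: (homog_local hp) => u us; rewrite hpartE ifT //; apply/eqP.
  by apply: (addIr r); rewrite us -ts addrA.
rewrite -[LHS](linear0 (dprj Z l s)) -(linear0 p); apply: (homog_local hp) => u us.
rewrite linear0 hpartE ifF //; apply/eqP => tu; apply: ts.
by rewrite -us -tu addrA.
Qed.

Lemma hpart_compr (X Y Z : bcomplex A) i j l q r (p : {linear F Y j -> F Z l})
    (p' : {linear F X i -> F Y j}) y : homog r p' ->
  hpart (q + r) (p \o p' : {linear F X i -> F Z l}) y = hpart q p (p' y).
Proof.
move=> hp; rewrite -[RHS]/((hpart q p \o p' : {linear F X i -> F Z l}) y); move: y.
suff -> : hpart (q + r) (p \o p' : {linear F X i -> F Z l}) = (hpart q p \o p') by [].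
apply: compress_ext => t x; apply: compressP => s; rewrite hpartE.
rewrite [RHS](@hpart_supp _ _ _ _ _ _ (deg i t + r)); last by move=> u /nesym; apply: hp.
by rewrite [q + r]addrC (addrA (deg i t)).
Qed.

Section HomogeneousMaps.
Variables (X Y : bcomplex A) (r : int) (u : cmap (F X) (F Y)).

Lemma cpart_comm i j y : hpart r (u j) (cdiff (F X) i j y) = cdiff (F Y) i j (hpart r (u i) y).
Proof.
have hd (W : bcomplex A) : homog 1 (cdiff (F W) i j) by move=> t s x; apply: diff_homog.
rewrite -(hpart_compr _ _ _ (hd X)) -(hpart_compl _ _ _ (hd Y)).
congr (hpart _ _ _); apply: linear_ext => z; exact: cmap_comm.
Qed.

Definition cpart : cmap (F X) (F Y) := CMap cpart_comm.

Lemma cpartE i y : cpart i y = hpart r (u i) y. Proof. by []. Qed.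

End HomogeneousMaps.

Definition chomog (X Y : bcomplex A) r (u : cmap (F X) (F Y)) := forall i, homog r (u i).

Lemma cpart_homog (X Y : bcomplex A) r (u : cmap (F X) (F Y)) : chomog r (cpart r u).
Proof. by move=> i; apply: hpart_homog. Qed.

Lemma cpart_id (X Y : bcomplex A) r (u : cmap (F X) (F Y)) : chomog r u -> cpart r u = u.
Proof. by move=> hu; apply: cmapP => i y; rewrite cpartE hpart_id. Qed.

Lemma cpart_compl (X Y Z : bcomplex A) q r (u : cmap (F Y) (F Z)) (v : cmap (F X) (F Y)) :
  chomog r u -> cpart (q + r) (u \oc v) = u \oc cpart q v.
Proof. by move=> hu; apply: cmapP => i y; rewrite cpartE hpart_compl. Qed.

Lemma cpart_compr (X Y Z : bcomplex A) q r (u : cmap (F Y) (F Z)) (v : cmap (F X) (F Y)) :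
  chomog r v -> cpart (q + r) (u \oc v) = cpart q u \oc v.
Proof. by move=> hv; apply: cmapP => i y; rewrite cpartE hpart_compr. Qed.

Lemma cpartD (X Y : bcomplex A) r (u v : cmap (F X) (F Y)) : cpart r (u + v) = cpart r u + cpart r v.
Proof. by apply: cmapP => i y; rewrite cpartE cDE !cpartE -hpartD. Qed.

Lemma cpart_sum (X Y : bcomplex A) : exists n : nat, forall u : cmap (F X) (F Y),
  u = \sum_(r <- window n) cpart r u.
Proof.
have [n nP] := hpart_sum X Y; exists n => u; apply: cmapP => i y.
by rewrite csumE nP.
Qed.

Lemma cpart_bigsum (X Y : bcomplex A) r (J : Type) (w : seq J) (u : J -> cmap (F X) (F Y)) :
  cpart r (\sum_(j <- w) u j) = \sum_(j <- w) cpart r (u j).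
Proof.
elim: w => [|j w IH]; last by rewrite !big_cons cpartD IH.
by rewrite !big_nil; apply: (addrI (cpart r 0)); rewrite -cpartD !addr0.
Qed.

Lemma homog1 (X : bcomplex A) : chomog 0 (1 : cmap (F X) (F X)).
Proof. by move=> i t s x; rewrite addr0 => ts; apply: dprj_out => ts'; apply: ts; rewrite ts'. Qed.

Lemma Fm_homog (X Y : bcomplex A) (f : cmap X Y) : chomog 0 (Fm f).
Proof.
move=> i t s x; rewrite addr0 Fm_demb => ts; apply: dprj_out => ts'; apply: ts.
by rewrite ts'.
Qed.

Lemma chomog_comp (X Y Z : bcomplex A) q r (u : cmap (F Y) (F Z)) (v : cmap (F X) (F Y)) :
  chomog r u -> chomog q v -> chomog (q + r) (u \oc v).
Proof.
by move=> hu hv; rewrite -(cpart_id hv) -(cpart_compl _ _ hu); apply: cpart_homog.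
Qed.

Section Uncompress.
Variables X Y : bcomplex A.

(** Reads off the map between bounded degrees i and j; the transports in
source and target are trivial for degrees of the form [deg i t]. *)
Definition unf (i j : int) (p : {linear F X (cl i) -> F Y (cl j)}) : {linear X i -> Y j} :=
  cst Y (deg (cl j) (qt j)) j \o (dprj Y (cl j) (qt j) \o
    (p \o (demb X (cl i) (qt i) \o cst X i (deg (cl i) (qt i))))).

Lemma unfE (p : forall i j, {linear F X i -> F Y j}) i j t s x :
  @unf (deg i t) (deg j s) (p _ _) x = dprj Y j s (p i j (demb X i t x)).
Proof.
rewrite /unf; have := cl_deg i t; have := cl_deg j s; have := qt_deg i t; have := qt_deg j s.
move: (cl (deg i t)) (cl (deg j s)) (qt (deg i t)) (qt (deg j s)) => a b c d -> -> -> -> /=.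
by rewrite !cst_id.
Qed.

Lemma unfE_diag (p : forall i, {linear F X i -> F Y i}) i t x :
  @unf (deg i t) (deg i t) (p _) x = dprj Y i t (p i (demb X i t x)).
Proof.
rewrite /unf; have := cl_deg i t; have := qt_deg i t.
move: (cl (deg i t)) (qt (deg i t)) => a c -> -> /=.
by rewrite !cst_id.
Qed.

Variable u : cmap (F X) (F Y).

Definition unF_fun j : {linear X j -> Y j} := @unf j j (u (cl j)).

Lemma unF_funE i t x : unF_fun (deg i t) x = dprj Y i t (u i (demb X i t x)).
Proof. exact: (unfE_diag (fun i => u i)). Qed.

Lemma unF_comm i j x : unF_fun j (cdiff X i j x) = cdiff Y i j (unF_fun i x).
Proof.
have [ij|/eqP ij] := eqVneq j (i + 1); last by rewrite !cdiff_shape ?linear0.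
move: ij x; rewrite -(deg_cl i) -(deg_cl j).
move: (cl i) (cl j) (qt i) (qt j) => a b t s ts x; rewrite !unF_funE.
by rewrite -(diff_dprj _ ts) -(diff_demb _ ts) cmap_comm.
Qed.

(** The degree-zero part of a map between compressed complexes, as a map
between the bounded ones.  It is left inverse to compression and linear over
compressed maps ([unF_compl], [unF_compr]), which is how splittings and
factorizations descend. *)
Definition unF : cmap X Y := CMap unF_comm.

Lemma unFE i t x : unF (deg i t) x = dprj Y i t (u i (demb X i t x)).
Proof. exact: unF_funE. Qed.

Lemma unF_full : chomog 0 u -> Fm unF = u.
Proof.
move=> hu; apply: cmapP => i y; move: y.
suff -> : Fm unF i = u i by [].
apply: compress_ext => t x; rewrite Fm_demb; apply: compressP => s.
have [<-|/eqP ts] := eqVneq t s; first by rewrite dprjK unFE.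
by rewrite dprj_out // hu // addr0 => /deg_inj.
Qed.

End Uncompress.

Lemma deg_ext (X Y : bcomplex A) (f g : cmap X Y) :
  (forall (i : 'Z_m) t x, f (deg i t) x = g (deg i t) x) -> f = g.
Proof.
move=> fg; apply: cmapP => j; rewrite -(deg_cl j); exact: fg.
Qed.

Lemma unF1 (X : bcomplex A) : unF (1 : cmap (F X) (F X)) = 1.
Proof. by apply: deg_ext => i t x; rewrite unFE dprjK. Qed.

Lemma unF_compr (X Y Z : bcomplex A) (u : cmap (F Y) (F Z)) (f : cmap X Y) :
  unF (u \oc Fm f) = unF u \oc f.
Proof.
apply: deg_ext => i t x; rewrite unFE.
rewrite -[u \oc _]/(ccomp u _) -[(u \oc Fm f) i _]/(u i (Fm f i (demb X i t x))) Fm_demb.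
by rewrite -[RHS]/(unF u _ (f _ x)) unFE.
Qed.

Lemma unF_compl (X Y Z : bcomplex A) (f : cmap Y Z) (u : cmap (F X) (F Y)) :
  unF (Fm f \oc u) = f \oc unF u.
Proof.
apply: deg_ext => i t x; rewrite unFE -[RHS]/(f (deg i t) (unF u _ x)) unFE.
by [].
Qed.

Lemma Fm1 (X : bcomplex A) : Fm (1 : cmap X X) = 1.
Proof. by apply: cmapP => i y; apply: dsumP. Qed.

Lemma Fm_comp (X Y Z : bcomplex A) (g : cmap Y Z) (f : cmap X Y) : Fm (g \oc f) = Fm g \oc Fm f.
Proof. by apply: cmapP => i y; apply: dsumP. Qed.

Lemma Fm_iso (X Y : bcomplex A) (f : cmap X Y) : isomorphism f -> isomorphism (Fm f).
Proof.
move=> /isoE[g [gf fg]]; apply/isoE; exists (Fm g); split.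
  by rewrite -Fm_comp gf Fm1.
by rewrite -Fm_comp fg Fm1.
Qed.

Lemma compress_elim (X : bcomplex A) (i : 'Z_m) (M : lmodType A)
    (l : forall t, {linear X (deg i t) -> M}) :
  exists p : {linear F X i -> M}, forall t x, p (demb X i t x) = l t x.
Proof.
have [n Xn] := bounded_window m_gt1 X i.
have lp : linear (fun y : F X i => \sum_(t <- window n) l t (dprj X i t y)).
  move=> a y z; rewrite scaler_sumr -big_split /=; apply: eq_bigr => t _.
  by rewrite !linearP.
exists (mk_linear lp) => t x.
rewrite -[LHS]/(\sum_(s <- window n) l s (dprj X i s (demb X i t x))).
have [tn|/Xn Xt] := boolP (t \in window n).
  rewrite (bigD1_seq t tn (window_uniq n)) dprjK big1; first exact: addr0.
  by move=> s /eqP st; rewrite dprj_out ?linear0 //; apply/nesym.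
by rewrite (Xt x) !linear0 big1 // => s _; rewrite !linear0.
Qed.

Lemma compress_intro (X : bcomplex A) (i : 'Z_m) (M : lmodType A)
    (l : forall t, {linear M -> X (deg i t)}) :
  exists p : {linear M -> F X i}, forall t y, dprj X i t (p y) = l t y.
Proof.
pose p y : F X i := DSum (comp_finite m_gt1 (fun t => l t y)).
have lp : linear p by move=> a y z; apply: dsumP => t; rewrite /= linearP.
by exists (mk_linear lp).
Qed.

Lemma deg_next (i : 'Z_m) t : exists s, deg (i + 1) s = deg i t + 1.
Proof.
exists (qt (deg i t + 1)); rewrite -[RHS]deg_cl; congr deg.
by apply/esym/(deg_succ m_gt1 (t := t) (s := qt (deg i t + 1))); rewrite deg_cl.
Qed.

Lemma deg_prev (i : 'Z_m) s : exists t, deg (i + 1) s = deg i t + 1.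
Proof.
exists (qt (deg (i + 1) s - 1)); rewrite -[LHS](subrK 1); congr (_ + 1).
rewrite -[LHS]deg_cl; congr deg; apply: (addIr 1).
by apply/esym/(deg_succ m_gt1 (t := qt (deg (i + 1) s - 1)) (s := s)); rewrite deg_cl // subrK.
Qed.

End CompressionGrading.

(** * Bounded summands of periodic complexes *)

Section Density.
Variables (k : fieldType) (A : falgType k) (m : nat) (m_gt1 : (1 < m)%N).

Local Notation "'F' X" := (compress m_gt1 X) (at level 10, X at level 9).
Local Notation Fm f := (compress_map m_gt1 f).

Lemma periodic_fin_supp (M : complex A 'Z_m) : fin_supp M.
Proof. by exists (enum 'Z_m) => i; rewrite mem_enum. Qed.

Section Unroll.
Variable M : complex A 'Z_m.

Definition unroll_diff (i j : int) : {linear M (cl m i) -> M (cl m j)} :=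
  if j == i + 1 then cdiff M (cl m i) (cl m j) else (\0 : {linear M (cl m i) -> M (cl m j)}).

Lemma unroll_shape i j : j <> i + 1 -> forall x, unroll_diff i j x = 0.
Proof. by move=> /eqP/negPf ij x; rewrite /unroll_diff ij. Qed.

Lemma unroll_diffK i j l x : unroll_diff j l (unroll_diff i j x) = 0.
Proof.
rewrite /unroll_diff; case: ifP => _; case: ifP => _ //=; rewrite ?cdiffK ?linear0 //.
Qed.

(** The right adjoint of compression, with values in unbounded complexes. *)
Definition unroll : complex A int := Complex unroll_shape unroll_diffK.

Lemma unroll_diffE i j x : j = i + 1 -> cdiff unroll i j x = cdiff M (cl m i) (cl m j) x.
Proof. by move=> ij; rewrite /= /unroll_diff ij eqxx. Qed.

End Unroll.

Variable nu : nat.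
Hypotheses (nu_ge1 : (1 <= nu)%N) (A_sgldim : is_sgldim A nu).

(** The components of an indecomposable summand of a truncation of the
unrolled complex commute with the differential of M because the summand stays
away from the ends of the window. *)
Lemma local_summand (M : complex A 'Z_m) : (1 : cmap M M) <> 0 ->
  exists (N : bcomplex A) (al : cmap (F N) M) (be : cmap M (F N)),
    indec N /\ unF (be \oc al) = 1.
Proof.
move=> /nonzero_degree[i0 Mi0]; pose j0 : int := deg i0 0.
(* One degree more than the width on both sides, so that a summand nonzero
in the middle has its neighbouring degrees inside the window. *)
pose P j := `|j - j0| <= nu.+1%:Z.
pose T := trunc (unroll M) P.
pose inc j : {linear T j -> M (cl m j)} := tinc (unroll M) P j.
pose prj j : {linear M (cl m j) -> T j} := tprj (unroll M) P j.
have incK j x : prj j (inc j x) = x by exact: (@tincK _ _ (unroll M) P).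
have prjK j x : P j -> inc j (prj j x) = x by apply: (@tprjK _ _ (unroll M) P j x).
have dT i j x : j = i + 1 -> cdiff T i j x = prj j (cdiff M (cl m i) (cl m j) (inc i x)).
  by move=> ij; rewrite tdiffE unroll_diffE.
have bT : bounded T.
  exists (j0 - nu.+1%:Z), (j0 + nu.+1%:Z) => j out; apply: trunc_out.
  by apply: contra out; rewrite /P; lia.
have Tj0 : ~ zero_module (T j0).
  move=> T0; apply: Mi0; rewrite -(cl_deg m_gt1 i0 0) -/j0 => x.
  rewrite -(prjK _ x) ?(T0 (prj _ _)) ?linear0 //.
  by rewrite /P subrr normr0.
have [N0 [i [p [pi iN Nj0]]]] := indec_retract (bounded_fin_supp bT) Tj0.
have bN := bounded_retract pi bT; pose N := BComplex bN.
have piE j x : p j (i j x) = x by rewrite -[RHS]/((1 : cmap N0 N0) j x) -pi.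
have near j : ~ zero_module (N j) -> `|j - j0| <= nu%:Z.
  move=> Nj; have := indec_width nu_ge1 A_sgldim bN iN Nj Nj0.
  by have := indec_width nu_ge1 A_sgldim bN iN Nj0 Nj; lia.
pose a j : {linear N j -> M (cl m j)} := inc j \o i j.
pose b j : {linear M (cl m j) -> N j} := p j \o prj j.
have ba j x : b j (a j x) = x by rewrite -[LHS]/(p j (prj j (inc j (i j x)))) incK piE.
have da j l x : l = j + 1 -> a l (cdiff N j l x) = cdiff M (cl m j) (cl m l) (a j x).
  move=> jl; have [Nj|/near Nj] := pselect (zero_module (N j)); first by rewrite (Nj x) !linear0.
  rewrite -[LHS]/(inc l (i l (cdiff N0 j l x))) cmap_comm dT // prjK // /P.
  by lia.
have db j l y : l = j + 1 -> b l (cdiff M (cl m j) (cl m l) y) = cdiff N j l (b j y).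
  move=> jl; have [Nl|/near Nl] := pselect (zero_module (N l)).
    by rewrite [LHS]Nl [RHS]Nl.
  rewrite -[RHS]/(cdiff N0 j l (p j (prj j y))) -cmap_comm dT // prjK // /P.
  by lia.
have ex_al c := compress_elim m_gt1 (fun t => cst M (cl m (deg c t)) c \o a (deg c t)).
pose al_fun c := sval (cid (ex_al c)).
have alE c t x : al_fun c (demb m_gt1 N c t x) = cst M (cl m (deg c t)) c (a (deg c t) x).
  by rewrite /al_fun; case: cid.
have ex_be c := compress_intro m_gt1 (X := N) (i := c) (fun t => b (deg c t) \o cst M c (cl m (deg c t))).
pose be_fun c := sval (cid (ex_be c)).
have beE c t y : dprj m_gt1 N c t (be_fun c y) = b (deg c t) (cst M c (cl m (deg c t)) y).
  by rewrite /be_fun; case: cid.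
have al_comm c d y : al_fun d (cdiff (F N) c d y) = cdiff M c d (al_fun c y).
  have [cd|/eqP cd] := eqVneq d (c + 1); last by rewrite !cdiff_shape ?linear0.
  subst d; move: y; suff E : (al_fun (c + 1) \o cdiff (F N) c (c + 1) : {linear F N c -> M (c + 1)})
      = (cdiff M c (c + 1) \o al_fun c) by move=> y; exact: (congr1 (fun h : {linear F N c -> M (c + 1)} => h y) E).
  apply: compress_ext => t x; have [s ts] := deg_next m_gt1 c t.
  rewrite -[LHS]/(al_fun _ (cdiff _ _ _ _)) -[RHS]/(cdiff _ _ _ (al_fun _ _)) (diff_demb m_gt1 _ ts).
  rewrite !alE da // cst_diff_r ?cl_deg // cst_diff_l ?cl_deg //.
have be_comm c d y : be_fun d (cdiff M c d y) = cdiff (F N) c d (be_fun c y).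
  have [cd|/eqP cd] := eqVneq d (c + 1); last by rewrite !cdiff_shape ?linear0.
  subst d; apply: compressP => s; have [t ts] := deg_prev m_gt1 c s.
  by rewrite (diff_dprj _ ts) !beE -db // cst_diff_r ?cl_deg // cst_diff_l ?cl_deg.
exists N, (CMap al_comm), (CMap be_comm); split=> //.
apply: (deg_ext m_gt1) => c t x; rewrite unFE -[LHS]/(dprj m_gt1 N c t (be_fun c (al_fun c _))).
rewrite beE alE [cst M c _ _](_ : _ = a (deg c t) x) ?ba //.
by move: (a _ x); rewrite cl_deg // => z; rewrite !cst_id.
Qed.

End Density.

(** * Compression is dense and preserves indecomposability *)

Section Locality.
Variables (k : fieldType) (A : falgType k) (m : nat) (m_gt1 : (1 < m)%N).

Local Notation "'F' X" := (compress m_gt1 X) (at level 10, X at level 9).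
Local Notation Fm f := (compress_map m_gt1 f).

Lemma unFD (X Y : bcomplex A) (u v : cmap (F X) (F Y)) : unF (u + v) = unF u + unF v.
Proof. by apply: (deg_ext m_gt1) => i t x; rewrite cDE !unFE cDE linearD. Qed.

Lemma unF0 (X Y : bcomplex A) : unF (0 : cmap (F X) (F Y)) = 0.
Proof. by apply: (deg_ext m_gt1) => i t x; rewrite unFE linear0. Qed.

Lemma unF_sum (X Y : bcomplex A) (J : Type) (w : seq J) (u : J -> cmap (F X) (F Y)) :
  unF (\sum_(j <- w) u j) = \sum_(j <- w) unF (u j).
Proof. by elim: w => [|j w IH]; rewrite ?big_nil ?unF0 // !big_cons unFD IH. Qed.

Lemma unF_cpart (X Y : bcomplex A) (u : cmap (F X) (F Y)) : unF (cpart 0 u) = unF u.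
Proof. by apply: (deg_ext m_gt1) => i t x; rewrite !unFE cpartE hpartE addr0 eqxx. Qed.

Lemma unF_Fm (X Y : bcomplex A) (f : cmap X Y) : unF (Fm f) = f.
Proof. by rewrite -[Fm f]ccomp1l unF_compr unF1 ccomp1l. Qed.

Lemma Fm_reflects_iso (X Y : bcomplex A) (f : cmap X Y) : isomorphism (Fm f) -> isomorphism f.
Proof.
move=> /isoE[v [vf fv]]; apply/isoE; exists (unF v); split.
  by rewrite -unF_compr vf unF1.
by rewrite -unF_compl fv unF1.
Qed.

Lemma homog_iso (X Y : bcomplex A) (u : cmap (F X) (F Y)) :
  chomog 0 u -> isomorphism u <-> isomorphism (unF u).
Proof.
move=> hu; rewrite -{1}(unF_full hu); split; first exact: Fm_reflects_iso.
exact: Fm_iso.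
Qed.

(** The degree-zero part of a product in a graded ring. *)
Lemma unF_comp_sum (X Y Z : bcomplex A) : exists n, forall (u : cmap (F Y) (F Z)) (v : cmap (F X) (F Y)),
  unF (u \oc v) = \sum_(r <- window n) unF (cpart (- r) u \oc cpart r v).
Proof.
have [n nP] := cpart_sum m_gt1 X Y; exists n => u v.
rewrite -unF_cpart {1}(nP v) -unF_sum; congr unF.
transitivity (cpart 0 (\sum_(r <- window n) u \oc cpart r v)).
  by congr (cpart 0 _); apply: cmapP => i x; rewrite [LHS]/= !csumE linear_sum.
rewrite cpart_bigsum; apply: eq_bigr => r _.
by rewrite -(cpart_compr _ _ (@cpart_homog _ _ _ _ _ r v)) addNr.
Qed.

Section NonIso.
Variable N : bcomplex A.
Hypothesis iN : indec N.

(** A support stable under a nonzero translation is unbounded. *)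
Lemma unbounded_orbit (r : int) : r != 0 ->
  (forall j, ~ zero_module (N j) -> ~ zero_module (N (j - r))) -> False.
Proof.
move=> r0 step; have [j Nj] := nonzero_degree iN.1.
have orb n : ~ zero_module (N (j - r *+ n)).
  by elim: n => [|n IH]; rewrite ?subr0 // mulrSr opprD addrA; apply: step.
have [a [b Nab]] := bc_bounded N.
have /Nab/orb[] : ~~ (a <= j - r *+ (absz a + absz b + absz j).+1 <= b).
by rewrite -mulr_natr natz; nia.
Qed.

(** If p q were invertible with q of nonzero degree - r, every nonzero term of
N would be embedded by q into the term r degrees below. *)
Lemma nonzero_degree_not_iso (r : int) (p q : cmap (F N) (F N)) : r != 0 ->
  chomog r p -> chomog (- r) q -> ~ isomorphism (p \oc q).
Proof.
move=> r0 hp hq /isoE[v [_ pqv]]; apply: (unbounded_orbit r0) => j.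
pose q' := q \oc cpart 0 v.
have hq' : chomog (- r) q'.
  by have := chomog_comp hq (@cpart_homog _ _ _ _ _ 0 v); rewrite add0r.
have hpq : chomog 0 (p \oc q) by have := chomog_comp hp hq; rewrite addNr.
have pq' : p \oc q' = 1.
  rewrite ccompA -(cpart_compl _ _ hpq) pqv addr0; apply: cpart_id; exact: homog1.
rewrite -(deg_cl m_gt1 j); move: (cl m j) (qt m j) => i t Nt Nu.
apply: Nt => x; have -> : x = dprj m_gt1 N i t (p i (q' i (demb m_gt1 N i t x))).
  by rewrite -[p i _]/((p \oc q') i (demb m_gt1 N i t x)) pq' dprjK.
rewrite (homog_local (z := 0) (hp i)) ?linear0 // => u ut; rewrite linear0.
have uE : deg i u = deg i t - r by rewrite -ut addrK.
by move: (dprj _ _ _ _ _); rewrite uE => y; apply: Nu.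
Qed.

(** In the degree-zero part of u v only the product of the degree-zero parts
can be invertible.  So the maps with non-invertible degree-zero part form an
ideal. *)
Lemma unF_comp_iso (u v : cmap (F N) (F N)) :
  isomorphism (unF (u \oc v)) -> isomorphism (unF u) /\ isomorphism (unF v).
Proof.
have [n ->] := unF_comp_sum N N N.
have fN := bounded_fin_supp (bc_bounded N).
move=> /(indec_iso_sum fN iN)[r _]; have [->|r0] := eqVneq r 0.
  rewrite oppr0 -(unF_full (@cpart_homog _ _ m_gt1 _ _ 0 v)) unF_compr !unF_cpart.
  exact: iso_mul.
move=> /(homog_iso _)E; case: (@nonzero_degree_not_iso (- r) (cpart (- r) u) (cpart r v)).
- by rewrite oppr_eq0.
- exact: cpart_homog.
- by rewrite opprK; apply: cpart_homog.
- apply: E; have := chomog_comp (@cpart_homog _ _ m_gt1 _ _ (- r) u) (@cpart_homog _ _ m_gt1 _ _ r v).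
  by rewrite addrN.
Qed.

Variable nu : nat.
Hypotheses (nu_ge1 : (1 <= nu)%N) (A_sgldim : is_sgldim A nu).

(** Otherwise the image M of w contains a local summand F N1 up to maps with
invertible degree-zero part.  Some homogeneous component then identifies N1
with a translate of N, and exhibits an isomorphism of N as the degree-zero
part of a multiple of w, against [unF_comp_iso]. *)
Lemma radical_idempotent (w : cmap (F N) (F N)) : w * w = w -> ~ isomorphism (unF w) -> w = 0.
Proof.
move=> ww nw; apply: contrapT => w0.
have [M [i [p [pi ip]]]] := split_idem ww.
have M0 : (1 : cmap M M) <> 0.
  by move=> M0; apply: w0; rewrite -ip -[i]ccomp1r M0 ccomp0r ccomp0l.
have [N1 [al [be [iN1 ba]]]] := local_summand m_gt1 nu_ge1 A_sgldim M0.
pose u := be \oc p; pose v := i \oc al.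
have uv : unF (u \oc v) = 1 by rewrite -ccompA (ccompA p) pi ccomp1l.
have uw : u = u \oc w by rewrite -ip ccompA -(ccompA be) pi ccomp1r.
have [n sumE] := unF_comp_sum N1 N N1.
have fN1 := bounded_fin_supp (bc_bounded N1).
have [r _ ir] : exists2 r, r \in window n & isomorphism (unF (cpart (- r) u \oc cpart r v)).
  by apply: (indec_iso_sum fN1 iN1); rewrite -sumE uv; apply: iso1.
have hPQ : chomog 0 (cpart (- r) u \oc cpart r v).
  by have := chomog_comp (@cpart_homog _ _ m_gt1 _ _ (- r) u) (@cpart_homog _ _ m_gt1 _ _ r v); rewrite addrN.
have [c0 [_ PQc0]] := (isoE _).1 ir.
(* G is a right inverse of the homogeneous part of u; both are homogeneous
of opposite degrees, so the idempotent that they define comes from N. *)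
pose G := cpart r v \oc Fm c0.
have hG : chomog r G.
  by have := chomog_comp (@cpart_homog _ _ m_gt1 _ _ r v) (Fm_homog m_gt1 c0); rewrite add0r.
have PG : cpart (- r) u \oc G = 1.
  by rewrite ccompA -(unF_full hPQ) -Fm_comp PQc0 Fm1.
have hGP : chomog 0 (G \oc cpart (- r) u).
  by have := chomog_comp hG (@cpart_homog _ _ m_gt1 _ _ (- r) u); rewrite addNr.
have GPM : (G \oc cpart (- r) u) * (G \oc cpart (- r) u) = G \oc cpart (- r) u.
  by rewrite cmulE ccompA -(ccompA G) PG ccomp1r.
have : isomorphism (unF ((G \oc u) \oc w)).
  rewrite -ccompA -uw -unF_cpart.
  have -> : cpart 0 (G \oc u) = G \oc cpart (- r) u by rewrite -(cpart_compl _ _ hG) addNr.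
  have idem : unF (G \oc cpart (- r) u) * unF (G \oc cpart (- r) u) = unF (G \oc cpart (- r) u).
    by rewrite cmulE -unF_compr (unF_full hGP) -cmulE GPM.
  have [e0|->] := iN.2 _ idem; last exact: iso1.
  have GP0 : G \oc cpart (- r) u = 0.
    by rewrite -(unF_full hGP) e0; apply: cmapP => j y; apply: dsumP.
  have F0 : (1 : cmap (F N1) (F N1)) = 0.
    by rewrite -[LHS]mulr1 -PG cmulE -ccompA (ccompA G) GP0 ccomp0l ccomp0r.
  by case: iN1.1; rewrite -(unF1 m_gt1) F0 unF0.
by move=> /unF_comp_iso[].
Qed.

(** After normalization u = 1 - v with v of degree-zero part zero.  The
Fitting idempotent of v is a multiple of v, hence vanishes by
[radical_idempotent], so v is nilpotent. *)
Lemma iso_of_degree_zero (u : cmap (F N) (F N)) : isomorphism (unF u) -> isomorphism u.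
Proof.
move=> /isoE[c0 [c0u _]]; pose v := 1 - Fm c0 \oc u.
have v0 : unF v = 0.
  apply: (addIr (unF (Fm c0 \oc u))); rewrite -unFD subrK add0r unF1.
  by rewrite unF_compl c0u.
have nv (w : cmap (F N) (F N)) : ~ isomorphism (unF (v \oc w)).
  by move=> iw; have [iv _] := unF_comp_iso iw; apply: (iso0F iN); rewrite -v0.
have fF := periodic_fin_supp (F N).
have [n [c [vc reg]]] := fitting fF v.
case: n reg => [|n] reg.
  by case: (nv c); rewrite -cmulE -[v]expr1 -reg unF1; apply: iso1.
have w0 : (v * c) ^+ n.+1 = 0.
  by apply: radical_idempotent; rewrite ?(regular_idem vc reg) // exprS -mulrA; apply: nv.
have vn : v ^+ n.+1 = 0 by rewrite -(regular_absorb reg n.+1) w0 mulr0.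
have := nilpotent_iso1B fF vn; rewrite opprB addrC subrK.
by move=> /(iso_mul fF)[].
Qed.

End NonIso.

Variable nu : nat.
Hypotheses (nu_ge1 : (1 <= nu)%N) (A_sgldim : is_sgldim A nu).

(** For the maps of [local_summand], the composite on F N is invertible; the
other composite gives a nonzero idempotent of M, which must be the identity.
*)
Lemma density (M : complex A 'Z_m) : indec M ->
  exists (N : bcomplex A) (phi : cmap M (F N)), indec N /\ isomorphism phi.
Proof.
move=> iM; have [N [al [be [iN ba]]]] := local_summand m_gt1 nu_ge1 A_sgldim iM.1.
exists N, be; split=> //.
have /isoE[c [cba bac]] : isomorphism (be \oc al).
  by apply: (iso_of_degree_zero iN nu_ge1 A_sgldim); rewrite ba; apply: iso1.
apply/isoE; exists (al \oc c); split; last by rewrite ccompA.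
have [|e0|//] := iM.2 (al \oc c \oc be).
  by rewrite cmulE !ccompA -(ccompA _ be al) -(ccompA al) cba ccomp1r.
case: iN.1; rewrite -ba -[be]ccomp1l -bac -!ccompA (ccompA c) (ccompA al) (ccompA al) e0.
by rewrite ccomp0l !ccomp0r unF0.
Qed.

End Locality.

(** * Transfer of almost split sequences along isomorphisms *)

Section SequenceIsomorphisms.
Variables A I : nzRingType.

Lemma bijective_iso (X Y : complex A I) (b : cmap X Y) :
  (forall i x, b i x = 0 -> x = 0) -> (forall i y, exists x, b i x = y) -> isomorphism b.
Proof.
move=> inj sur; have binj i : injective (b i).
  by move=> x y /eqP; rewrite -subr_eq0 -linearB => /eqP/inj/eqP; rewrite subr_eq0 => /eqP.
pose c i := projT1 (choice (sur i)).
have cE i y : b i (c i y) = y := projT2 (choice (sur i)) y.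
have lc i : linear (c i).
  by move=> a x y; apply: (binj i); rewrite linearP !cE.
have c_comm i j y : mk_linear (lc j) (cdiff Y i j y) = cdiff X i j (mk_linear (lc i) y).
  by apply: (binj j); rewrite cmap_comm /= !cE.
apply/isoE; exists (CMap c_comm); split; apply: cmapP => i x /=; last exact: cE.
by apply: (binj i); rewrite cE.
Qed.

Lemma short_five (X Y Z X' Y' Z' : complex A I) (f : cmap X Y) (g : cmap Y Z)
    (f' : cmap X' Y') (g' : cmap Y' Z') (a : cmap X X') (b : cmap Y Y') (c : cmap Z Z') :
  conflation f g -> conflation f' g' -> isomorphism a -> isomorphism c ->
  b \oc f = f' \oc a -> g' \oc b = c \oc g -> isomorphism b.
Proof.
move=> cfl cfl' /isoE[a' [a'a aa']] /isoE[c' [c'c cc']] bf gb.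
have bfE i x : b i (f i x) = f' i (a i x) by rewrite -[LHS]/((b \oc f) i x) bf.
have gbE i y : g' i (b i y) = c i (g i y) by rewrite -[LHS]/((g' \oc b) i y) gb.
have a'aE i x : a' i (a i x) = x by rewrite -[RHS]/((1 : cmap X X) i x) -a'a.
have aa'E i x : a i (a' i x) = x by rewrite -[RHS]/((1 : cmap X' X') i x) -aa'.
have c'cE i x : c' i (c i x) = x by rewrite -[RHS]/((1 : cmap Z Z) i x) -c'c.
have cc'E i x : c i (c' i x) = x by rewrite -[RHS]/((1 : cmap Z' Z') i x) -cc'.
apply: bijective_iso => i y.
  move=> by0; have [_ ex _] := cfl i; have [inj' _ _] := cfl' i.
  have /ex[x xy] : g i y = 0 by rewrite -[LHS]c'cE -gbE by0 !linear0.
  rewrite -xy -[x]a'aE (_ : a i x = 0) ?linear0 //.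
  by apply: inj'; rewrite -bfE xy linear0.
have [_ _ [s gs]] := cfl i; have [_ ex' _] := cfl' i.
pose x := s (c' i (g' i y)).
have /ex'[z zE] : g' i (y - b i x) = 0 by rewrite linearB /= gbE gs cc'E subrr.
by exists (f i (a' i z) + x); rewrite linearD /= bfE aa'E zE subrK.
Qed.

Section Transfer.
Variables (X Y Z X' Y' Z' : complex A I) (f : cmap X Y) (g : cmap Y Z).
Variables (f' : cmap X' Y') (g' : cmap Y' Z').

Lemma seq_isoE : seq_iso f g f' g' -> exists (a : cmap X X') (b : cmap Y Y') (c : cmap Z Z')
    (a' : cmap X' X) (b' : cmap Y' Y) (c' : cmap Z' Z),
  [/\ a' \oc a = 1 /\ a \oc a' = 1, b' \oc b = 1 /\ b \oc b' = 1, c' \oc c = 1 /\ c \oc c' = 1,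
      b \oc f = f' \oc a & c \oc g = g' \oc b].
Proof.
move=> [a [b [c [/isoE[a' aE] /isoE[b' bE] /isoE[c' cE] /cmapP bf /cmapP cg]]]].
by exists a, b, c, a', b', c'.
Qed.

Lemma seq_iso_sym : seq_iso f g f' g' -> seq_iso f' g' f g.
Proof.
move=> /seq_isoE[a [b [c [a' [b' [c' [[a'a aa'] [b'b bb'] [c'c cc'] bf cg]]]]]]].
exists a', b', c'; split.
- by apply/isoE; exists a.
- by apply/isoE; exists b.
- by apply/isoE; exists c.
- have -> : b' \oc f' = f \oc a' by rewrite -[f']ccomp1r -aa' !ccompA -(ccompA b') -bf !ccompA b'b ccomp1l.
  by [].
- have -> : c' \oc g' = g \oc b' by rewrite -[g']ccomp1r -bb' !ccompA -(ccompA c') -cg !ccompA c'c ccomp1l.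
  by [].
Qed.

Lemma conflation_transfer : seq_iso f g f' g' -> conflation f g -> conflation f' g'.
Proof.
move=> /seq_isoE[a [b [c [a' [b' [c' [[a'a aa'] [b'b bb'] [c'c cc'] bf cg]]]]]]] cfl i.
have bfE x : b i (f i x) = f' i (a i x) by rewrite -[LHS]/((b \oc f) i x) bf.
have cgE y : g' i (b i y) = c i (g i y) by rewrite -[LHS]/((g' \oc b) i y) -cg.
have a'aE x : a' i (a i x) = x by rewrite -[RHS]/((1 : cmap X X) i x) -a'a.
have aa'E x : a i (a' i x) = x by rewrite -[RHS]/((1 : cmap X' X') i x) -aa'.
have b'bE x : b' i (b i x) = x by rewrite -[RHS]/((1 : cmap Y Y) i x) -b'b.
have bb'E x : b i (b' i x) = x by rewrite -[RHS]/((1 : cmap Y' Y') i x) -bb'.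
have c'cE x : c' i (c i x) = x by rewrite -[RHS]/((1 : cmap Z Z) i x) -c'c.
have cc'E x : c i (c' i x) = x by rewrite -[RHS]/((1 : cmap Z' Z') i x) -cc'.
have [inj ex [s gs]] := cfl i; split.
- move=> x y fxy; rewrite -[x]aa'E -[y]aa'E; congr (a i _); apply: inj.
  by rewrite -[LHS]b'bE -[RHS]b'bE !bfE !aa'E fxy.
- move=> y; split=> [gy|[x <-]].
    have /ex[x xE] : g i (b' i y) = 0 by rewrite -[LHS]c'cE -cgE bb'E gy linear0.
    by exists (a i x); rewrite -bfE xE bb'E.
  rewrite -[x]aa'E -bfE cgE (_ : g i _ = 0) ?linear0 //; apply/ex; by exists (a' i x).
- exists (b i \o (s \o c' i)) => z; by rewrite /= cgE gs cc'E.
Qed.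

Variable C : complex A I -> Prop.

Lemma left_transfer : seq_iso f g f' g' ->
  left_almost_split C f /\ left_minimal f -> left_almost_split C f' /\ left_minimal f'.
Proof.
move=> /seq_isoE[a [b [c [a' [b' [c' [[a'a aa'] [b'b bb'] _ bf _]]]]]]] [[nf ext] min].
split; [split|].
- move=> /sectionE[r rf]; apply: nf; apply/sectionE; exists (a' \oc r \oc b).
  by rewrite -ccompA bf -!ccompA (ccompA r) rf ccomp1l a'a.
- move=> W CW h nh; have [|h' /cmapP h'f] := ext W CW (h \oc a).
    move=> /sectionE[v vha]; apply: nh; apply/sectionE; exists (a \oc v).
    by rewrite -[_ \oc h]ccomp1r -aa' -!ccompA (ccompA h) (ccompA v) vha ccomp1l.
  exists (h' \oc b'); have -> : h' \oc b' \oc f' = h; last by [].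
  rewrite -[f']ccomp1r -aa' (ccompA f') -bf -!ccompA (ccompA b') b'b ccomp1l.
  by rewrite ccompA h'f -ccompA aa' ccomp1r.
- move=> e /cmapP ef; have ie : isomorphism (b' \oc e \oc b).
    apply: min; have -> : b' \oc e \oc b \oc f = f; last by [].
    by rewrite -ccompA bf -!ccompA (ccompA e) ef -bf ccompA b'b ccomp1l.
  have -> : e = b \oc (b' \oc e \oc b) \oc b'.
    by rewrite !ccompA bb' ccomp1l -ccompA bb' ccomp1r.
  apply: iso_comp; last by apply/isoE; exists b.
  by apply: iso_comp => //; apply/isoE; exists b'.
Qed.

Lemma right_transfer : seq_iso f g f' g' ->
  right_almost_split C g /\ right_minimal g -> right_almost_split C g' /\ right_minimal g'.
Proof.
move=> /seq_isoE[a [b [c [a' [b' [c' [_ [b'b bb'] [c'c cc'] _ cg]]]]]]] [[ng lift] min].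
have gE : g = c' \oc g' \oc b by rewrite -ccompA -cg ccompA c'c ccomp1l.
split; [split|].
- move=> /retractionE[r gr]; apply: ng; apply/retractionE; exists (b' \oc r \oc c).
  by rewrite gE -!ccompA (ccompA b) bb' ccomp1l (ccompA g') gr ccomp1l c'c.
- move=> W CW h nh; have [|h' /cmapP gh'] := lift W CW (c' \oc h).
    move=> /retractionE[v chv]; apply: nh; apply/retractionE; exists (v \oc c').
    by rewrite -[h \oc _]ccomp1l -cc' -!ccompA (ccompA h) (ccompA c') (ccompA c') chv ccomp1l.
  exists (b \oc h'); have -> : g' \oc (b \oc h') = h; last by [].
  by rewrite ccompA -cg -ccompA gh' ccompA cc' ccomp1l.
- move=> e /cmapP ge; have ie : isomorphism (b' \oc e \oc b).
    apply: min; have -> : g \oc (b' \oc e \oc b) = g; last by [].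
    by rewrite {1}gE -!ccompA (ccompA b) bb' ccomp1l (ccompA g') ge ccompA -gE.
  have -> : e = b \oc (b' \oc e \oc b) \oc b'.
    by rewrite !ccompA bb' ccomp1l -ccompA bb' ccomp1r.
  apply: iso_comp; last by apply/isoE; exists b.
  by apply: iso_comp => //; apply/isoE; exists b'.
Qed.

Lemma almost_split_transfer : seq_iso f g f' g' -> [/\ C X', C Y' & C Z'] ->
  almost_split C f g -> almost_split C f' g'.
Proof.
move=> iso CC [_ cfl la ra]; split=> //.
- exact: conflation_transfer.
- exact: left_transfer.
- exact: right_transfer.
Qed.

End Transfer.

Lemma seq_iso_trans (X Y Z X' Y' Z' X'' Y'' Z'' : complex A I) (f : cmap X Y) (g : cmap Y Z)
    (f' : cmap X' Y') (g' : cmap Y' Z') (f'' : cmap X'' Y'') (g'' : cmap Y'' Z'') :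
  seq_iso f g f' g' -> seq_iso f' g' f'' g'' -> seq_iso f g f'' g''.
Proof.
move=> [a [b [c [ia ib ic /cmapP bf /cmapP cg]]]] [a' [b' [c' [ia' ib' ic' /cmapP bf' /cmapP cg']]]].
exists (a' \oc a), (b' \oc b), (c' \oc c); split; try exact: iso_comp.
- have -> : b' \oc b \oc f = f'' \oc (a' \oc a) by rewrite -ccompA bf !ccompA bf'.
  by [].
- have -> : c' \oc c \oc g = g'' \oc (b' \oc b) by rewrite -ccompA cg !ccompA cg'.
  by [].
Qed.

End SequenceIsomorphisms.

(** * Homogeneous extension classes *)

Section Homogenization.
Variables (k : fieldType) (A : falgType k) (m : nat) (m_gt1 : (1 < m)%N).

Local Notation "'F' X" := (compress m_gt1 X) (at level 10, X at level 9).
Local Notation Fm f := (compress_map m_gt1 f).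

Lemma compress_conflation (X Y Z : bcomplex A) (f : cmap X Y) (g : cmap Y Z) :
  conflation f g -> conflation (Fm f) (Fm g).
Proof.
move=> cfl; have [s [r [gs rf gf rs frsg]]] := conflation_splitting cfl; move=> i.
have FfE t x : dprj m_gt1 Y i t (Fm f i x) = f (deg i t) (dprj m_gt1 X i t x) by [].
have FgE t y : dprj m_gt1 Z i t (Fm g i y) = g (deg i t) (dprj m_gt1 Y i t y) by [].
have [R RE] := compress_intro m_gt1 (fun t => r (deg i t) \o dprj m_gt1 Y i t).
have [S SE] := compress_intro m_gt1 (fun t => s (deg i t) \o dprj m_gt1 Z i t).
split.
- move=> x y fxy; apply: compressP => t; rewrite -[LHS]rf -[RHS]rf -!FfE.
  by rewrite fxy.
- move=> y; split=> [gy|[x <-]].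
    exists (R y); apply: compressP => t; rewrite FfE RE /= -[RHS]frsg.
    by rewrite -FgE gy !linear0 addr0.
  by apply: compressP => t; rewrite FgE FfE gf linear0.
- by exists S => z; apply: compressP => t; rewrite FgE SE /= gs.
Qed.

Lemma hpart_at (X Y : bcomplex A) (i j : 'Z_m) r (p : {linear F X i -> F Y j}) t s z :
  deg i t + r = deg j s ->
  dprj m_gt1 Y j s (hpart r p z) = dprj m_gt1 Y j s (p (demb m_gt1 X i t (dprj m_gt1 X i t z))).
Proof.
move=> ts; rewrite (homog_local (z := demb m_gt1 X i t (dprj m_gt1 X i t z)) (hpart_homog p)).
  by rewrite hpartE ts eqxx.
move=> u us; have -> : u = t by apply: (deg_inj m_gt1 (i := i)); apply: (addIr r); rewrite us ts.
by rewrite dprjK.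
Qed.

(** A cocycle of this form is zero in Ext^1: the extension that it classifies
splits. *)
Definition coboundary (Z X : complex A 'Z_m) (phi : forall i j, {linear Z i -> X j}) : Prop :=
  exists sg : forall i, {linear Z i -> X i}, forall i z,
    phi i (i + 1) z = cdiff X i (i + 1) (sg i z) - sg (i + 1) (cdiff Z i (i + 1) z).

Section HomogeneousClass.
Variables (N' N : bcomplex A) (Y : complex A 'Z_m) (f : cmap (F N') Y) (g : cmap Y (F N)).
Variables (s : forall i, {linear F N i -> Y i}) (r : forall i, {linear Y i -> F N' i}).
Hypotheses (gs : forall i z, g i (s i z) = z) (rf : forall i x, r i (f i x) = x).
Hypotheses (gf : forall i x, g i (f i x) = 0).
Hypothesis frsg : forall i y, f i (r i y) + s i (g i y) = y.

(** The cocycle of the extension with respect to a degreewise splitting. *)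
Definition ext_class i j : {linear F N i -> F N' j} := r j \o (cdiff Y i j \o s i).

Lemma f_inj i : injective (f i). Proof. exact: (can_inj (@rf i)). Qed.

(** The defect of the splitting s to commute with the differentials. *)
Lemma f_ext_class i j z :
  f j (ext_class i j z) = cdiff Y i j (s i z) - s j (cdiff (F N) i j z).
Proof.
by rewrite -[in RHS](frsg (cdiff Y i j (s i z))) cmap_comm gs addrK.
Qed.

Lemma ext_class_cocycle i j l z :
  cdiff (F N') j l (ext_class i j z) + ext_class j l (cdiff (F N) i j z) = 0.
Proof.
apply: f_inj; rewrite linearD linear0 cmap_comm !f_ext_class linearB.
by rewrite !cdiffK linear0 subr0 sub0r addNr.
Qed.

Lemma ext_class_shape i j z : j <> i + 1 -> ext_class i j z = 0.
Proof. by move=> ij; rewrite [LHS]/= cdiff_shape // linear0. Qed.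

Lemma ext_class_coboundary : coboundary ext_class -> retraction g.
Proof.
move=> [sg sgE]; have wc i j z : (s j \- (f j \o sg j)) (cdiff (F N) i j z)
    = cdiff Y i j ((s i \- (f i \o sg i)) z).
  have [ij|/eqP ij] := eqVneq j (i + 1); last by rewrite !cdiff_shape ?linear0.
  subst j; pose S := s (i + 1) (cdiff (F N) i (i + 1) z).
  rewrite -[LHS]/(S - f (i + 1) (sg (i + 1) (cdiff (F N) i (i + 1) z))).
  rewrite -[X in _ = cdiff _ _ _ X]/(s i z - f i (sg i z)) linearB -cmap_comm.
  have -> : cdiff Y i (i + 1) (s i z) = f (i + 1) (ext_class i (i + 1) z) + S.
    by rewrite f_ext_class subrK.
  by rewrite sgE linearB addrAC [f _ (cdiff _ _ _ _) - _]addrC addrK addrC.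
apply/retractionE; exists (@CMap _ _ (F N) Y (fun i => s i \- (f i \o sg i)) wc).
by apply: cmapP => i z; rewrite /= linearB /= gs gf subr0.
Qed.

Hypothesis ncob : ~ coboundary (fun i j => hpart 1 (ext_class i j)).

(** The component of degree one of the extension class, as a cocycle on
bounded complexes. *)
Definition hclass (i j : int) : {linear N i -> N' j} :=
  if j == i + 1 then unf (ext_class (cl m i) (cl m j)) else (\0 : {linear N i -> N' j}).

Lemma hclass_shape i j : j <> i + 1 -> forall x, hclass i j x = 0.
Proof. by move=> /eqP/negPf ij x; rewrite /hclass ij. Qed.

Lemma hclassE i j t u x : deg j u = deg i t + 1 ->
  hclass (deg i t) (deg j u) x = dprj m_gt1 N' j u (ext_class i j (demb m_gt1 N i t x)).
Proof. by move=> /eqP tu; rewrite /hclass tu (unfE ext_class). Qed.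

Lemma hclass_cocycle i j l x :
  cdiff N' j l (hclass i j x) + hclass j l (cdiff N i j x) = 0.
Proof.
have [ij|/eqP ij] := eqVneq j (i + 1); last first.
  by rewrite hclass_shape // [cdiff N _ _ _]cdiff_shape // !linear0 addr0.
have [jl|/eqP jl] := eqVneq l (j + 1); last first.
  by rewrite (hclass_shape jl) [cdiff N' _ _ _]cdiff_shape // addr0.
move: ij jl x; rewrite -(deg_cl m_gt1 i) -(deg_cl m_gt1 j) -(deg_cl m_gt1 l).
move: (cl m i) (cl m j) (cl m l) (qt m i) (qt m j) (qt m l) => a b c t u v tu uv x.
rewrite !hclassE // -(diff_dprj _ uv) -(diff_demb m_gt1 _ tu) -linearD.
by rewrite ext_class_cocycle linear0.
Qed.

Definition hext : complex A int := twist hclass_shape hclass_cocycle.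

Lemma hext_bounded : exists a b, concentrated a b hext.
Proof. by apply: twist_bounded; apply: bc_bounded. Qed.
Definition bhext : bcomplex A := BComplex hext_bounded.

Definition hin : cmap N' bhext := twist_in hclass_shape hclass_cocycle.
Definition hout : cmap bhext N := twist_out hclass_shape hclass_cocycle.

Lemma hconflation : conflation hin hout. Proof. exact: twist_conflation. Qed.

Hypotheses (iN' : indec N') (nu : nat) (nu_ge1 : (1 <= nu)%N) (A_sgldim : is_sgldim A nu).
Hypothesis ass : almost_split (fun _ => True) f g.

(** Pulling the given sequence back along F E -> F N yields b and its
restriction a. By the short five lemma it is enough that a is invertible.  If
not, all its homogeneous parts are non-sections and factor through f as h f;
then h s is a homotopy showing that this part kills the extension class, and
its part of the right degree shows the same for the component of degree one.
Summing up, a times that component is a coboundary, which corrects b to a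
section of g. *)
Lemma homogeneous_representative : exists (a : cmap (F N') (F N')) (b : cmap (F bhext) Y),
  [/\ isomorphism a, isomorphism b, b \oc Fm hin = f \oc a & g \oc b = Fm hout].
Proof.
have [_ cfl [[nf extend] _] [[ng lift] _]] := ass.
have ex_jj i := compress_intro m_gt1 (X := bhext) (i := i)
  (fun t => pairr (N' (deg i t)) (N (deg i t)) \o dprj m_gt1 N i t).
pose jj i := projT1 (cid (ex_jj i)).
have jjE i t z : dprj m_gt1 bhext i t (jj i z) = (0, dprj m_gt1 N i t z) := projT2 (cid (ex_jj i)) t z.
have ex_rh i := compress_intro m_gt1 (X := N') (i := i)
  (fun t => (fst : {linear bhext (deg i t) -> N' (deg i t)}) \o dprj m_gt1 bhext i t).
pose rh i := projT1 (cid (ex_rh i)).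
have rhE i t e : dprj m_gt1 N' i t (rh i e) = (dprj m_gt1 bhext i t e).1 := projT2 (cid (ex_rh i)) t e.
have inE i t x : dprj m_gt1 bhext i t (Fm hin i x) = (dprj m_gt1 N' i t x, 0) by [].
have outE i t e : dprj m_gt1 N i t (Fm hout i e) = (dprj m_gt1 bhext i t e).2 by [].
pose th i j := hpart 1 (ext_class i j).
have out_jj i z : Fm hout i (jj i z) = z by apply: compressP => t; rewrite outE jjE.
have out_in i x : Fm hout i (Fm hin i x) = 0 by apply: compressP => t; rewrite outE inE linear0.
have rh_in i x : rh i (Fm hin i x) = x by apply: compressP => t; rewrite rhE inE.
have rh_jj i z : rh i (jj i z) = 0 by apply: compressP => t; rewrite rhE jjE linear0.
have decomp i e : e = Fm hin i (rh i e) + jj i (Fm hout i e).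
  apply: compressP => t; rewrite linearD inE jjE outE rhE.
  by case: (dprj _ _ _ _ _) => x y; congr pair; rewrite /= ?addr0 ?add0r.
have djj i z : cdiff (F bhext) i (i + 1) (jj i z)
    = jj (i + 1) (cdiff (F N) i (i + 1) z) + Fm hin (i + 1) (th i (i + 1) z).
  apply: compressP => u; have [t tu] := deg_prev m_gt1 i u.
  rewrite linearD (diff_dprj _ tu) !jjE inE (diff_dprj _ tu) (hpart_at _ _ (esym tu)) -hclassE //.
  by congr pair; rewrite /= ?linear0 ?add0r ?addr0.
have nout : ~ retraction (Fm hout).
  move=> /retractionE[v vE]; apply: ncob; exists (fun i => \- (rh i \o v i)) => i z.
  have outv j w : Fm hout j (v j w) = w by rewrite -[RHS]/((1 : cmap (F N) (F N)) j w) -vE.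
  have E : rh (i + 1) (v (i + 1) (cdiff (F N) i (i + 1) z))
      = cdiff (F N') i (i + 1) (rh i (v i z)) + th i (i + 1) z.
    rewrite cmap_comm [in LHS](decomp i (v i z)) outv linearD -cmap_comm djj.
    by rewrite !linearD !rh_in rh_jj add0r.
  rewrite -[RHS]/(cdiff (F N') i (i + 1) (- rh i (v i z)) - - rh (i + 1) (v (i + 1) _)).
  by rewrite E linearN opprK addKr.
have [b bE] : exists b, g \oc b = Fm hout by have [b /cmapP bE] := lift _ I (Fm hout) nout; exists b.
have bE' i e : g i (b i e) = Fm hout i e by rewrite -[RHS]/(Fm hout i e) -bE.
have gbin i x : g i (b i (Fm hin i x)) = 0 by rewrite bE' out_in.
pose a_fun i : {linear F N' i -> F N' i} := r i \o (b i \o Fm hin i).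
have faE i x : f i (a_fun i x) = b i (Fm hin i x).
  by rewrite -[RHS]frsg gbin linear0 addr0.
have a_comm i j x : a_fun j (cdiff (F N') i j x) = cdiff (F N') i j (a_fun i x).
  by apply: f_inj; rewrite cmap_comm !faE -!cmap_comm.
pose a : cmap (F N') (F N') := CMap a_comm.
have fa : b \oc Fm hin = f \oc a by apply: cmapP => i x; rewrite [RHS]faE.
have ia : isomorphism a; last first.
  exists a, b; split=> //.
  apply: (short_five (compress_conflation hconflation) cfl ia (iso1 (F N)) fa).
  by rewrite bE ccomp1l.
apply: contrapT => na; have fF := periodic_fin_supp (F N').
(* A part of nonzero degree is never invertible, and the part of degree zero
   only together with a. *)
have nsec q : ~ section (cpart q a).
  move=> /(endo_section_iso fF) iq; have [q0|q0] := eqVneq q 0.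
    apply: na; apply: (iso_of_degree_zero iN' nu_ge1 A_sgldim).
    by rewrite -unF_cpart; apply/(homog_iso (@cpart_homog _ _ _ _ _ 0 a)); rewrite -q0.
  have /isoE[c [ca ac]] := iq.
  have acq : cpart q a \oc cpart (- q) c = 1.
    rewrite -(cpart_compl _ _ (@cpart_homog _ _ _ _ _ q a)) ac addNr; apply: cpart_id.
    exact: homog1.
  apply: (nonzero_degree_not_iso iN' q0 (@cpart_homog _ _ _ _ _ q a) (@cpart_homog _ _ _ _ _ (- q) c)).
  by rewrite acq; apply: iso1.
(* So every homogeneous part of a factors through f. *)
have ex_h q := extend _ I _ (nsec q).
pose h q := projT1 (cid (ex_h q)).
have hE q i x : h q i (f i x) = cpart q a i x := projT2 (cid (ex_h q)) i x.
have cob q i z : cpart q a (i + 1) (th i (i + 1) z)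
    = cdiff (F N') i (i + 1) (hpart q (h q i \o s i) z)
      - hpart q (h q (i + 1) \o s (i + 1)) (cdiff (F N) i (i + 1) z).
  have hd (W : bcomplex A) : homog 1 (cdiff (F W) i (i + 1)) by move=> t u x; apply: diff_homog.
  apply/eqP; rewrite eq_sym subr_eq; apply/eqP.
  rewrite -(hpart_compl _ _ _ (hd N')) -(hpart_compr _ _ _ (hd N)).
  rewrite /th -(hpart_compl 1 _ _ (@cpart_homog _ _ _ _ _ q a (i + 1))) [1 + q]addrC -hpartD.
  congr (hpart _ _ _); apply: linear_ext => w.
  rewrite -[LHS]/(cdiff (F N') i (i + 1) (h q i (s i w))).
  rewrite -[RHS]/(cpart q a (i + 1) (ext_class i (i + 1) w)
                  + h q (i + 1) (s (i + 1) (cdiff (F N) i (i + 1) w))).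
  by rewrite -hE f_ext_class linearB subrK cmap_comm.
have [n aE] := cpart_sum m_gt1 N' N'.
pose Sg i z := \sum_(q <- window n) hpart q (h q i \o s i) z.
have Sg_lin i : linear (Sg i).
  by move=> c x y; rewrite /Sg scaler_sumr -big_split; apply: eq_bigr => q _; rewrite linearP.
have aSg i z : a (i + 1) (th i (i + 1) z)
    = cdiff (F N') i (i + 1) (Sg i z) - Sg (i + 1) (cdiff (F N) i (i + 1) z).
  rewrite {1}(aE a) csumE (eq_bigr _ (fun q _ => cob q i z)) sumrB.
  by rewrite /Sg [cdiff _ _ _ (\sum_(_ <- _) _)]linear_sum.
pose w i : {linear F N i -> Y i} := (b i \o jj i) \- (f i \o mk_linear (Sg_lin i)).
have wE i z : w i z = b i (jj i z) - f i (Sg i z) by [].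
have w_comm i j z : w j (cdiff (F N) i j z) = cdiff Y i j (w i z).
  have [ij|/eqP ij] := eqVneq j (i + 1); last by rewrite !cdiff_shape ?linear0.
  subst j; rewrite !wE linearB -!cmap_comm djj linearD -faE.
  rewrite -[a_fun _ _]/(a (i + 1) (th i (i + 1) z)) aSg linearB addrA addrAC.
  by rewrite addrK.
apply: ng; apply/retractionE; exists (CMap w_comm); apply: cmapP => i z.
rewrite -[LHS]/(g i (w i z)) wE linearB bE' gf subr0.
exact: out_jj.
Qed.

End HomogeneousClass.
End Homogenization.

(** * Translations and shifts *)

Lemma cst_round (A I : nzRingType) (X : complex A I) i j x : i = j -> cst X j i (cst X i j x) = x.
Proof. by move=> ij; subst j; rewrite !cst_id. Qed.

Section Translation.
Variables (A : nzRingType) (c : int) (X : bcomplex A).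

Let tr_ob i : projmod A := X (i + c).
Let tr_diff i j : {linear tr_ob i -> tr_ob j} := cdiff X (i + c) (j + c).

Lemma tr_shape i j : j <> i + 1 -> forall x, tr_diff i j x = 0.
Proof.
by move=> ij x; apply: cdiff_shape => /eqP; rewrite addrAC (inj_eq (addIr c)) => /eqP.
Qed.

Lemma tr_diffK i j l x : tr_diff j l (tr_diff i j x) = 0.
Proof. exact: cdiffK. Qed.

Lemma tr_bounded : exists a b, concentrated a b (Complex tr_shape tr_diffK).
Proof.
have [a [b Xab]] := bc_bounded X; exists (a - c), (b - c) => i out.
by apply: (Xab (i + c)); move: out; lia.
Qed.

Definition translate : bcomplex A := BComplex tr_bounded.

Variables (m : nat) (m_gt1 : (1 < m)%N) (q : int).
Hypothesis cE : c = q * m%:Z.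

Local Notation "'F' X" := (compress m_gt1 X) (at level 10, X at level 9).

Lemma deg_tr (i : 'Z_m) t : deg i (t + q) = deg i t + c.
Proof. by rewrite cE /deg mulrDl addrA. Qed.

(** Translation by a multiple of m does not change the compression; the
isomorphism has degree - c for the grading by bounded degrees.  There are no
signs here, unlike for the shift. *)
Lemma compress_translate : exists psi : cmap (F X) (F translate), isomorphism psi /\ chomog (- c) psi.
Proof.
have ex_psi i := compress_intro m_gt1 (X := translate) (i := i)
  (fun t => cst X (deg i (t + q)) (deg i t + c) \o dprj m_gt1 X i (t + q)).
pose psi i := projT1 (cid (ex_psi i)).
have psiE i t y : dprj m_gt1 translate i t (psi i y)
    = cst X (deg i (t + q)) (deg i t + c) (dprj m_gt1 X i (t + q) y) := projT2 (cid (ex_psi i)) t y.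
have psi_comm i j y : psi j (cdiff (F X) i j y) = cdiff (F translate) i j (psi i y).
  have [ij|/eqP ij] := eqVneq j (i + 1); last by rewrite !cdiff_shape ?linear0.
  subst j; apply: compressP => u; have [t tu] := deg_prev m_gt1 i u.
  have tuq : deg (i + 1) (u + q) = deg i (t + q) + 1 by rewrite !deg_tr tu addrAC.
  rewrite (diff_dprj _ tu) !psiE (diff_dprj _ tuq).
  by rewrite cst_diff_r ?deg_tr // [RHS]cst_diff_l ?deg_tr.
exists (CMap psi_comm); split; last first.
  move=> i t s x ts; rewrite psiE dprj_out ?linear0 // => tsq; apply: ts.
  by rewrite tsq deg_tr addrK.
apply: bijective_iso => i y.
  move=> py0; apply: compressP => t; rewrite linear0.
  have := psiE i (t - q) y; rewrite [psi i y]py0 linear0 => /esym/(congr1 (cst X _ (deg i (t - q + q)))).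
  by rewrite cst_round ?deg_tr // linear0 subrK.
have [ch chE] := compress_intro m_gt1 (X := X) (i := i)
  (fun t => cst X (deg i (t - q) + c) (deg i t) \o dprj m_gt1 translate i (t - q)).
exists (ch y); apply: compressP => t; rewrite -[LHS]/(dprj m_gt1 translate i t (psi i (ch y))) psiE chE.
rewrite -[LHS]/(cst X (deg i (t + q)) (deg i t + c) (cst X (deg i (t + q - q) + c) (deg i (t + q))
  (dprj m_gt1 translate i (t + q - q) y))).
by move: (t + q - q) (addrK q t) => t' ->; rewrite cst_round ?deg_tr.
Qed.

End Translation.

Section Unshift.
Variables (A : nzRingType) (t : int).

Lemma sign_square : (-1) ^ t * (-1) ^ t = 1 :> int.
Proof. by rewrite -exprMz_comm // mulrNN mulr1 exp1rz. Qed.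

Lemma sign_inverse : (-1) ^ (- t) * (-1) ^ t = 1 :> int.
Proof. by rewrite -exprzDr ?unitrN1 // addNr expr0z. Qed.

Section UnshiftMap.
Variables (X Y : bcomplex A) (u : cmap (shift t X) (shift t Y)).

Definition unshift_fun i : {linear X i -> Y i} :=
  cst Y (i - t + t) i \o (u (i - t) \o cst X i (i - t + t)).

Lemma unshift_funE j x : unshift_fun (j + t) x = u j x.
Proof.
rewrite -[LHS]/(cst Y (j + t - t + t) (j + t) (u (j + t - t) (cst X (j + t) (j + t - t + t) x))).
by move: (j + t - t) (addrK t j) => j' ->; rewrite [LHS]cst_id; congr (u j _); rewrite cst_id.
Qed.

Lemma unshift_comm i j x : unshift_fun j (cdiff X i j x) = cdiff Y i j (unshift_fun i x).
Proof.
move: x; rewrite -(subrK t i) -(subrK t j); move: (i - t) (j - t) => {}i {}j x.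
rewrite !unshift_funE.
have E (W : bcomplex A) (w : W (i + t)) :
    cdiff W (i + t) (j + t) w = cdiff (shift t W) i j w *~ (-1) ^ t.
  by rewrite /= -mulrzA sign_square mulr1z.
rewrite !E -cmap_comm.
by rewrite raddfMz.
Qed.

(** The shift changes the differential by a sign only, so it is fully
faithful. *)
Definition unshift : cmap X Y := CMap unshift_comm.

End UnshiftMap.

Lemma shift_ext (X Y : bcomplex A) (f g : cmap X Y) :
  (forall i x, f (i + t) x = g (i + t) x) -> f = g.
Proof. by move=> fg; apply: cmapP => i; rewrite -(subrK t i). Qed.

Lemma unshift1 (X : bcomplex A) : unshift (1 : cmap (shift t X) (shift t X)) = 1.
Proof. by apply: shift_ext => i x; rewrite [LHS]unshift_funE. Qed.

Lemma unshift_compl (X Y Z : bcomplex A) (f : cmap Y Z) (u : cmap (shift t X) (shift t Y)) :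
  unshift (shift_map t f \oc u) = f \oc unshift u.
Proof.
by apply: shift_ext => i x; rewrite [LHS]unshift_funE -[RHS]/(f _ (unshift u _ x)) [unshift u _ _]unshift_funE.
Qed.

Lemma unshift_compr (X Y Z : bcomplex A) (u : cmap (shift t Y) (shift t Z)) (f : cmap X Y) :
  unshift (u \oc shift_map t f) = unshift u \oc f.
Proof.
by apply: shift_ext => i x; rewrite [LHS]unshift_funE -[RHS]/(unshift u _ (f _ x)) [RHS]unshift_funE.
Qed.

Definition unshift_iso_fun (X : bcomplex A) i : {linear shift t (shift (- t) X) i -> X i} :=
  cst X (i + t - t) i.

Lemma unshift_iso_comm (X : bcomplex A) i j x :
  unshift_iso_fun X j (cdiff (shift t (shift (- t) X)) i j x) = cdiff X i j (unshift_iso_fun X i x).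
Proof.
rewrite [cdiff _ i j x]/= -mulrzA sign_inverse mulr1z.
by rewrite /unshift_iso_fun [LHS]cst_diff_r ?addrK // [RHS]cst_diff_l ?addrK.
Qed.

(** The signs of the two shifts cancel. *)
Definition unshift_iso (X : bcomplex A) : cmap (shift t (shift (- t) X)) X :=
  CMap (@unshift_iso_comm X).

Lemma unshift_iso_iso (X : bcomplex A) : isomorphism (unshift_iso X).
Proof.
apply: bijective_iso => i x.
  rewrite -[unshift_iso X i x]/(cst X (i + t - t) i x) => /(congr1 (cst X i (i + t - t))).
  by rewrite cst_round ?addrK // linear0.
exists (cst X i (i + t - t) x); exact: (cst_round x (esym (addrK t i))).
Qed.

Lemma unshift_iso_natural (X Y : bcomplex A) (f : cmap X Y) :
  unshift_iso Y \oc shift_map t (shift_map (- t) f) = f \oc unshift_iso X.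
Proof. by apply: cmapP => i x; rewrite -[RHS]/(f i (cst X _ i x)) cst_map. Qed.

Variables (m : nat) (m_gt1 : (1 < m)%N).
Local Notation "'F' X" := (compress m_gt1 X) (at level 10, X at level 9).
Local Notation Fm f := (compress_map m_gt1 f).

Lemma shift_map1 (X : bcomplex A) : shift_map t (1 : cmap X X) = 1.
Proof. exact: cmapP. Qed.

Lemma shift_map_comp (X Y Z : bcomplex A) (g : cmap Y Z) (f : cmap X Y) :
  shift_map t (g \oc f) = shift_map t g \oc shift_map t f.
Proof. exact: cmapP. Qed.

Lemma shift_compress_seq_iso (X Y Z : bcomplex A) (f : cmap X Y) (g : cmap Y Z) :
  seq_iso (Fm (shift_map t (shift_map (- t) f))) (Fm (shift_map t (shift_map (- t) g))) (Fm f) (Fm g).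
Proof.
exists (Fm (unshift_iso X)), (Fm (unshift_iso Y)), (Fm (unshift_iso Z)).
split; try (by apply: Fm_iso; apply: unshift_iso_iso).
  by rewrite -!Fm_comp unshift_iso_natural.
by rewrite -!Fm_comp unshift_iso_natural.
Qed.

(** Compression after a shift has a one-sided inverse D on morphisms that is
linear over the image; D carries sections, factorizations and inverses back.
*)
Lemma almost_split_reflect (X Y Z : bcomplex A) (f : cmap X Y) (g : cmap Y Z) :
  conflation f g ->
  almost_split (fun _ : complex A 'Z_m => True) (Fm (shift_map t f)) (Fm (shift_map t g)) ->
  almost_split (@bounded A) f g.
Proof.
pose G (X Y : bcomplex A) (h : cmap X Y) := Fm (shift_map t h).
pose D (X Y : bcomplex A) (u : cmap (F (shift t X)) (F (shift t Y))) := unshift (unF u).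
have G1 V : G V V 1 = 1 by rewrite /G shift_map1 Fm1.
have GM (V W U : bcomplex A) (p : cmap W U) (q : cmap V W) : G _ _ (p \oc q) = G _ _ p \oc G _ _ q.
  by rewrite /G shift_map_comp Fm_comp.
have D1 V : D V V 1 = 1 by rewrite /D unF1 unshift1.
have Dl (V W U : bcomplex A) (p : cmap W U) q : D V U (G _ _ p \oc q) = p \oc D V W q.
  by rewrite /D unF_compl unshift_compl.
have Dr (V W U : bcomplex A) p (q : cmap V W) : D V U (p \oc G _ _ q) = D W U p \oc q.
  by rewrite /D unF_compr unshift_compr.
move=> cfl [_ _ [[nf ext] lmin] [[ng lift] rmin]]; split=> //.
- by split; apply: bc_bounded.
- split; [split|].
  + move=> /sectionE[r rf]; apply: nf; apply/sectionE; exists (G _ _ r).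
    by rewrite -[Fm _]/(G _ _ f) -GM rf G1.
  + move=> W0 bW h nh; pose W := BComplex bW; have [|h' /cmapP h'f] := ext _ I (G X W h).
      move=> /sectionE[v vh]; apply: nh; apply/sectionE; exists (D W X v).
      by apply: etrans (esym (Dr X W X v h)) _; rewrite vh D1.
    exists (D Y W h'); have -> : D Y W h' \oc f = h; last by [].
    apply: etrans (esym (Dr X Y W h' f)) _; rewrite h'f.
    by rewrite -[X in D _ _ X]ccomp1l Dr D1 ccomp1l.
  + move=> e /cmapP ef; have /isoE[v [ve ev]] : isomorphism (G _ _ e).
      apply: lmin; have -> : G _ _ e \oc Fm (shift_map t f) = Fm (shift_map t f); last by [].
      by rewrite -[Fm _]/(G _ _ f) -GM ef.
    apply/isoE; exists (D Y Y v); split; first by rewrite -Dr ve D1.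
    by rewrite -Dl ev D1.
- split; [split|].
  + move=> /retractionE[r gr]; apply: ng; apply/retractionE; exists (G _ _ r).
    by rewrite -[Fm _]/(G _ _ g) -GM gr G1.
  + move=> W0 bW h nh; pose W := BComplex bW; have [|h' /cmapP gh'] := lift _ I (G W Z h).
      move=> /retractionE[v hv]; apply: nh; apply/retractionE; exists (D Z W v).
      by apply: etrans (esym (Dl Z W Z h v)) _; rewrite hv D1.
    exists (D W Y h'); have -> : g \oc D W Y h' = h; last by [].
    apply: etrans (esym (Dl W Y Z g h')) _; rewrite gh'.
    by rewrite -[X in D _ _ X]ccomp1l Dr D1 ccomp1l.
  + move=> e /cmapP ge; have /isoE[v [ve ev]] : isomorphism (G _ _ e).
      apply: rmin; have -> : Fm (shift_map t g) \oc G _ _ e = Fm (shift_map t g); last by [].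
      by rewrite -[Fm (shift_map t g)]/(G _ _ g) -GM ge.
    apply/isoE; exists (D Y Y v); split; first by rewrite -Dr ve D1.
    by rewrite -Dl ev D1.
Qed.

End Unshift.

(** * Almost split sequences of periodic complexes *)

Section PeriodicSequences.
Variables (k : fieldType) (A : falgType k) (m : nat) (m_gt1 : (1 < m)%N).

Local Notation "'F' X" := (compress m_gt1 X) (at level 10, X at level 9).
Local Notation Fm f := (compress_map m_gt1 f).

Lemma compress_indec_reflect (N : bcomplex A) : indec (F N) -> indec N.
Proof.
have Fm0 : Fm (0 : cmap N N) = 0 by apply: cmapP => i y; apply: dsumP.
move=> [F0 idem]; split=> [N0|e ee]; first by apply: F0; rewrite -Fm1 N0 Fm0.
have FF : Fm e * Fm e = Fm e by rewrite cmulE -Fm_comp -cmulE ee.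
have [Fe|Fe] := idem _ FF; [left|right]; rewrite -(unF_Fm m_gt1 e) Fe.
  exact: unF0.
exact: unF1.
Qed.

(** If all homogeneous components were coboundaries then so would be their
sum; and components of a degree not congruent to one modulo m vanish. *)
Lemma homogeneous_component (N N' : bcomplex A) (phi : forall i j, {linear F N i -> F N' j}) :
  (forall i j z, j <> i + 1 -> phi i j z = 0) -> ~ coboundary phi ->
  exists q : int, ~ coboundary (fun i j => hpart (1 + q * m%:Z) (phi i j)).
Proof.
move=> shape ncob; have [n nP] := hpart_sum m_gt1 N N'.
have [r nr] : exists r, ~ coboundary (fun i j => hpart r (phi i j)).
  apply: contrapT => /forallNP cob; apply: ncob.
  have [sg sgE] := choice (fun r => contrapT (cob r)).
  have lin i : linear (fun z => \sum_(r <- window n) sg r i z).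
    by move=> c x y; rewrite scaler_sumr -big_split; apply: eq_bigr => r _; rewrite linearP.
  exists (fun i => mk_linear (lin i)) => i z; rewrite (nP i (i + 1) (phi i (i + 1))).
  rewrite (eq_bigr _ (fun r _ => sgE r i z)) sumrB.
  by congr (_ - _); apply/esym; apply: linear_sum.
suff [q rE] : exists q, r = 1 + q * m%:Z by exists q; rewrite -rE.
apply: contrapT => /forallNP nq; apply: nr; exists (fun i => \0) => i z.
suff -> : hpart r (phi i (i + 1)) = \0.
  by rewrite -[RHS]/(cdiff (F N') i (i + 1) 0 - 0) subr0 linear0.
apply: compress_ext => t x; apply: compressP => u; rewrite hpartE [RHS]/=.
case: eqP => // tu; have [t' tu'] := deg_prev m_gt1 i u.
by case: (nq (t' - t)); move: tu; rewrite tu' /deg; lia.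
Qed.

Variable nu : nat.
Hypotheses (nu_ge1 : (1 <= nu)%N) (A_sgldim : is_sgldim A nu).

Lemma almost_split_compressed (X Y Z : complex A 'Z_m) (f : cmap X Y) (g : cmap Y Z) :
  almost_split (fun _ : complex A 'Z_m => True) f g ->
  exists (X' Y' Z' : bcomplex A) (f' : cmap X' Y') (g' : cmap Y' Z'),
    conflation f' g' /\ seq_iso (Fm f') (Fm g') f g.
Proof.
move=> ass; have [_ _ [fl _] [gr _]] := ass.
have iX := left_almost_split_indec (C := fun _ => True) I fl.
have iZ := right_almost_split_indec (C := fun _ => True) I gr.
have [N1 [phiX [iN1 ix]]] := density m_gt1 nu_ge1 A_sgldim iX.
have [N [phiZ [iN iz]]] := density m_gt1 nu_ge1 A_sgldim iZ.
have /isoE[psX [pX Xp]] := ix; have /isoE[psZ [pZ Zp]] := iz.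
pose f1 := f \oc psX; pose g1 := phiZ \oc g.
have s1 : seq_iso f1 g1 f g.
  exists psX, 1, psZ; split.
  - by apply/isoE; exists phiX.
  - exact: iso1.
  - by apply/isoE; exists phiZ.
  - by rewrite ccomp1l.
  - by rewrite ccomp1r /g1 ccompA pZ ccomp1l.
have ass1 : almost_split (fun _ => True) f1 g1.
  by apply: almost_split_transfer (seq_iso_sym s1) _ ass.
have [_ cfl1 _ [[ng1 _] _]] := ass1.
have [s [r [gs rf gf rs frsg]]] := conflation_splitting cfl1.
have shape i j z : j <> i + 1 -> ext_class s r i j z = 0 by apply: ext_class_shape.
have [q nq] : exists q : int, ~ coboundary (fun i j => hpart (1 + q * m%:Z) (ext_class s r i j)).
  apply: homogeneous_component => // cob; apply: ng1.
  exact: (ext_class_coboundary gs gf frsg cob).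
(* The component of degree 1 + q m of the class becomes the one of degree 1
after translating N1. *)
have [psi [ip hpsi]] := compress_translate N1 m_gt1 (erefl (q * m%:Z)).
have /isoE[chi [cp pc]] := ip; set N' := translate _ _ in psi ip hpsi chi cp pc.
have cpE i x : chi i (psi i x) = x by rewrite -[RHS]/((1 : cmap (F N1) (F N1)) i x) -cp.
have pcE i x : psi i (chi i x) = x by rewrite -[RHS]/((1 : cmap (F N') (F N')) i x) -pc.
pose f2 := f1 \oc chi.
have s2 : seq_iso f2 g1 f1 g1.
  exists chi, 1, 1; split=> //; try exact: iso1.
    by apply/isoE; exists psi.
have ass2 : almost_split (fun _ => True) f2 g1.
  by apply: almost_split_transfer (seq_iso_sym s2) _ ass1.
have iN' : indec N'.
  have [_ _ [f2l _] _] := ass2.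
  exact: compress_indec_reflect (left_almost_split_indec (C := fun _ => True) I f2l).
pose r2 i : {linear Y i -> F N' i} := psi i \o r i.
have r2E i y : r2 i y = psi i (r i y) by [].
have rf2 i x : r2 i (f2 i x) = x by rewrite r2E rf pcE.
have gf2 i x : g1 i (f2 i x) = 0 by apply: gf.
have frsg2 i y : f2 i (r2 i y) + s i (g1 i y) = y.
  by rewrite -[f2 i _]/(f1 i (chi i (psi i (r i y)))) cpE frsg.
have ncob2 : ~ coboundary (fun i j => hpart 1 (ext_class s r2 i j)).
  move=> [sg sgE]; apply: nq; exists (fun i => chi i \o sg i) => i z.
  rewrite -[LHS]cpE.
  have -> : psi (i + 1) (hpart (1 + q * m%:Z) (ext_class s r i (i + 1)) z)
      = hpart 1 (ext_class s r2 i (i + 1)) z.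
    rewrite -(hpart_compl _ _ _ (hpsi (i + 1))) addrK; congr (hpart _ _ _).
  by rewrite sgE linearB cmap_comm.
have [a [b [ia ib bf gb]]] :=
  homogeneous_representative gs rf2 gf2 frsg2 ncob2 iN' nu_ge1 A_sgldim ass2.
exists N', (bhext gs rf2 frsg2), N, (hin gs rf2 frsg2), (hout gs rf2 frsg2).
split; first exact: hconflation.
apply: seq_iso_trans (seq_iso_trans s2 s1).
exists a, b, 1; split=> //; first exact: iso1.
  by rewrite bf.
by rewrite gb ccomp1l.
Qed.

End PeriodicSequences.

Lemma shift_conflation (A : nzRingType) (t : int) (X Y Z : bcomplex A) (f : cmap X Y) (g : cmap Y Z) :
  conflation f g -> conflation (shift_map t f) (shift_map t g).
Proof. by move=> cfl i; apply: (cfl (i + t)). Qed.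

Lemma almost_split_subcategory (A I : nzRingType) (C D : complex A I -> Prop)
    (X Y Z : complex A I) (f : cmap X Y) (g : cmap Y Z) :
  (forall W, D W -> C W) -> [/\ D X, D Y & D Z] -> almost_split C f g -> almost_split D f g.
Proof.
move=> DC DD [_ cfl [[nf ext] lm] [[ng lift] rm]]; split=> //.
  by split=> //; split=> // W /DC; apply: ext.
by split=> //; split=> // W /DC; apply: lift.
Qed.

Theorem theorem4p2 (k : fieldType) (A : falgType k) (nu : nat)
    (nu_ge1 : (1 <= nu)%N) (A_sgldim : is_sgldim A nu)
    (m : nat) (m_ge2 : (2 <= m)%N)
    (X Y Z : complex A 'Z_m) (f : cmap X Y) (g : cmap Y Z)
    (fg_ass : almost_split (fun _ : complex A 'Z_m => True) f g) :
  exists (t : int) (X' Y' Z' : bcomplex A) (f' : cmap X' Y') (g' : cmap Y' Z'),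
    almost_split (concentrated 1 (nu.+1)%:Z) f' g' /\
    seq_iso (compress_map m_ge2 (shift_map t f'))
            (compress_map m_ge2 (shift_map t g')) f g.
Proof.
have [N' [E [N [f0 [g0 [cfl s0]]]]]] := almost_split_compressed m_ge2 nu_ge1 A_sgldim fg_ass.
have s1 t := seq_iso_trans (shift_compress_seq_iso t m_ge2 f0 g0) s0.
have ass t : almost_split (@bounded A) (shift_map (- t) f0) (shift_map (- t) g0).
  apply: (almost_split_reflect (t := t) (m_gt1 := m_ge2) (shift_conflation _ cfl)).
  by apply: almost_split_transfer (seq_iso_sym (s1 t)) _ fg_ass.
have [c [cX cY cZ]] := almost_split_span nu_ge1 A_sgldim (bc_bounded (shift (- 0) N'))
  (bc_bounded (shift (- 0) E)) (bc_bounded (shift (- 0) N)) (shift_conflation (- 0) cfl) (ass 0).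
(* The sequence is almost split after every shift; the shift by 0 locates
its span, and the shift by t moves this span to [1, nu + 1]. *)
pose t := 1 - c.
have conc (W : bcomplex A) : concentrated c (c + nu%:Z) (shift (- 0) W) ->
    concentrated 1 (nu.+1)%:Z (shift (- t) W).
  move=> cW i out; have := cW (i - t).
  have {}out : ~~ (c <= i - t <= c + nu%:Z) by move: out; rewrite /t; lia.
  have it0 : i - t + - 0 = i - t by rewrite oppr0 addr0.
  by move=> /(_ out); rewrite [X in zero_module X]/= it0.
exists t, (shift (- t) N'), (shift (- t) E), (shift (- t) N), (shift_map (- t) f0), (shift_map (- t) g0).
split; last exact: s1.
apply: almost_split_subcategory (ass t); first by move=> W cW; exists 1, (nu.+1)%:Z.
by split; apply: conc.
Qed.
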